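(* Let $(G,S_E^+)$ be an edge-signed map, where $S_E^+$ assigns the sign $+$ to every edge, and suppose that $med(G)$ is a $2$-antipodally symmetric map, realized by $\alpha_2$. If $\alpha_2$ is color-preserving, then $L(G,S_E^+)$ is $3$-antipodally symmetric.
   Context: Maps. A map $G=(V,E,F)$ is (the image of) an embedding in $\mathbb{S}^2$ of a connected finite planar graph (loops and multiple edges allowed), $F$ being the set of faces. $G^*$ is its geometric dual. An edge-signed map $(G,S_E)$ is a map with a function $S_E:E\to\{+,-\}$. Medial map. $med(G)$ is the 4-regular map with one vertex on each edge of $G$, two vertices being joined when the corresponding edges are consecutive on a face of $G$. Each face of $med(G)$ contains exactly one vertex of $G$ or exactly one vertex of $G^*$; it is colored black in the first case and white in the second. Links. $D(G,S_E)$ is the link diagram on $\mathbb{S}^2$ with shadow $med(G)$; the crossing on an edge $e$ has sign $S_E(e)$, where for an observer in a black face at a crossing, looking at the crossing (from outside the sphere), a positive crossing is one where the strand on the observer's left passes over the one on the right, a negative crossing is the opposite. $L(G,S_E)$ is the link represented by $D(G,S_E)$ in $\mathbb{R}^3\subset\mathbb{S}^3=\mathbb{R}^3\cup\{\infty\}$. Two links are equivalent if an orientation-preserving homeomorphism of the ambient space maps one onto the other; $[L]$ is the class of links equivalent to $L$. Antipodal symmetry. $\alpha_n:\mathbb{S}^n\to\mathbb{S}^n$, $x\mapsto -x$. A map $M$ is $2$-antipodally symmetric (realized by $\alpha_2$) if it can be drawn in $\mathbb{S}^2$ so that $\alpha_2(M)=M$. For $M=med(G)$ with its face-coloring, $\alpha_2$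 is color-preserving if $f$ and $\alpha_2(f)$ have the same color for every face $f$. A link $L$ is $3$-antipodally symmetric if there is $\hat L\in[L]$, $\hat L\subset\mathbb{S}^3$, with $\alpha_3(\hat L)=\hat L$. *)

(* Defs.v *)
From HB Require Import structures.
From mathcomp Require Import all_boot all_order all_algebra.
From mathcomp Require Import all_classical all_reals all_analysis.
Import Order.TTheory GRing.Theory Num.Theory numFieldNormedType.Exports.

Set Implicit Arguments.
Unset Strict Implicit.
Unset Printing Implicit Defensive.

Local Open Scope classical_set_scope.
Local Open Scope ring_scope.

Section Spheres.
Variable R : realType.

(* The topology of 'rV[R]_m is the usual one, but the library norm on it is
   the sup norm, hence this explicit Euclidean norm. *)
Definition normsq m (x : 'rV[R]_m) : R := \sum_i x ord0 i ^+ 2.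

Definition sphere n : set 'rV[R]_n.+1 := [set x | normsq x = 1].
Arguments sphere n _ : clear implicits.

Definition antipode n (x : 'rV[R]_n.+1) : 'rV[R]_n.+1 := - x.

(* Only the values of h on the sphere matter. *)
Definition sphere_homeo n (h : 'rV[R]_n.+1 -> 'rV[R]_n.+1) : Prop :=
  exists g : 'rV[R]_n.+1 -> 'rV[R]_n.+1,
    [/\ {homo h : x / sphere n x} /\ {homo g : x / sphere n x},
        {within sphere n, continuous h},
        {within sphere n, continuous g},
        {in sphere n, cancel h g} & {in sphere n, cancel g h}].

(* Preserving the orientation of S^n means having degree 1.  The degree of a
   self-map of S^n is its class in [S^n, S^n] = Z (n >= 1), so degree 1 means
   being homotopic to the identity. *)
Definition orientation_preserving n (h : 'rV[R]_n.+1 -> 'rV[R]_n.+1) : Prop :=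
  exists H : R * 'rV[R]_n.+1 -> 'rV[R]_n.+1,
    [/\ {within `[0, 1] `*` sphere n, continuous H},
        (forall (t : R) x, 0 <= t <= 1 -> sphere n x -> sphere n (H (t, x))),
        (forall x, sphere n x -> H (0, x) = x)
      & (forall x, sphere n x -> H (1, x) = h x)].

(* The inclusion of R^m in S^m = R^m + oo, with oo = (0, .., 0, 1). *)
Definition inv_stereo m (x : 'rV[R]_m) : 'rV[R]_(m + 1) :=
  row_mx ((2 / (normsq x + 1)) *: x)
         (const_mx ((normsq x - 1) / (normsq x + 1))).

Definition link_equiv (L L' : set 'rV[R]_4) : Prop :=
  exists h, [/\ sphere_homeo (n := 3) h, orientation_preserving (n := 3) h
              & h @` L = L'].

Definition antipodally_symmetric3 (L : set 'rV[R]_4) : Prop :=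
  exists L' : set 'rV[R]_4,
    [/\ L' `<=` sphere 3, link_equiv L L' & antipode (n := 3) @` L' = L'].

End Spheres.
Arguments sphere {R} n _.

Section Maps.
Variable R : realType.

(* Vertices are points, and each edge e is a path [earc e] parametrized by
   [0, 1].  Its two ends are indexed by booleans: false for the parameter 0,
   true for the parameter 1. *)
Record drawing := Drawing {
  vertex : finType;
  edge : finType;
  vpos : vertex -> 'rV[R]_3;
  earc : edge -> R -> 'rV[R]_3;
  endpt : edge -> bool -> vertex }.

Definition end_param (s : bool) : R := (s : nat)%:R.

Definition vertices (G : drawing) : set 'rV[R]_3 := range (@vpos G).

Definition arc_set (G : drawing) (e : edge G) : set 'rV[R]_3 :=
  earc e @` `[0, 1].

Definition skeleton (G : drawing) : set 'rV[R]_3 :=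
  vertices G `|` \bigcup_(e in [set: edge G]) arc_set e.

Definition face_at (G : drawing) (x : 'rV[R]_3) : set 'rV[R]_3 :=
  connected_component (sphere 2 `\` skeleton G) x.

Definition is_face (G : drawing) (f : set 'rV[R]_3) : Prop :=
  exists2 x, (sphere 2 `\` skeleton G) x & f = face_at G x.

Record is_map (G : drawing) : Prop := IsMap {
  map_nonempty : vertices G !=set0;
  map_sphere : skeleton G `<=` sphere 2;
  map_vpos : injective (@vpos G);
  map_arc : forall e : edge G, {within `[0, 1], continuous (earc e)};
  map_ends : forall (e : edge G) s, earc e (end_param s) = vpos (endpt e s);
  map_interior : forall (e : edge G) (t : R) (v : vertex G), 0 < t < 1 -> earc e t <> vpos v;
  map_embedded : forall (e e' : edge G) (t t' : R),
    0 < t < 1 -> 0 < t' < 1 -> earc e t = earc e' t' -> e = e' /\ t = t';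
  map_connected : connected (skeleton G) }.

Definition redraw (phi : 'rV[R]_3 -> 'rV[R]_3) (G : drawing) : drawing :=
  {| vpos := fun v : vertex G => phi (vpos v);
     earc := fun (e : edge G) t => phi (earc e t);
     endpt := @endpt G |}.

Definition antipode_invariant (M : drawing) : Prop :=
  antipode (n := 2) @` vertices M = vertices M /\
  antipode (n := 2) @` skeleton M = skeleton M.

Definition regular4 (M : drawing) : Prop :=
  forall v : vertex M,
    #|[set a : edge M * bool | endpt a.1 a.2 == v]%SET| = 4%N.

(* The part of the arc of e between its end s and its point of parameter c. *)
Definition half_edge (G : drawing) (e : edge G) (s : bool) (c : R) :
    set 'rV[R]_3 :=
  if s then earc e @` `[c, 1] else earc e @` `[0, c].

(* M is a drawing of med(G), with vertex p e on the edge e.  The last clause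
   says that every edge m of M joins two edges of G that are consecutive on a
   face of G: together with half-edges of G issuing from a common vertex, m
   bounds a region U disjoint from G and M, i.e. m cuts off a corner of a face
   of G.  Different edges of M cut off different corners, and G has as many
   corners as the 4-regular map M has edges (twice the number of edges of G),
   so that each corner of G is cut off exactly once. The two half-edges
   coincide when the corner is at a vertex of degree 1. *)
Definition is_medial (G M : drawing) (p : edge G -> vertex M) : Prop :=
  exists c : edge G -> R,
    [/\ [/\ is_map M, regular4 M & bijective p],
        forall e, 0 < c e < 1 /\ vpos (p e) = earc e (c e),
        skeleton G `&` skeleton M = vertices M
      & forall m : edge M, exists e s e' s' x (U := connected_component
            (sphere 2 `\` (skeleton G `|` skeleton M)) x),
        [/\ endpt m false = p e /\ endpt m true = p e',
            endpt e s = endpt e' s',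
            (sphere 2 `\` (skeleton G `|` skeleton M)) x
          & closure U `\` U =
              arc_set m `|` half_edge e s (c e) `|` half_edge e' s' (c e')]].

(* A face of med(G) is black if it contains a vertex of G, white otherwise. *)
Definition black (G : drawing) (f : set 'rV[R]_3) : Prop :=
  exists v : vertex G, f (vpos v).

Definition color_preserving (G M : drawing) : Prop :=
  forall f, is_face M f -> (black G f <-> black G (antipode (n := 2) @` f)).

End Maps.

Section Diagrams.
Variable R : realType.
Implicit Types G M : drawing R.

(* The loop th |-> chi (cos th, sin th) winds once counterclockwise around q,
   for an observer outside the sphere: (u, v, q) is a positive basis, and a is
   a continuous angle of the loop in the plane (u, v), along q. *)
Definition counterclockwise (chi : R * R -> 'rV[R]_3) (q : 'rV[R]_3) : Prop :=
  exists (u v : 'rV[R]_3) (r a b : R -> R),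
    [/\ 0 < \det (\matrix_(i < 3) nth 0 [:: u; v; q] i),
        {within `[0, 2 * pi], continuous a},
        a (2 * pi) = a 0 + 2 * pi
      & forall th : R, 0 <= th <= 2 * pi -> 0 < r th /\
          chi (cos th, sin th) =
          r th *: (cos (a th) *: u + sin (a th) *: v) + b th *: q].

Definition square : set (R * R) := [set z | `|z.1| <= 1 /\ `|z.2| <= 1].

(* A local picture of M at its vertex w, seen from outside the sphere: in the
   (x, y)-coordinates given by chi, M is the pair of diagonals, and the black
   sectors are those containing the y-axis. *)
Definition crossing_chart G M (w : vertex M) (chi : R * R -> 'rV[R]_3) : Prop :=
  [/\ [/\ {within square, continuous chi}, {in square &, injective chi}
        & chi @` square `<=` sphere 2],
      chi (0, 0) = vpos w /\ counterclockwise chi (vpos w),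
      forall x y : R, square (x, y) -> (skeleton M (chi (x, y)) <-> `|x| = `|y|)
    & forall x y : R, square (x, y) -> `|x| <> `|y| ->
        (black G (face_at M (chi (x, y))) <-> `|x| < `|y|)].

(* The crossing at w, where [over m s] tells whether the strand through w
   arriving along the end s of m is the one passing over.  The observer in
   the black sector {y < - |x|}, looking at the crossing, has on the left the
   arm {x = y < 0}, hence the strand {x = y}; the same strand is on the left
   in the opposite black sector. So the crossing is positive (sg = true) if
   {x = y} passes over, and negative if {x = - y} passes over. *)
Definition crossing_sign G M (over : edge M -> bool -> bool) (w : vertex M)
    (sg : bool) : Prop :=
  exists2 chi : R * R -> 'rV[R]_3, crossing_chart G w chi &
    forall (m : edge M) (s : bool), endpt m s = w ->
    exists2 d : R, 0 < d & forall t : R, 0 < t < 1 -> `|t - end_param R s| < d ->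
      exists x y, [/\ square (x, y), earc m t = chi (x, y)
                    & x = if over m s == sg then y else - y].

(* The link diagram with shadow M and crossings [over] is D(G, S), where
   S e = true stands for the sign + *)
Definition is_diagram G (S : edge G -> bool) M (p : edge G -> vertex M)
    (over : edge M -> bool -> bool) : Prop :=
  forall e, crossing_sign G over (p e) (S e).

(* L projects radially onto the shadow M; above each crossing the over strand
   is farther from the origin, i.e. closer to an observer outside the sphere. *)
Definition represented_by M (over : edge M -> bool -> bool)
    (L : set 'rV[R]_3) : Prop :=
  exists (rho : edge M -> R -> R) (lo hi : vertex M -> R),
    [/\ forall m, {within `[0, 1], continuous (rho m)},
        forall m (t : R), 0 <= t <= 1 -> 0 < rho m t,
        forall w, lo w < hi w,
        forall m s, rho m (end_param R s) =
          if over m s then hi (endpt m s) else lo (endpt m s)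
      & L = \bigcup_(m in [set: edge M])
              [set rho m t *: earc m t | t in `[0, 1]]].

(* L is the link L(G, S), as a subset of S^3, drawn from the medial map M. *)
Definition link_of_map G (S : edge G -> bool) M (p : edge G -> vertex M)
    (L : set 'rV[R]_4) : Prop :=
  exists (over : edge M -> bool -> bool) (L0 : set 'rV[R]_3),
    [/\ is_diagram S p over, represented_by over L0
      & L = @inv_stereo R 3 @` L0].

End Diagrams.

(* Main.v *)
Require Import Defs.
From HB Require Import structures.
From mathcomp Require Import all_boot all_order all_algebra.
From mathcomp Require Import all_classical all_reals all_analysis.
From mathcomp Require Import zify ring lra.
Import Order.TTheory GRing.Theory Num.Theory numFieldNormedType.Exports.

(** Let psi = phi^-1 o (-) o phi be the antipodal symmetry of the redrawn map,
   carried back to the sphere on which M lies.  It is an involution without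
   fixed points, which preserves M, its vertices and the colours of its faces
   ([conjugate_vertex], [conjugate_skeleton], [conjugate_black]).

   S^3 is the suspension of S^2: a point is given by a direction u in S^2 and a
   height y in [-1, 1], the antipodal map is (u, y) |-> (- u, - y), and a point
   at distance rho from the origin of R^3 has the height
   (rho^2 - 1) / (rho^2 + 1) ([stereo_cone], [cone_opp]).  If f is a
   homeomorphism of S^2 homotopic to the identity, and T u is for each u an
   increasing homeomorphism of [-1, 1], then (u, y) |-> (f u, T u y) is an
   orientation-preserving homeomorphism of S^3 ([susp_homeo],
   [susp_orientation]).  It is applied to f = phi or f = - phi, one of which is
   homotopic to the identity ([homeo_homotopic]); in both cases
   f (psi u) = - f u.  So the image of the link is antipodally symmetric as soon
   as the transformed heights over u and psi u are opposite for every u inside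
   an edge of M; the crossings follow by continuity ([strands_antipodal]).

   In a coordinate of ]-1, 1[ in which T u can be any translation, the heights
   over u and psi u become opposite after translating each of them by minus half
   of their sum.  The difficulty lies at the crossings, where two strands have to
   be translated together.  A first change of heights puts all the strands at
   the crossings at heights 1/2 and -1/2 ([level_crossings]).  Then the
   translation extends continuously by 0 to the vertices of M, provided that psi
   maps the upper strand of each crossing to the lower strand of its image, and
   from M it extends to S^2 ([symmetric_heights]).

   Why does psi exchange upper and lower strands?  Seen from outside the sphere, in
   a chart where the strands are the diagonals and the black sectors contain the
   vertical axis, the upper strand at a positive crossing is always the diagonal
   x = y.  As psi has no fixed points, it reverses the orientation, as the
   antipodal map does; and it preserves the colours.  A map between two crossings
   that preserves the colours of the sectors and reverses the orientation, such
   as a reflection in an axis, exchanges the two diagonals ([strands_swapped]).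

   The facts about maps of S^2 are obtained from winding numbers of plane loops.
   A homeomorphism of the sphere that fixes the poles has winding number 1 or -1
   on the equator, and this number determines its homotopy class
   ([homotopic_fix_poles]); general homeomorphisms are reduced to this case by
   moving two points to the poles ([axis_homeo]).  If a map without fixed points
   exchanges the poles, and maps no other point to a pole, then it preserves the
   winding number around the axis of a small loop around one pole
   ([wind_pole_swap], [wind_mult]), although a loop seen as counterclockwise from
   outside turns in opposite directions around the axis at the two poles: so the
   orientation is reversed ([opposite_winds]). *)

Set Implicit Arguments.
Unset Strict Implicit.
Unset Printing Implicit Defensive.

Local Open Scope classical_set_scope.
Local Open Scope ring_scope.

(** * Continuity on a subset *)

(** The topology on the domain of [{within A, continuous f}] is an alias that
   hinders syntactic search; behind this constant, the closure properties below
   can be applied by looking at the shape of the function. *)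
Definition cts {X Y : topologicalType} (A : set X) (f : X -> Y) : Prop :=
  {within A, continuous f}.

Lemma cts_at {X Y : topologicalType} (A : set X) (f : X -> Y) :
  cts A f -> forall x, A x -> f @ within A (nbhs x) --> f x.
Proof. by move=> cf; apply/subspace_continuousP. Qed.

Lemma at_cts {X Y : topologicalType} (A : set X) (f : X -> Y) :
  (forall x, A x -> f @ within A (nbhs x) --> f x) -> cts A f.
Proof. by move=> cf; apply/subspace_continuousP. Qed.

Section Restriction.
Context {X : topologicalType}.
Implicit Types (A : set X).

Lemma cts_ext {Y : topologicalType} A (f g : X -> Y) :
  (forall x, A x -> f x = g x) -> cts A f -> cts A g.
Proof.
by move=> fg; apply: subspace_eq_continuous => x /[!inE] /fg.
Qed.

Lemma cts_sub {Y : topologicalType} A B (f : X -> Y) :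
  A `<=` B -> cts B f -> cts A f.
Proof. exact: continuous_subspaceW. Qed.

Lemma cts_T {Y : topologicalType} A (f : X -> Y) : continuous f -> cts A f.
Proof. exact: continuous_subspaceT. Qed.

Lemma cts_id A : cts A (fun x => x).
Proof. by apply: (@cts_T X) => x; exact: cvg_id. Qed.

Lemma cts_cst {Y : topologicalType} A (y : Y) : cts A (fun=> y).
Proof. by apply: cts_T => x; exact: cvg_cst. Qed.

Lemma cts_pair {Y Z : topologicalType} A (f : X -> Y) (g : X -> Z) :
  cts A f -> cts A g -> cts A (fun x => (f x, g x)).
Proof. by move=> cf cg x; apply: cvg_pair; [exact: cf|exact: cg]. Qed.

Lemma cts_comp {Y Z : topologicalType} A (B : set Y) (f : X -> Y) (g : Y -> Z) :
  cts B g -> cts A f -> (forall x, A x -> B (f x)) -> cts A (fun x => g (f x)).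
Proof.
move=> /cts_at cg /cts_at cf AB; apply: at_cts => x Ax.
apply: (cvg_comp f g (G := within B (nbhs (f x)))); last exact: cg (AB _ Ax).
move=> U BU; have h : (within A (nbhs x)) [set y | B (f y) -> U (f y)] by apply: cf BU.
by apply: (filterS _ (h : nbhs x [set y | A y -> B (f y) -> U (f y)])) => y hy Ay; exact: hy Ay (AB _ Ay).
Qed.

End Restriction.

Section Toolkit.
Context {R : realType} {X : topologicalType}.
Implicit Types (A : set X).

Lemma cts_compT {Y Z : topologicalType} A (f : X -> Y) (g : Y -> Z) :
  continuous g -> cts A f -> cts A (fun x => g (f x)).
Proof. by move=> cg cf; apply: (@cts_comp _ _ _ _ setT) => //; exact: cts_T. Qed.

Lemma cts_fst {Y Z : topologicalType} A (f : X -> Y * Z) :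
  cts A f -> cts A (fun x => (f x).1).
Proof. by apply: cts_compT; move=> -[? ?]; exact: cvg_fst. Qed.

Lemma cts_snd {Y Z : topologicalType} A (f : X -> Y * Z) :
  cts A f -> cts A (fun x => (f x).2).
Proof. by apply: cts_compT; move=> -[? ?]; exact: cvg_snd. Qed.

Lemma ctsD {V : normedModType R} A (f g : X -> V) :
  cts A f -> cts A g -> cts A (fun x => f x + g x).
Proof. by move=> cf cg x; apply: cvgD; [exact: cf|exact: cg]. Qed.

Lemma ctsN {V : normedModType R} A (f : X -> V) :
  cts A f -> cts A (fun x => - f x).
Proof. by move=> cf x; apply: cvgN; exact: cf. Qed.

Lemma ctsB {V : normedModType R} A (f g : X -> V) :
  cts A f -> cts A g -> cts A (fun x => f x - g x).
Proof. by move=> cf cg x; apply: cvgB; [exact: cf|exact: cg]. Qed.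

Lemma ctsZ {V : normedModType R} A (f : X -> R) (g : X -> V) :
  cts A f -> cts A g -> cts A (fun x => f x *: g x).
Proof. by move=> cf cg x; apply: cvgZ; [exact: cf|exact: cg]. Qed.

Lemma ctsM A (f g : X -> R) :
  cts A f -> cts A g -> cts A (fun x => f x * g x).
Proof. by move=> cf cg x; apply: cvgM; [exact: cf|exact: cg]. Qed.

Lemma ctsX A (f : X -> R) n : cts A f -> cts A (fun x => f x ^+ n).
Proof.
move=> cf; elim: n => [|n IH]; first by under eq_fun do rewrite expr0; exact: cts_cst.
by under eq_fun do rewrite exprS; exact: ctsM.
Qed.

Lemma ctsV A (f : X -> R) : (forall x, A x -> f x != 0) ->
  cts A f -> cts A (fun x => (f x)^-1).
Proof.
move=> f0 /cts_at cf; apply: at_cts => x Ax.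
by apply: cvgV; [exact: f0|exact: cf].
Qed.

Lemma cts_sqrt A (f : X -> R) : cts A f -> cts A (fun x => Num.sqrt (f x)).
Proof. by apply: cts_compT; exact: sqrt_continuous. Qed.

Lemma cts_cos A (f : X -> R) : cts A f -> cts A (fun x => cos (f x)).
Proof. by apply: cts_compT; exact: continuous_cos. Qed.

Lemma cts_sin A (f : X -> R) : cts A f -> cts A (fun x => sin (f x)).
Proof. by apply: cts_compT; exact: continuous_sin. Qed.

Lemma cts_atan A (f : X -> R) : cts A f -> cts A (fun x => atan (f x)).
Proof. by apply: cts_compT; exact: continuous_atan. Qed.

Lemma cts_expR A (f : X -> R) : cts A f -> cts A (fun x => expR (f x)).
Proof. by apply: cts_compT; exact: continuous_expR. Qed.

Lemma cts_norm A (f : X -> R) : cts A f -> cts A (fun x => `|f x|).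
Proof. by move=> cf; apply: cts_compT cf; exact: norm_continuous. Qed.

Lemma cts_ln A (f : X -> R) : (forall x, A x -> 0 < f x) ->
  cts A f -> cts A (fun x => ln (f x)).
Proof.
move=> f0 /cts_at cf; apply: at_cts => x Ax.
have := cf _ Ax; move=> h.
by apply: (cvg_comp _ _ h); exact: continuous_ln (f0 _ Ax).
Qed.

Lemma cts_sum (I : Type) (r : seq I) A (f : I -> X -> R) :
  (forall i, cts A (f i)) -> cts A (fun x => \sum_(i <- r) f i x).
Proof.
move=> cf; elim: r => [|i r IH].
  by under eq_fun do rewrite big_nil; exact: cts_cst.
by under eq_fun do rewrite big_cons; exact: ctsD.
Qed.

Lemma cts_prod (I : Type) (r : seq I) (P : pred I) A (f : I -> X -> R) :
  (forall i, cts A (f i)) -> cts A (fun x => \prod_(i <- r | P i) f i x).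
Proof.
move=> cf; elim: r => [|i r IH].
  by under eq_fun do rewrite big_nil; exact: cts_cst.
by under eq_fun do rewrite big_cons; case: (P i) => //; exact: ctsM.
Qed.

Lemma cts_coord m n A (f : X -> 'M[R]_(m, n)) i j :
  cts A f -> cts A (fun x => f x i j).
Proof. by apply: (@cts_compT _ _ A f (fun M : 'M[R]_(m, n) => M i j)); exact: coord_continuous. Qed.

Lemma cts_mx m n A (f : X -> 'M[R]_(m, n)) :
  (forall i j, cts A (fun x => f x i j)) -> cts A f.
Proof.
move=> cf; apply: at_cts => x Ax; apply/cvgrPdist_lt => e e0.
have h i j : \forall y \near within A (nbhs x), `|f x i j - f y i j| < e.
  have /cts_at /(_ _ Ax) /cvgrPdist_lt := cf i j; exact.
have : \forall y \near within A (nbhs x), forall ij : 'I_m * 'I_n, `|f x ij.1 ij.2 - f y ij.1 ij.2| < e.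
  by apply: filter_forall => -[i j].
apply: filterS => y H.
rewrite /Num.norm/= mx_normE; have -> : e = (NngNum (ltW e0))%:num by [].
rewrite num_lt; apply/bigmax_ltP; split => //= -[i j] _; rewrite -num_lt/=.
by have := H (i, j); rewrite !mxE.
Qed.
End Toolkit.

Section Quotient.
Context {X Y Z : topologicalType}.

(** A continuous image of a compact set carries the quotient topology. *)
Lemma cts_quotient (K : set X) (q : X -> Y) (F : Y -> Z) :
  hausdorff_space Y -> compact K -> cts K q -> cts K (fun x => F (q x)) ->
  cts (q @` K) F.
Proof.
move=> hY cK cq cF; apply/continuous_closedP => C clC.
apply/closed_subspaceP.
have /continuous_closedP /(_ _ clC) /closed_subspaceP [V clV VE] := cF.
exists (q @` (V `&` K)).
  apply: compact_closed => //; apply: continuous_compact.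
    by apply: cts_sub cq; exact: subIsetr.
  by rewrite setIC; exact: compact_closedI.
rewrite VE; apply/seteqP; split => [y [[x [Fx Kx] <-] _]|y [/= Cy [x Kx xy]]].
  by split => //; exists x.
split; last by exists x.
by exists x => //; split => //; rewrite /from_subspace xy. 
Qed.

End Quotient.

Lemma cts_inverse {X Y : topologicalType} (K : set X) (q : X -> Y) (g : Y -> X) :
  hausdorff_space Y -> compact K -> cts K q -> (forall x, K x -> g (q x) = x) ->
  cts (q @` K) g.
Proof.
move=> hY cK cq gq; apply: cts_quotient => //.
by apply: (cts_ext (f := fun x => x)); [move=> x /gq|exact: cts_id].
Qed.

(** By compactness, g is positive on a whole neighbourhood of the zeros of h, of
   uniform size: all the radii below come from this. *)
Lemma compact_pos_near {R : realType} {X : topologicalType} (K : set X) (g h : X -> R) :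
  compact K -> cts K g -> cts K h ->
  (forall x, K x -> h x = 0 -> 0 < g x) ->
  exists2 e : R, 0 < e & forall x, K x -> `|h x| < e -> 0 < g x.
Proof.
move=> cK cg ch gh; pose C := [set x | K x /\ g x <= 0].
have cC : compact C.
  have clR : closed [set x : R | x <= 0] by exact: closed_le.
  have /continuous_closedP /(_ _ clR) /closed_subspaceP[W clW WE] := cg.
  have -> : C = K `&` W.
    rewrite setIC WE; apply/seteqP; split => z; first by case=> Kz gz; split.
    by case => gz Kz.
  exact: compact_closedI.
have clh : closed (h @` C).
  apply: compact_closed; first exact: Rhausdorff.
  by apply: continuous_compact cC; apply: cts_sub ch => x [].
have : nbhs (0 : R) (~` (h @` C)).
  apply: open_nbhs_nbhs; split; first exact: closed_openC.
  by case=> x [Kx gx] /(gh _ Kx); rewrite ltNge gx.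
move/nbhs_ballP => [e /= e0 eP]; exists e => // x Kx hx.
rewrite ltNge; apply/negP => gx; apply: (eP (h x)); last by exists x.
by rewrite /ball /= sub0r normrN.
Qed.

(** * Polar angles and their continuous choice *)

Section Polar.
Context {R : realType}.
Implicit Types (x y a b : R).

Definition polar x y a : Prop :=
  exists2 r : R, 0 < r & x = r * cos a /\ y = r * sin a.

Lemma polar_neq0 x y a : polar x y a -> 0 < x ^+ 2 + y ^+ 2.
Proof.
case=> r r0 [-> ->]; rewrite !exprMn -mulrDr cos2Dsin2 mulr1.
by rewrite exprn_gt0.
Qed.

Lemma or_neq0 x y : (x = 0 -> y = 0 -> False) -> x != 0 \/ y != 0.
Proof.
case: (eqVneq x 0) => [x0|]; last by left.
by case: (eqVneq y 0) => [y0|]; [move/(_ x0 y0)|right].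
Qed.

Lemma polar_or x y a : polar x y a -> x != 0 \/ y != 0.
Proof.
by move/polar_neq0 => h; apply: or_neq0 => x0 y0; rewrite x0 y0 expr0n /= addr0 ltxx in h.
Qed.

Lemma polar_mul x y a x' y' b : polar x y a -> polar x' y' b ->
  polar (x * x' - y * y') (x * y' + y * x') (a + b).
Proof.
case=> r r0 [-> ->] [r' r'0 [-> ->]]; exists (r * r'); first exact: mulr_gt0.
by rewrite cosD sinD; split; ring.
Qed.

Lemma polar_conj x y a : polar x y a -> polar x (- y) (- a).
Proof. by case=> r r0 [-> ->]; exists r; rewrite // cosN sinN mulrN. Qed.

Lemma polar_scale c x y a : 0 < c -> polar x y a -> polar (c * x) (c * y) a.
Proof.
by move=> c0 [r r0 [-> ->]]; exists (c * r); rewrite ?mulr_gt0 // !mulrA.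
Qed.

Lemma polar_cancel c x y a : 0 < c -> polar (c * x) (c * y) a -> polar x y a.
Proof.
move=> c0 /(polar_scale (c := c^-1)) h.
by have := h ltac:(by rewrite invr_gt0); rewrite !mulKf ?gt_eqF.
Qed.

Lemma polar_atan x y : 0 < x -> polar x y (atan (y / x)).
Proof.
move=> x0; set t := y / x; have ct : 0 < cos (atan t).
  by rewrite cos_gt0_pihalf // atan_gtNpi2 atan_ltpi2.
exists (x / cos (atan t)); first exact: divr_gt0.
split; first by rewrite divfK // gt_eqF.
rewrite mulrAC -mulrA -/(tan (atan t)) atanK /t mulrCA divff ?mulr1 //.
by rewrite gt_eqF.
Qed.

Lemma polar_opp x y a : polar x y a -> polar (- x) (- y) (a + pi).
Proof.
by case=> r r0 [-> ->]; exists r; rewrite // cosDpi sinDpi !mulrN.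
Qed.

Lemma polar_exists x y : x != 0 \/ y != 0 -> exists a, polar x y a.
Proof.
case: (ltgtP x 0) => [x0 _|x0 _|-> [|y0]]; last 2 first.
- by [].
- case: (ltgtP y 0) y0 => [y0 _|y0 _|//].
    exists (- (pi / 2)), (- y); first by rewrite oppr_gt0.
    by rewrite cosN sinN cos_pihalf sin_pihalf mulr0 mulrN1 opprK.
  by exists (pi / 2), y; rewrite // cos_pihalf sin_pihalf mulr0 mulr1.
- have h : 0 < - x by rewrite oppr_gt0.
  by have := polar_opp (polar_atan (- y) h); rewrite !opprK => pa; eexists; exact: pa.
- by exists (atan (y / x)); exact: polar_atan.
Qed.

Lemma cossin_periodz (b : R) (n : int) :
  cos (b + 2 * pi * n%:~R) = cos b /\ sin (b + 2 * pi * n%:~R) = sin b.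
Proof.
have E (m : nat) (c : R) : cos (c + 2 * pi * m%:R) = cos c /\ sin (c + 2 * pi * m%:R) = sin c.
  elim: m => [|m [IHc IHs]]; first by rewrite mulr0 addr0.
  rewrite -(natr1 m) mulrDr mulr1 addrA [X in _ + X]mulr_natl.
  by rewrite cosD2pi sinD2pi.
case: n => n; first exact: E.
have [<- <-] := E n.+1 (b + 2 * pi * (Negz n)%:~R).
by rewrite NegzE mulrNz mulrN subrK.
Qed.

Lemma cos_periodz (b : R) (n : int) : cos (b + 2 * pi * n%:~R) = cos b.
Proof. by have [] := cossin_periodz b n. Qed.

Lemma sin_periodz (b : R) (n : int) : sin (b + 2 * pi * n%:~R) = sin b.
Proof. by have [] := cossin_periodz b n. Qed.

Lemma polar_exists_ge0 x y : x != 0 \/ y != 0 ->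
  exists2 a, 0 <= a <= 2 * pi & polar x y a.
Proof.
move=> h; have [a pa] := polar_exists h.
have p2 : 0 < 2 * pi :> R by rewrite mulr_gt0 // pi_gt0.
pose k := Num.floor (a / (2 * pi)); exists (a + 2 * pi * (- k)%:~R).
  rewrite mulrNz mulrN.
  have /andP[k1 k2] := floor_itv (a / (2 * pi)).
  rewrite subr_ge0 mulrC -ler_pdivlMr // k1 /=.
  move: k2; rewrite ltr_pdivrMr // intrD mulrDl mul1r => /ltW k2.
  by lra.
case: pa => r r0 [-> ->]; exists r => //.
by rewrite cos_periodz sin_periodz.
Qed.

End Polar.

Section Lift.
Context {R : realType}.

(** The floor of (a - b + pi) / (2 pi) reduces to a - b in [- pi, pi], where
   the cosine takes the value 1 only at 0. *)
Lemma polar_uniq (x y a b : R) : polar x y a -> polar x y b ->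
  exists k : int, a = b + 2 * pi * k%:~R.
Proof.
move=> [r r0 [xr yr]] [s s0 [xs ys]].
have rs : r = s.
  have : r ^+ 2 = s ^+ 2.
    have := cos2Dsin2 a; have := cos2Dsin2 b => hb ha.
    rewrite -[LHS]mulr1 -ha -[RHS]mulr1 -hb !mulrDr -!exprMn.
    by rewrite -xr -yr xs ys.
  by move/eqP; rewrite eqrXn2 ?ltW // => /eqP.
subst s.
have r0' : r != 0 by rewrite gt_eqF.
have ec : cos a = cos b by apply: (mulfI r0'); rewrite -xr -xs.
have es : sin a = sin b by apply: (mulfI r0'); rewrite -yr -ys.
have p2 : 0 < 2 * pi :> R by rewrite mulr_gt0 // pi_gt0.
pose k := Num.floor ((a - b + pi) / (2 * pi)); exists k.
have /andP[k1 k2] := floor_itv ((a - b + pi) / (2 * pi)).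
move: k1 k2; rewrite -/k intrD ler_pdivlMr // ltr_pdivrMr // => k1 k2.
pose c := a - b - 2 * pi * k%:~R.
have cc : cos c = 1.
  have -> : c = a - b + 2 * pi * (- k)%:~R by rewrite mulrNz mulrN.
  rewrite cos_periodz cosB ec es -!expr2; exact: cos2Dsin2.
have c1 : - pi <= c by rewrite /c; lra.
have c2 : c <= pi by rewrite /c; lra.
have : c = 0.
  have : `|c| = 0.
    apply: (@cos_inj R); rewrite ?in_itv /= ?lexx ?pi_ge0 ?normr_ge0 //=.
      by rewrite ler_norml c1 c2.
    by rewrite cos0; case: (ger0P c) => _; rewrite ?cosN.
  by move/eqP; rewrite normr_eq0 => /eqP.
by rewrite /c; lra.
Qed.

Lemma int_valued_cst (f : R -> R) (x y : R) : x <= y -> cts `[x, y] f ->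
  (forall t, x <= t <= y -> exists k : int, f t = k%:~R) -> f x = f y.
Proof.
move=> xy cf fZ.
have [kx fx] := fZ x ltac:(by rewrite lexx xy).
have [ky fy] := fZ y ltac:(by rewrite lexx xy).
case: (eqVneq (f x) (f y)) => // ne; exfalso.
have key (m : int) : (m = kx \/ m = ky) -> ((m%:~R : R) + 1/2 <= kx%:~R \/ (m%:~R : R) + 1/2 <= ky%:~R) -> False.
  move=> mE mle.
  have [c cxy fc] : exists2 c, c \in `[x, y] & f c = m%:~R + 1/2.
    apply: IVT => //; rewrite fx fy ge_min le_max.
    by case: mE mle => -> [] h; rewrite ?h ?orbT //=; apply/andP; split;
      first [lra | by rewrite h ?orbT | apply/orP; by [left; lra|right; lra]].
  move: cxy; rewrite in_itv /= => /fZ[k]; rewrite fc => e.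
  have e1 : (m%:~R : R) < k%:~R by lra.
  have e2 : (k%:~R : R) < (m + 1)%:~R by rewrite intrD; lra.
  move: e1 e2; rewrite !ltr_int; lia.
have : kx != ky by apply: contra_neq ne; rewrite fx fy => ->.
case: (ltgtP kx ky) => // h _.
  apply: (key kx); first by left.
  right; have : ((kx + 1)%:~R : R) <= ky%:~R by rewrite ler_int; lia.
  by rewrite intrD; lra.
apply: (key ky); first by right.
left; have : ((ky + 1)%:~R : R) <= kx%:~R by rewrite ler_int; lia.
by rewrite intrD; lra.
Qed.

(** Lifting to the universal cover over a star-shaped compact set: by uniform
   continuity, the direction turns by less than a right angle along each of
   finitely many equal pieces of the ray from the centre, so that the angle is
   a finite sum of arc tangents, hence continuous. *)
Lemma polar_lift (V : normedModType R) (D : set V) (X Y : V -> R) :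
  compact D -> D 0 -> (forall (t : R) p, 0 <= t <= 1 -> D p -> D (t *: p)) ->
  cts D X -> cts D Y -> (forall p, D p -> X p != 0 \/ Y p != 0) ->
  exists2 a, cts D a & forall p, D p -> polar (X p) (Y p) (a p).
Proof.
move=> cD D0 star cX cY nz.
pose re (p q : V) := X p * X q + Y p * Y q.
pose im (p q : V) := Y p * X q - X p * Y q.
have [d d0 dP] : exists2 d : R, 0 < d & forall p q, D p -> D q -> `|p - q| < d -> 0 < re p q.
  have cre : cts (D `*` D) (fun z : V * V => re z.1 z.2).
    have h (f : V -> R) : cts D f -> cts (D `*` D) (fun z => f z.1) /\ cts (D `*` D) (fun z => f z.2).
      move=> cf; split; apply: (cts_comp cf); try by move=> [? ?] [].
        by apply: cts_fst; exact: cts_id.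
      by apply: cts_snd; exact: cts_id.
    by have [? ?] := h _ cX; have [? ?] := h _ cY; apply: ctsD; exact: ctsM.
  have cg : cts (D `*` D) (fun z : V * V => `|z.1 - z.2|).
    by apply: cts_T => z; apply: cvg_norm; apply: cvgB; [exact: cvg_fst|exact: cvg_snd].
  have [|d d0 dP] := compact_pos_near (compact_setX cD cD) cre cg.
    move=> [p q] [/= Dp Dq] /eqP; rewrite normr_eq0 subr_eq0 => /eqP <-.
    rewrite /re -!expr2.
    by have [h|h] := nz _ Dp; [rewrite ltr_pwDl|rewrite ltr_wpDl]; rewrite ?sqr_ge0 // exprn_even_gt0.
  by exists d => // p q Dp Dq pq; apply: (dP (p, q)); rewrite //= normr_id.
have [M [_ MP]] := compact_bounded cD.
have /= MD := MP (M + 1) ltac:(by rewrite ltrDl).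
pose n := (Num.truncn (`|M + 1| / d)).+1.
have n0 : 0 < n%:R :> R by rewrite ltr0n.
have nd p : D p -> `| n%:R^-1 *: p | < d.
  move=> Dp; rewrite normrZ gtr0_norm ?invr_gt0 // mulrC ltr_pdivrMr //.
  apply: le_lt_trans (MD _ Dp) _; apply: le_lt_trans (ler_norm _) _.
  rewrite mulrC -ltr_pdivrMr //; have := truncn_itv (x := `|M + 1| / d).
  by move=> /(_ ltac:(by rewrite divr_ge0 // ltW)) /andP[].
pose pt k p : V := (k%:R / n%:R) *: p.
have ptD k p : (k <= n)%N -> D p -> D (pt k p).
  move=> kn Dp; apply: star => //; rewrite divr_ge0 //=.
  by rewrite ler_pdivrMr // mul1r ler_nat.
have re0 k p : (k < n)%N -> D p -> 0 < re (pt k.+1 p) (pt k p).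
  move=> kn Dp; apply: dP; [exact: ptD|by apply: ptD => //; exact: ltnW|].
  by rewrite -scalerBl -mulrBl -natrB // subSnn mul1r; exact: nd.
have [a0 a0P] := polar_exists (nz _ D0).
pose a k p := a0 + \sum_(i < k) atan (im (pt i.+1 p) (pt i p) / re (pt i.+1 p) (pt i p)).
have aP k p : (k <= n)%N -> D p -> polar (X (pt k p)) (Y (pt k p)) (a k p).
  move=> + Dp; elim: k => [_|k IH kn].
    by rewrite /a big_ord0 addr0 /pt mul0r scale0r.
  have pk := IH (ltnW kn); have re1 := re0 _ _ kn Dp.
  have := polar_mul pk (polar_atan (im (pt k.+1 p) (pt k p)) re1).
  rewrite /a big_ord_recr /= addrA -/(a k p) => h.
  apply: (polar_cancel (polar_neq0 pk)); move: h; rewrite /re /im.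
  by congr polar; ring.
exists (a n) => [|p Dp]; last first.
  by have := aP n p (leqnn n) Dp; rewrite /pt divff ?scale1r // gt_eqF.
have cpt (f : V -> R) k : (k <= n)%N -> cts D f -> cts D (fun p => f (pt k p)).
  move=> kn cf; apply: (cts_comp cf) => [|p Dp]; last exact: ptD.
  by apply: ctsZ; [exact: cts_cst|exact: cts_id].
apply: ctsD; first exact: cts_cst.
apply: cts_sum => -[k kn] /=; apply: cts_atan; apply: ctsM.
  apply: ctsB; apply: ctsM; apply: cpt => //; exact: ltnW.
apply: ctsV => [p Dp|]; first by rewrite gt_eqF // re0.
apply: ctsD; apply: ctsM; apply: cpt => //; exact: ltnW.
Qed.

End Lift.

(** * Winding numbers of plane loops *)

Section Winding.
Context {R : realType}.
Implicit Types (X Y : R -> R) (k : int).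

Definition circ : set R := `[0, 2 * pi].
Definition cyl : set (R * R) := `[0, 1] `*` circ.

Lemma twopi_gt0 : 0 < 2 * pi :> R.
Proof. by rewrite mulr_gt0 // pi_gt0. Qed.

Lemma circP th : circ th <-> 0 <= th <= 2 * pi.
Proof. by rewrite /circ /= in_itv. Qed.

Lemma itv01P (t : R) : (`[0, 1]%classic : set R) t <-> 0 <= t <= 1.
Proof. by rewrite /= in_itv. Qed.

Lemma circ0 : circ 0. Proof. by apply/circP; rewrite lexx ltW // twopi_gt0. Qed.
Lemma circ1 : circ (2 * pi).
Proof. by apply/circP; rewrite lexx ltW // twopi_gt0. Qed.

(** The increment of an angle along the loop; as a relation, it can be asserted
   without proving first that a continuous angle exists. *)
Definition wind X Y k : Prop :=
  exists a : R -> R, [/\ cts circ a,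
    forall th, circ th -> polar (X th) (Y th) (a th)
    & a (2 * pi) = a 0 + 2 * pi * k%:~R].

Lemma wind_ext X Y X' Y' k :
  (forall th, circ th -> X th = X' th /\ Y th = Y' th) -> wind X Y k -> wind X' Y' k.
Proof.
by move=> e [a [ca pa ea]]; exists a; split => // th /[dup] /e[<- <-]; exact: pa.
Qed.

Lemma wind_neq0 X Y k t : wind X Y k -> circ t -> X t != 0 \/ Y t != 0.
Proof. by move=> [a [_ pa _]] /pa /polar_or. Qed.

Lemma wind_uniq X Y k k' : wind X Y k -> wind X Y k' -> k = k'.
Proof.
move=> [a [ca pa ea]] [b [cb pb eb]].
have t0 : (2 * pi : R) != 0 by rewrite gt_eqF // twopi_gt0.
have : (a 0 - b 0) / (2 * pi) = (a (2 * pi) - b (2 * pi)) / (2 * pi).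
  apply: (@int_valued_cst R (fun th => (a th - b th) / (2 * pi))).
  - exact: ltW twopi_gt0.
  - by apply: ctsM; [exact: ctsB|exact: cts_cst].
  - move=> t /circP h; have [j ->] := polar_uniq (pa _ h) (pb _ h).
    by exists j; rewrite addrC addKr mulrC mulKf.
move/(mulIf (invr_neq0 t0)); rewrite ea eb => h.
have /(mulfI t0) : 2 * pi * k%:~R = 2 * pi * k'%:~R :> R by lra.
by move/eqP; rewrite eqr_int => /eqP.
Qed.

Lemma wind_mul X Y k X' Y' k' : wind X Y k -> wind X' Y' k' ->
  wind (fun t => X t * X' t - Y t * Y' t) (fun t => X t * Y' t + Y t * X' t) (k + k').
Proof.
move=> [a [ca pa ea]] [b [cb pb eb]]; exists (fun t => a t + b t); split.
- exact: ctsD.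
- by move=> th h; apply: polar_mul; [exact: pa|exact: pb].
- by rewrite ea eb intrD; ring.
Qed.

Lemma wind_conj X Y k : wind X Y k -> wind X (fun t => - Y t) (- k).
Proof.
move=> [a [ca pa ea]]; exists (fun t => - a t); split; first exact: ctsN.
  by move=> th h; apply: polar_conj; exact: pa.
by rewrite ea mulrNz; ring.
Qed.

Lemma wind_scale (c : R -> R) X Y k : (forall t, circ t -> 0 < c t) ->
  wind X Y k -> wind (fun t => c t * X t) (fun t => c t * Y t) k.
Proof.
move=> c0 [a [ca pa ea]]; exists a; split => // th h.
by apply: polar_scale; [exact: c0|exact: pa].
Qed.

Lemma wind_cancel (c : R -> R) X Y k : (forall t, circ t -> 0 < c t) ->
  wind (fun t => c t * X t) (fun t => c t * Y t) k -> wind X Y k.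
Proof.
move=> c0 [a [ca pa ea]]; exists a; split => // th h.
by apply: (polar_cancel (c0 _ h)); exact: pa.
Qed.

Lemma wind_cst (x y : R) : x != 0 \/ y != 0 -> wind (fun=> x) (fun=> y) 0.
Proof.
move=> /polar_exists[a pa]; exists (fun=> a); split => //; first exact: cts_cst.
by rewrite mulr0 addr0.
Qed.

Lemma wind_right X Y : (forall t, circ t -> 0 < X t) -> cts circ X -> cts circ Y ->
  X (2 * pi) = X 0 -> Y (2 * pi) = Y 0 -> wind X Y 0.
Proof.
move=> X0 cX cY eX eY; exists (fun t => atan (Y t / X t)); split.
- apply: cts_atan; apply: ctsM => //; apply: ctsV => // t h.
  by rewrite gt_eqF // X0.
- by move=> t /X0; exact: polar_atan.
- by rewrite eX eY mulr0 addr0.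
Qed.

Lemma wind_circle k : wind (fun t => cos (t * k%:~R)) (fun t => sin (t * k%:~R)) k.
Proof.
exists (fun t => t * k%:~R); split; last by rewrite mul0r add0r.
  by apply: ctsM; [exact: cts_id|exact: cts_cst].
by move=> th _; exists 1; rewrite ?mul1r.
Qed.

Lemma compact_circ : compact circ. Proof. exact: segment_compact. Qed.

Lemma compact_cyl : compact cyl.
Proof. by apply: compact_setX; exact: segment_compact. Qed.

Lemma cylP (p : R * R) : cyl p <-> 0 <= p.1 <= 1 /\ 0 <= p.2 <= 2 * pi.
Proof. by rewrite /cyl /= /circ /= !in_itv. Qed.

(** The angle is lifted over the whole cylinder; its increment along the circle
   is then a continuous function with integer values (up to 2 pi) of the other
   parameter. *)
Lemma wind_homotopy (X Y : R -> R -> R) :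
  cts cyl (fun p => X p.1 p.2) -> cts cyl (fun p => Y p.1 p.2) ->
  (forall s t, 0 <= s <= 1 -> circ t -> X s t != 0 \/ Y s t != 0) ->
  (forall s, 0 <= s <= 1 -> X s (2 * pi) = X s 0 /\ Y s (2 * pi) = Y s 0) ->
  exists k, forall s, 0 <= s <= 1 -> wind (X s) (Y s) k.
Proof.
move=> cX cY nz per; have t0 := twopi_gt0.
have [|t p /andP[t1 t2] /cylP[/andP[a1 a2] /andP[b1 b2]]|p /cylP[h1 /circP h2]|a ca pa] :=
    polar_lift compact_cyl _ _ cX cY.
- by apply/cylP; rewrite /= lexx ler01 ltW.
- have : 0 <= t * p.1 <= 1 /\ 0 <= t * p.2 <= 2 * pi.
    by split; apply/andP; split; rewrite ?mulr_ge0 //; nra.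
  by move=> h; apply/cylP.
- exact: nz.
have P s th : 0 <= s <= 1 -> circ th -> cyl (s, th) by move=> ? /circP ?; apply/cylP.
have K s : 0 <= s <= 1 -> exists k : int, a (s, 2 * pi) = a (s, 0) + 2 * pi * k%:~R.
  move=> h; have [e1 e2] := per _ h.
  apply: polar_uniq (pa _ (P _ _ h circ1)) _ => /=; rewrite e1 e2.
  exact: (pa _ (P _ _ h circ0)).
have [k kP] := K 0 ltac:(by rewrite lexx ler01).
exists k => s hs; exists (fun t => a (s, t)); split.
- apply: (cts_comp ca) => [|t]; last exact: P.
  by apply: cts_pair; [exact: cts_cst|exact: cts_id].
- by move=> th h; exact: pa (P _ _ hs h).
have n0 : (2 * pi : R) != 0 by rewrite gt_eqF.
have : (a (0, 2 * pi) - a (0, 0)) / (2 * pi) = (a (s, 2 * pi) - a (s, 0)) / (2 * pi).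
  apply: (@int_valued_cst R (fun s => (a (s, 2 * pi) - a (s, 0)) / (2 * pi))).
  - by case/andP: hs.
  - apply: ctsM; last exact: cts_cst.
    apply: ctsB; apply: (cts_comp ca);
      try by (apply: cts_pair; [exact: cts_id|exact: cts_cst]).
    + move=> t; rewrite /= in_itv /= => /andP[h1 h2]; apply: P circ1.
      by rewrite h1 (le_trans h2) //; case/andP: hs.
    + move=> t; rewrite /= in_itv /= => /andP[h1 h2]; apply: P circ0.
      by rewrite h1 (le_trans h2) //; case/andP: hs.
  - move=> t /andP[h1 h2]; have [|j ->] := K t.
      by rewrite h1 (le_trans h2) //; case/andP: hs.
    by exists j; rewrite addrC addKr mulrC mulKf.
by move/(mulIf (invr_neq0 n0)); rewrite kP; lra.
Qed.

Lemma wind_exists X Y : cts circ X -> cts circ Y ->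
  (forall t, circ t -> X t != 0 \/ Y t != 0) ->
  X (2 * pi) = X 0 -> Y (2 * pi) = Y 0 -> exists k, wind X Y k.
Proof.
move=> cX cY nz eX eY.
have c2 (f : R -> R) : cts circ f -> cts cyl (fun p => f p.2).
  move=> cf; apply: (cts_comp cf) => [|p /cylP[_ h]]; last exact/circP.
  by apply: cts_snd; exact: cts_id.
have [||||k kP] := @wind_homotopy (fun=> X) (fun=> Y).
- exact: c2.
- exact: c2.
- by move=> _ t _; exact: nz.
- by [].
by exists k; apply: (kP 0); rewrite lexx ler01.
Qed.

Lemma wind_transport (X Y : R -> R -> R) k :
  cts cyl (fun p => X p.1 p.2) -> cts cyl (fun p => Y p.1 p.2) ->
  (forall s t, 0 <= s <= 1 -> circ t -> X s t != 0 \/ Y s t != 0) ->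
  (forall s, 0 <= s <= 1 -> X s (2 * pi) = X s 0 /\ Y s (2 * pi) = Y s 0) ->
  wind (X 0) (Y 0) k -> wind (X 1) (Y 1) k.
Proof.
move=> cX cY nz per w0; have [j jP] := wind_homotopy cX cY nz per.
rewrite (wind_uniq w0 (jP 0 _)); last by rewrite lexx ler01.
by apply: jP; rewrite lexx ler01.
Qed.

Lemma cts_cyl2 (Z : topologicalType) (f : R -> Z) : cts circ f -> cts cyl (fun p => f p.2).
Proof.
move=> cf; apply: (cts_comp cf) => [|p /cylP[_ h]]; last exact/circP.
by apply: cts_snd; exact: cts_id.
Qed.

Lemma wind_segment X Y X' Y' k :
  cts circ X -> cts circ Y -> cts circ X' -> cts circ Y' ->
  (forall s t, 0 <= s <= 1 -> circ t ->
     (1 - s) * X t + s * X' t != 0 \/ (1 - s) * Y t + s * Y' t != 0) ->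
  X (2 * pi) = X 0 -> Y (2 * pi) = Y 0 -> X' (2 * pi) = X' 0 -> Y' (2 * pi) = Y' 0 ->
  wind X Y k -> wind X' Y' k.
Proof.
move=> cX cY cX' cY' nz eX eY eX' eY' w.
have c1 : cts cyl (fun p : R * R => p.1) by apply: cts_fst; exact: cts_id.
have := @wind_transport (fun s t => (1 - s) * X t + s * X' t)
  (fun s t => (1 - s) * Y t + s * Y' t) k.
have H (f g : R -> R) : cts circ f -> cts circ g -> cts cyl (fun p => (1 - p.1) * f p.2 + p.1 * g p.2).
  move=> cf cg; apply: ctsD; apply: ctsM => //; try exact: cts_cyl2.
  by apply: ctsB => //; exact: cts_cst.
move=> /(_ (H _ _ cX cX') (H _ _ cY cY') nz) /=.
move=> /(_ ltac:(by move=> s _; rewrite eX eX' eY eY')) h.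
have {h} : wind (fun t => (1 - 1) * X t + 1 * X' t) (fun t => (1 - 1) * Y t + 1 * Y' t) k.
  by apply: h; apply: wind_ext w => t _; rewrite subr0 !mul1r !mul0r !addr0.
by apply: wind_ext => t _; rewrite subrr !mul0r !add0r !mul1r.
Qed.

Lemma convex_gt0 (s x y : R) : 0 <= s <= 1 -> 0 < x -> 0 < y -> 0 < (1 - s) * x + s * y.
Proof.
move=> /andP[]; rewrite le_eqVlt => /orP[/eqP <-|s0] s1 x0 y0.
  by rewrite subr0 mul1r mul0r addr0.
by rewrite ltr_wpDl ?mulr_gt0 // mulr_ge0 ?subr_ge0 // ltW.
Qed.

Definition sgn_wind (D : R) (k : int) : int := if 0 < D then k else - k.

(** A linear automorphism of the plane is a rotation followed by a triangular
   map, and triangular maps with positive diagonal form a convex set. *)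
Lemma wind_linear (a b c d : R) X Y k : a * d - b * c != 0 ->
  cts circ X -> cts circ Y -> X (2 * pi) = X 0 -> Y (2 * pi) = Y 0 ->
  wind X Y k ->
  wind (fun t => a * X t + b * Y t) (fun t => c * X t + d * Y t)
    (sgn_wind (a * d - b * c) k).
Proof.
move=> D0 cX cY eX eY w.
have ac : a != 0 \/ c != 0.
  by apply: or_neq0 => a0 c0; move: D0; rewrite a0 c0 mul0r mulr0 subrr eqxx.
have q0 : 0 < a ^+ 2 + c ^+ 2.
  by case: ac => h; [rewrite ltr_pwDl|rewrite ltr_wpDl]; rewrite ?sqr_ge0 // exprn_even_gt0.
pose e : R := if 0 < a * d - b * c then 1 else -1.
have w1 : wind X (fun t => e * Y t) (sgn_wind (a * d - b * c) k).
  rewrite /e /sgn_wind; case: ifP => _; first by apply: wind_ext w => t; rewrite mul1r.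
  by apply: wind_ext (wind_conj w) => t; rewrite mulN1r.
have e0 : 0 < e * (a * d - b * c).
  rewrite /e; case: ifP => h; first by rewrite mul1r.
  by rewrite mulN1r oppr_gt0 lt_neqAle D0 leNgt h.
have w2 : wind (fun t => (a ^+ 2 + c ^+ 2) * X t + (a * b + c * d) * Y t)
    (fun t => (a * d - b * c) * Y t) (sgn_wind (a * d - b * c) k).
  apply: wind_segment w1; rewrite ?eX ?eY //; try by [apply: ctsM => //; exact: cts_cst].
    by apply: ctsD; apply: ctsM => //; exact: cts_cst.
  move=> s t /andP[s0 s1] ht.
  have ee : e * e = 1 by rewrite /e; case: ifP; rewrite ?mulrNN mulr1.
  case: (eqVneq (Y t) 0) => [Y0|nY].
    left; rewrite Y0 !mulr0 !addr0 mulrA -mulrDl mulf_neq0 //; last first.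
      by have [|] := wind_neq0 w ht; rewrite // Y0 eqxx.
    by rewrite gt_eqF // -[1 - s]mulr1 convex_gt0 ?s0.
  right; rewrite !mulrA -mulrDl mulf_neq0 //.
  have : 0 < e * ((1 - s) * e + s * (a * d - b * c)).
    by rewrite mulrDr [e * (_ * e)]mulrCA ee [e * (s * _)]mulrCA convex_gt0 ?s0.
  by case: (eqVneq ((1 - s) * e + s * (a * d - b * c)) 0) => [->|//]; rewrite mulr0 ltxx.
have w3 := wind_mul (wind_cst ac) w2.
have w4 : wind (fun t => (a ^+ 2 + c ^+ 2) * (a * X t + b * Y t))
   (fun t => (a ^+ 2 + c ^+ 2) * (c * X t + d * Y t)) (sgn_wind (a * d - b * c) k).
  rewrite add0r in w3; apply: wind_ext w3 => t _; split; ring.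
exact: wind_cancel w4.
Qed.

End Winding.

(** * The sphere and homotopies of its self-maps *)

Section Space.
Context {R : realType}.
Implicit Types (x y z : 'rV[R]_3).

Definition px x : R := x ord0 ord0.
Definition py x : R := x ord0 (lift ord0 ord0).
Definition pz x : R := x ord0 (lift ord0 (lift ord0 ord0)).
Definition vec (a b c : R) : 'rV[R]_3 := \row_j nth 0 [:: a; b; c] j.

Lemma px_vec a b c : px (vec a b c) = a. Proof. by rewrite /px mxE. Qed.
Lemma py_vec a b c : py (vec a b c) = b. Proof. by rewrite /py mxE. Qed.
Lemma pz_vec a b c : pz (vec a b c) = c. Proof. by rewrite /pz mxE. Qed.

Lemma eq3 x y : px x = px y -> py x = py y -> pz x = pz y -> x = y.
Proof.
move=> h0 h1 h2; apply/rowP => -[[|[|[|//]]] h].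
- by move: h0; rewrite /px; congr (_ = _); congr (fun_of_matrix _ _ _); exact: val_inj.
- by move: h1; rewrite /py; congr (_ = _); congr (fun_of_matrix _ _ _); exact: val_inj.
- by move: h2; rewrite /pz; congr (_ = _); congr (fun_of_matrix _ _ _); exact: val_inj.
Qed.

Lemma vec_eta x : vec (px x) (py x) (pz x) = x.
Proof. by apply: eq3; rewrite ?px_vec ?py_vec ?pz_vec. Qed.

Lemma pxD x y : px (x + y) = px x + px y. Proof. by rewrite /px mxE. Qed.
Lemma pyD x y : py (x + y) = py x + py y. Proof. by rewrite /py mxE. Qed.
Lemma pzD x y : pz (x + y) = pz x + pz y. Proof. by rewrite /pz mxE. Qed.
Lemma pxN x : px (- x) = - px x. Proof. by rewrite /px mxE. Qed.
Lemma pyN x : py (- x) = - py x. Proof. by rewrite /py mxE. Qed.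
Lemma pzN x : pz (- x) = - pz x. Proof. by rewrite /pz mxE. Qed.
Lemma pxZ c x : px (c *: x) = c * px x. Proof. by rewrite /px mxE. Qed.
Lemma pyZ c x : py (c *: x) = c * py x. Proof. by rewrite /py mxE. Qed.
Lemma pzZ c x : pz (c *: x) = c * pz x. Proof. by rewrite /pz mxE. Qed.
Lemma px0 : px 0 = 0. Proof. by rewrite /px mxE. Qed.
Lemma py0 : py 0 = 0. Proof. by rewrite /py mxE. Qed.
Lemma pz0 : pz 0 = 0. Proof. by rewrite /pz mxE. Qed.

Definition coordE := (px_vec, py_vec, pz_vec, pxD, pyD, pzD, pxN, pyN, pzN,
  pxZ, pyZ, pzZ, px0, py0, pz0).

Definition dot x y : R := px x * px y + py x * py y + pz x * pz y.
Definition det3 x y z : R :=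
  px x * (py y * pz z - pz y * py z) - py x * (px y * pz z - pz y * px z)
  + pz x * (px y * py z - py y * px z).

Lemma normsqE x : normsq x = px x ^+ 2 + py x ^+ 2 + pz x ^+ 2.
Proof. by rewrite /normsq !big_ord_recl big_ord0 addr0 addrA. Qed.

Lemma normsq_dot x : normsq x = dot x x.
Proof. by rewrite normsqE /dot !expr2. Qed.

Lemma sphereP x : sphere 2 x <-> px x ^+ 2 + py x ^+ 2 + pz x ^+ 2 = 1.
Proof. by rewrite /sphere /= normsqE. Qed.

Lemma sphereN x : sphere 2 x -> sphere 2 (- x).
Proof. by move=> /sphereP h; apply/sphereP; rewrite !coordE !sqrrN. Qed.

Lemma normsq_ge0 x : 0 <= normsq x.
Proof. by rewrite normsqE !addr_ge0 // sqr_ge0. Qed.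

Lemma normsq_gt0 x : x != 0 -> 0 < normsq x.
Proof.
move=> x0; rewrite lt_neqAle normsq_ge0 andbT eq_sym; apply: contra_neq x0.
rewrite normsqE => /eqP.
rewrite !paddr_eq0 ?addr_ge0 ?sqr_ge0 // !sqrf_eq0 => /andP[/andP[/eqP a /eqP b] /eqP c].
by apply: eq3; rewrite !coordE.
Qed.

Lemma normsq0 : normsq (0 : 'rV[R]_3) = 0.
Proof. by rewrite normsqE !coordE expr0n /= !addr0. Qed.

Lemma normsq_sub_eq0 x y : normsq (x - y) = 0 -> x = y.
Proof.
by move=> h; apply/eqP; rewrite -subr_eq0; apply: contraT => /normsq_gt0; rewrite h ltxx.
Qed.

Lemma sphere_neq0 x : sphere 2 x -> x != 0.
Proof.
by apply: contraPneq => ->; rewrite /sphere /= normsqE !coordE expr0n /= !addr0 => /esym/eqP; rewrite oner_eq0.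
Qed.

Definition unit_vec x : 'rV[R]_3 := (Num.sqrt (normsq x))^-1 *: x.

Lemma normsqZ c x : normsq (c *: x) = c ^+ 2 * normsq x.
Proof. by rewrite !normsqE !coordE; ring. Qed.

Lemma unit_sphere x : x != 0 -> sphere 2 (unit_vec x).
Proof.
move=> /normsq_gt0 h; rewrite /sphere /= /unit_vec normsqZ exprVn sqr_sqrtr ?ltW //.
by rewrite mulVf // gt_eqF.
Qed.

Lemma unit_id x : sphere 2 x -> unit_vec x = x.
Proof. by rewrite /sphere /= /unit_vec => ->; rewrite sqrtr1 invr1 scale1r. Qed.

Lemma unit_factor x : x != 0 -> exists2 c, 0 < c & unit_vec x = c *: x.
Proof.
move=> /normsq_gt0 h; exists (Num.sqrt (normsq x))^-1 => //.
by rewrite invr_gt0 sqrtr_gt0.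
Qed.

Lemma unitZ c x : 0 < c -> unit_vec (c *: x) = unit_vec x.
Proof.
move=> c0; rewrite /unit_vec normsqZ sqrtrM ?sqr_ge0 // sqrtr_sqr gtr0_norm //.
by rewrite invfM scalerA mulrC mulVKf // gt_eqF.
Qed.

Lemma unit_pos c x : 0 < c -> sphere 2 x -> unit_vec (c *: x) = x.
Proof. by move=> c0 /unit_id h; rewrite unitZ. Qed.

Lemma unitN x : unit_vec (- x) = - unit_vec x.
Proof. by rewrite /unit_vec -scaleN1r normsqZ sqrrN expr1n mul1r scaleN1r scalerN. Qed.

End Space.

Section SpaceTopology.
Context {R : realType} {X : topologicalType}.
Implicit Types (A : set X) (f : X -> 'rV[R]_3).

Lemma cts_px A f : cts A f -> cts A (fun x => px (f x)).
Proof. exact: cts_coord. Qed.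
Lemma cts_py A f : cts A f -> cts A (fun x => py (f x)).
Proof. exact: cts_coord. Qed.
Lemma cts_pz A f : cts A f -> cts A (fun x => pz (f x)).
Proof. exact: cts_coord. Qed.

Lemma cts_vec A (a b c : X -> R) :
  cts A a -> cts A b -> cts A c -> cts A (fun x => vec (a x) (b x) (c x)).
Proof.
move=> ca cb cc; apply: cts_mx => i [[|[|[|//]]] h];
  by under eq_fun do rewrite mxE.
Qed.

Lemma cts_dot A f g : cts A f -> cts A g -> cts A (fun x => dot (f x) (g x)).
Proof.
move=> cf cg; apply: ctsD; [apply: ctsD|]; apply: ctsM; first
  [exact: (@cts_px A f)|exact: (@cts_py A f)|exact: (@cts_pz A f)|exact: (@cts_px A g)|exact: (@cts_py A g)|exact: (@cts_pz A g)].
Qed.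

Lemma cts_normsq A f : cts A f -> cts A (fun x => normsq (f x)).
Proof. by move=> cf; under eq_fun do rewrite normsq_dot; exact: cts_dot. Qed.

Lemma cts_unit A f : (forall x, A x -> f x != 0) -> cts A f ->
  cts A (fun x => unit_vec (f x)).
Proof.
move=> f0 cf; apply: ctsZ => //; apply: ctsV.
  by move=> x /f0/normsq_gt0 h; rewrite gt_eqF // sqrtr_gt0.
by apply: cts_sqrt; exact: cts_normsq.
Qed.
End SpaceTopology.

(* Proves the continuity of an expression from that of its subexpressions. *)
Ltac cts_step :=
  lazymatch goal with
  | |- cts _ (fun _ => ?c) => apply: cts_cst
  | |- cts _ (fun x => x) => apply: cts_id
  | |- cts ?A fst => apply: (@cts_fst _ _ _ A (fun x => x))
  | |- cts ?A snd => apply: (@cts_snd _ _ _ A (fun x => x))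
  | |- cts ?A px => apply: (@cts_px _ _ A (fun x => x))
  | |- cts ?A py => apply: (@cts_py _ _ A (fun x => x))
  | |- cts ?A pz => apply: (@cts_pz _ _ A (fun x => x))
  | |- cts ?A -%R => apply: (@ctsN _ _ _ A (fun x => x))
  | |- cts ?A cos => apply: (@cts_cos _ _ A (fun x => x))
  | |- cts ?A sin => apply: (@cts_sin _ _ A (fun x => x))
  | |- cts ?A (fun x => (@?f x, @?g x)) => apply: (@cts_pair _ _ _ A f g)
  | |- cts ?A (fun x => (@?f x + @?g x)%R) => apply: (@ctsD _ _ _ A f g)
  | |- cts ?A (fun x => (- @?f x)%R) => apply: (@ctsN _ _ _ A f)
  | |- cts ?A (fun x => (@?f x * @?g x)%R) => apply: (@ctsM _ _ A f g)
  | |- cts ?A (fun x => (@?f x *: @?g x)%R) => apply: (@ctsZ _ _ _ A f g)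
  | |- cts ?A (fun x => (@?f x ^+ ?n)%R) => apply: (@ctsX _ _ A f n)
  | |- cts ?A (fun x => vec (@?f x) (@?g x) (@?h x)) => apply: (@cts_vec _ _ A f g h)
  | |- cts ?A (fun x => px (@?f x)) => apply: (@cts_px _ _ A f)
  | |- cts ?A (fun x => py (@?f x)) => apply: (@cts_py _ _ A f)
  | |- cts ?A (fun x => pz (@?f x)) => apply: (@cts_pz _ _ A f)
  | |- cts ?A (fun x => dot (@?f x) (@?g x)) => apply: (@cts_dot _ _ A f g)
  | |- cts ?A (fun x => normsq (@?f x)) => apply: (@cts_normsq _ _ A f)
  | |- cts ?A (fun x => cos (@?f x)) => apply: (@cts_cos _ _ A f)
  | |- cts ?A (fun x => sin (@?f x)) => apply: (@cts_sin _ _ A f)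
  | |- cts ?A (fun x => Num.sqrt (@?f x)) => apply: (@cts_sqrt _ _ A f)
  | |- cts ?A (fun x => (@?f x).1) => apply: (@cts_fst _ _ _ A f)
  | |- cts ?A (fun x => (@?f x).2) => apply: (@cts_snd _ _ _ A f)
  end.
Ltac cts_hyp :=
  match goal with H : cts ?A ?f |- cts ?A ?f => exact H end.
Ltac ctst := repeat first [cts_hyp | cts_step]; try assumption.

Section Sphere.
Context {R : realType}.
Local Notation V3 := ('rV[R]_3).

Lemma compact_sphere n : compact (@sphere R n).
Proof.
apply: bounded_closed_compact.
  exists 1; split => // M M1 x h /=; apply: le_trans (ltW M1).
  rewrite /Num.norm/= mx_normE; have -> : 1 = (NngNum (ler01 : 0 <= 1 :> R))%:num by [].
  rewrite num_le; apply/bigmax_leP; split => //= -[i j] _; rewrite -num_le/=.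
  rewrite -(@ler_pXn2r _ 2) ?nnegrE // expr1n real_normK ?num_real // -h /normsq.
  by rewrite (ord1 i) (bigD1 j) //= lerDl sumr_ge0 // => k _; exact: sqr_ge0.
have c : cts setT (fun x : 'rV[R]_n.+1 => normsq x).
  by apply: cts_sum => i; apply: ctsX; apply: cts_coord; exact: cts_id.
have -> : @sphere R n = (fun x => normsq x) @^-1` [set 1] by [].
have c' : continuous (fun x : 'rV[R]_n.+1 => normsq x) by apply/continuous_subspace_setT.
apply: closed_comp; last exact: closed_eq.
by move=> x _; exact: c'.
Qed.

Definition north : V3 := vec 0 0 1.

Lemma northP : sphere 2 north.
Proof. by apply/sphereP; rewrite !coordE; ring. Qed.

Definition cyl2 : set (R * V3) := (`[0, 1]%classic : set R) `*` sphere 2.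

Definition smap (f : V3 -> V3) : Prop := cts (sphere 2) f /\ {homo f : x / sphere 2 x}.

Definition homotopic (f g : V3 -> V3) : Prop :=
  exists H : R * V3 -> V3, [/\ cts cyl2 H,
    forall t x, 0 <= t <= 1 -> sphere 2 x -> sphere 2 (H (t, x)),
    forall x, sphere 2 x -> H (0, x) = f x & forall x, sphere 2 x -> H (1, x) = g x].

Lemma cyl2P (p : R * V3) : cyl2 p <-> 0 <= p.1 <= 1 /\ sphere 2 p.2.
Proof. by rewrite /cyl2 /= in_itv. Qed.

Lemma hom_sym f g : homotopic f g -> homotopic g f.
Proof.
case=> H [cH sH H0 H1]; exists (fun p => H (1 - p.1, p.2)); split => /=.
- apply: (cts_comp cH) => [|p /cyl2P[/andP[h1 h2] h3]]; first by ctst.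
  by apply/cyl2P; split => //=; rewrite subr_ge0 h2 lerBlDr lerDl.
- by move=> t x /andP[h1 h2]; apply: sH; rewrite subr_ge0 h2 lerBlDr lerDl.
- by move=> x /H1 <-; rewrite subr0.
- by move=> x /H0 <-; rewrite subrr.
Qed.

Lemma hom_trans g f l : homotopic f g -> homotopic g l -> homotopic f l.
Proof.
move=> [H [cH sH H0 H1]] [K [cK sK K0 K1]].
pose L (p : R * V3) := if p.1 <= 1/2 then H (2 * p.1, p.2) else K (2 * p.1 - 1, p.2).
exists L; split.
- pose A : set (R * V3) := (`[0, 1/2]%classic : set R) `*` sphere 2.
  pose B : set (R * V3) := (`[1/2, 1]%classic : set R) `*` sphere 2.
  have AB : cyl2 `<=` A `|` B.
    move=> p /cyl2P[/andP[h1 h2] h3]; case: (leP p.1 (1/2)) => h; [left|right];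
      by split => //=; rewrite in_itv /= ?h1 ?h2 ?h // ltW.
  apply: cts_sub AB _; apply: withinU_continuous.
  + apply: compact_closed; first exact: norm_hausdorff.
    by apply: compact_setX; [exact: segment_compact|exact: compact_sphere].
  + apply: compact_closed; first exact: norm_hausdorff.
    by apply: compact_setX; [exact: segment_compact|exact: compact_sphere].
  + change (cts A L); apply: (@cts_ext _ _ _ (fun p : R * V3 => H (2 * p.1, p.2))).
      by move=> p [/=]; rewrite in_itv /= /L => /andP[_ ->].
    apply: (cts_comp cH) => [|p [/=]]; first by ctst.
    by rewrite in_itv /= => /andP[h1 h2] h3; apply/cyl2P; split => //=; lra.
  + change (cts B L); apply: (@cts_ext _ _ _ (fun p : R * V3 => K (2 * p.1 - 1, p.2))).
      move=> p [/=]; rewrite in_itv /= /L => /andP[h _] hp; case: ifP => // h'.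
      have -> : p.1 = 1/2 by lra.
      have e : 2 * (1/2) = 1 :> R by lra.
      by rewrite e subrr H1 // K0.
    apply: (cts_comp cK) => [|p [/=]]; first by ctst.
    by rewrite in_itv /= => /andP[h1 h2] h3; apply/cyl2P; split => //=; lra.
- move=> t x /andP[t0 t1] sx; rewrite /L /=; case: (leP t (1/2)) => h.
    by apply: sH => //; lra.
  by apply: sK => //; lra.
- by move=> x sx; rewrite /L /= ifT ?mulr0 ?H0 //; lra.
- move=> x sx; rewrite /L /= ifF; last by apply/negbTE; rewrite -ltNge; lra.
  by rewrite mulr1 -addrA subrr addr0 K1.
Qed.

Lemma hom_ext f g f' g' : (forall x, sphere 2 x -> f x = f' x) ->
  (forall x, sphere 2 x -> g x = g' x) -> homotopic f g -> homotopic f' g'.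
Proof.
move=> ef eg [H [cH sH H0 H1]]; exists H; split => // x sx.
  by rewrite H0 // ef.
by rewrite H1 // eg.
Qed.

Lemma hom_post k f g : smap k -> homotopic f g -> homotopic (fun x => k (f x)) (fun x => k (g x)).
Proof.
move=> [ck sk] [H [cH sH H0 H1]]; exists (fun p => k (H p)); split.
- by apply: (cts_comp ck) => // -[t x] /cyl2P[/=]; exact: sH.
- by move=> t x ht sx; apply: sk; exact: sH.
- by move=> x sx; rewrite H0.
- by move=> x sx; rewrite H1.
Qed.

Lemma hom_pre k f g : smap k -> homotopic f g -> homotopic (fun x => f (k x)) (fun x => g (k x)).
Proof.
move=> [ck sk] [H [cH sH H0 H1]]; exists (fun p => H (p.1, k p.2)); split => /=.
- apply: (cts_comp cH) => [|p /cyl2P[h1 h2]]; last by apply/cyl2P; split => //; exact: sk.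
  apply: cts_pair; first by ctst.
  by apply: (cts_comp ck) => [|p /cyl2P[]] //; ctst.
- by move=> t x ht sx; apply: sH => //; exact: sk.
- by move=> x sx; rewrite H0 //; exact: sk.
- by move=> x sx; rewrite H1 //; exact: sk.
Qed.

(** Radial projection turns a homotopy that avoids the origin into a homotopy
   on the sphere. *)
Lemma hom_unit (H : R * V3 -> V3) : cts cyl2 H -> (forall p, cyl2 p -> H p != 0) ->
  homotopic (fun x => unit_vec (H (0, x))) (fun x => unit_vec (H (1, x))).
Proof.
move=> cH nz; exists (fun p => unit_vec (H p)); split => //; first exact: cts_unit.
by move=> t x ht sx; apply: unit_sphere; apply: nz; apply/cyl2P.
Qed.

Lemma smapN : smap (fun x => - x).
Proof. by split; [ctst|exact: sphereN]. Qed.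

Lemma hom_opp f g : homotopic f g -> homotopic (fun x => - f x) (fun x => - g x).
Proof. exact: hom_post smapN. Qed.

End Sphere.

(** * Maps preserving the complement of the poles *)

Section Degree.
Context {R : realType}.
Local Notation V3 := ('rV[R]_3).

(** Over an interval [- T, T] that contains n periods, the increment of the
   angle over a period is an integer multiple of 2 pi, hence constant. *)
Lemma wind_reparam (X Y : R -> R) (m n : int) :
  cts setT X -> cts setT Y -> (forall t, X t != 0 \/ Y t != 0) ->
  (forall t, X (t + 2 * pi) = X t /\ Y (t + 2 * pi) = Y t) ->
  wind X Y m -> wind (fun t => X (t * n%:~R)) (fun t => Y (t * n%:~R)) (n * m).
Proof.
move=> cX cY nz per w; have t0 := twopi_gt0 (R := R).
pose N := (`|n|%N).+1; pose T : R := 2 * pi * N%:R.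
have N0 : 0 < N%:R :> R by rewrite ltr0n.
have T0 : 0 < T by rewrite mulr_gt0.
pose D : set R^o := [set t | - T <= t <= T].
have cD : compact D.
  have -> : D = (`[- T, T]%classic : set R) by apply/seteqP; split => t; rewrite /D /= in_itv.
  exact: segment_compact.
have [|t p /andP[h1 h2] /andP[h3 h4]|||p _|b cb pb] := @polar_lift R R^o D X Y cD.
- by rewrite /D /= oppr_le0 (ltW T0).
- rewrite /D /= /GRing.scale /=; nra.
- exact: cts_sub cX.
- exact: cts_sub cY.
- exact: nz.
have step t : D t -> D (t + 2 * pi) -> b (t + 2 * pi) = b t + 2 * pi * m%:~R.
  pose g t := (b (t + 2 * pi) - b t) / (2 * pi).
  have gi t' : D t' -> D (t' + 2 * pi) -> exists k : int, g t' = k%:~R.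
    move=> d1 d2; have [e1 e2] := per t'.
    have := pb _ d2; rewrite e1 e2 => h; have [k kE] := polar_uniq h (pb _ d1).
    by exists k; rewrite /g kE addrC addKr mulrC mulKf // gt_eqF.
  have piT : 2 * pi <= T.
    by rewrite /T -[X in X <= _]mulr1 ler_pM2l // ler1n.
  have gcst x y : x <= y -> D x -> D (y + 2 * pi) -> g x = g y.
    move=> xy /andP[dx dx'] /andP[dy dy'].
    have cg : cts `[x, y] g.
      apply: ctsM; last exact: cts_cst.
      apply: ctsB; apply: (cts_comp cb).
      - by apply: ctsD; [exact: cts_id|exact: cts_cst].
      - by move=> s; rewrite /= in_itv /= /D /= => /andP[h1 h2]; lra.
      - exact: cts_id.
      - by move=> s; rewrite /= in_itv /= /D /= => /andP[h1 h2]; lra.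
    apply: (int_valued_cst xy cg) => s /andP[h1 h2]; apply: gi; rewrite /D /=; lra.
  have g0 : g 0 = m%:~R.
    have [k kE] := gi 0 ltac:(by rewrite /D /=; lra) ltac:(by rewrite /D /=; lra).
    rewrite kE; congr (_%:~R); apply: wind_uniq w; exists b; split.
    - by apply: cts_sub cb => s /circP /andP[h1 h2]; rewrite /D /=; lra.
    - by move=> s /circP /andP[h1 h2]; apply: pb; rewrite /D /=; lra.
    - by rewrite -kE /g add0r [2 * pi * _]mulrC divfK ?gt_eqF // [RHS]addrC subrK.
  move=> d1 d2; have : g t = m%:~R.
    have D0 : D 0 by rewrite /D /=; lra.
    have D2 : D (0 + 2 * pi) by rewrite /D /=; lra.
    by case: (leP t 0) => [h|/ltW h]; rewrite -g0; [apply: gcst|symmetry; apply: gcst].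
  by move=> <-; rewrite /g [2 * pi * _]mulrC divfK ?gt_eqF // [RHS]addrC subrK.
have steps (j : nat) t : - T <= t -> t + 2 * pi * j%:R <= T ->
    b (t + 2 * pi * j%:R) = b t + 2 * pi * (j%:R * m%:~R).
  elim: j => [|j IH] h1 h2; first by rewrite mulr0 mul0r mulr0 !addr0.
  have e : t + 2 * pi * j.+1%:R = t + 2 * pi * j%:R + 2 * pi by rewrite -(natr1 j); ring.
  have j0 : 0 <= 2 * pi * j%:R :> R by rewrite mulr_ge0 // ltW.
  by rewrite e step ?IH ?/D //=; first (by rewrite -(natr1 j); ring); lra.
have nN : `|n%:~R| <= N%:R :> R.
  by rewrite -intr_norm -[N%:R]/((N%:Z)%:~R) ler_int /N; lia.
have Dn t : circ t -> D (t * n%:~R).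
  move=> /circP /andP[h1 h2]; rewrite /D /= -ler_norml normrM ger0_norm //.
  by apply: ler_pM.
exists (fun t => b (t * n%:~R)); split.
- by apply: (cts_comp cb) => //; apply: ctsM; [exact: cts_id|exact: cts_cst].
- by move=> t /Dn; exact: pb.
have [j [jN nE]] : exists j : nat, (j <= N)%N /\ (n%:~R = j%:R :> R \/ n%:~R = - j%:R :> R).
  exists `|n|%N; split; first by rewrite /N.
  by case: (n) => k; [left|right; rewrite NegzE mulrNz].
have jT : 2 * pi * j%:R <= T by rewrite /T ler_pM2l // ler_nat.
have j0 : 0 <= 2 * pi * j%:R :> R by rewrite mulr_ge0 // ltW.
rewrite mul0r intrM; case: nE => ->.
  by have := steps j 0; rewrite add0r; apply => //; lra.
have := steps j (- (2 * pi * j%:R)); rewrite addNr => -> //; try lra.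
by rewrite !mulrN mulNr mulrN addrK.
Qed.

Definition equator (t : R) : V3 := vec (cos t) (sin t) 0.

Lemma equatorP t : sphere 2 (equator t).
Proof. by apply/sphereP; rewrite !coordE expr0n /= addr0 cos2Dsin2. Qed.

Definition offpole (x : V3) : Prop := px x != 0 \/ py x != 0.

(** The loop c turns k times around the vertical axis. *)
Definition turn (c : R -> V3) (k : int) : Prop :=
  wind (fun t => px (c t)) (fun t => py (c t)) k.

Lemma turn_ext (c c' : R -> V3) k :
  (forall t, circ t -> c t = c' t) -> turn c k -> turn c' k.
Proof. by move=> e; apply: wind_ext => t /e ->. Qed.

Lemma turn_transport (C : R * R -> V3) k : cts cyl C ->
  (forall s t, 0 <= s <= 1 -> circ t -> offpole (C (s, t))) ->
  (forall s, 0 <= s <= 1 -> C (s, 2 * pi) = C (s, 0)) ->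
  turn (fun t => C (0, t)) k -> turn (fun t => C (1, t)) k.
Proof.
move=> cC off per.
apply: (wind_transport (X := fun s t => px (C (s, t))) (Y := fun s t => py (C (s, t)))) => //.
- by apply: cts_px; apply: cts_ext cC => -[].
- by apply: cts_py; apply: cts_ext cC => -[].
- by move=> s /per ->.
Qed.

Lemma cossin_neq0 (t : R) : cos t != 0 \/ sin t != 0.
Proof.
apply: or_neq0 => c0 s0.
by have := cos2Dsin2 t; rewrite c0 s0 expr0n /= addr0 => /esym/eqP; rewrite oner_eq0.
Qed.

Lemma polar_norm (x y a r : R) : 0 < r -> r ^+ 2 = x ^+ 2 + y ^+ 2 -> polar x y a ->
  x = r * cos a /\ y = r * sin a.
Proof.
move=> r0 rE [q q0 [xE yE]]; suff -> : r = q by [].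
have : r ^+ 2 = q ^+ 2 by rewrite rE xE yE !exprMn -mulrDr cos2Dsin2 mulr1.
by move/eqP; rewrite eqrXn2 ?ltW // => /eqP.
Qed.

Lemma cos_2pi (t : R) : cos (t + 2 * pi) = cos t.
Proof. by have := cos_periodz t 1; rewrite mulr1. Qed.
Lemma sin_2pi (t : R) : sin (t + 2 * pi) = sin t.
Proof. by have := sin_periodz t 1; rewrite mulr1. Qed.

Lemma equator_per t : equator (t + 2 * pi) = equator t.
Proof. by rewrite /equator cos_2pi sin_2pi. Qed.

Lemma offpole_pz (x : V3) : sphere 2 x -> offpole x -> pz x ^+ 2 < 1.
Proof.
move=> /sphereP h [] /= n0; have := sqr_ge0 (px x); have := sqr_ge0 (py x).
  have : 0 < px x ^+ 2 by rewrite exprn_even_gt0.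
  by move: h; lra.
have : 0 < py x ^+ 2 by rewrite exprn_even_gt0.
by move: h; lra.
Qed.

(** The complement of two antipodal points retracts onto the equator: a map
   preserving it multiplies winding numbers around the axis. *)
Lemma wind_mult (f : V3 -> V3) (c : R -> V3) (m n : int) :
  smap f -> (forall x, sphere 2 x -> offpole x -> offpole (f x)) ->
  turn (fun t => f (equator t)) m ->
  cts circ c -> (forall t, circ t -> sphere 2 (c t) /\ offpole (c t)) ->
  c (2 * pi) = c 0 ->
  turn c n -> turn (fun t => f (c t)) (n * m).
Proof.
move=> [cf sf] fo wm cc sc ec [a [ca pa ea]].
pose Y s t := s * pz (c t).
pose A s t := s * a t + (1 - s) * (t * n%:~R).
pose rho s t := Num.sqrt (1 - Y s t ^+ 2).
pose C (p : R * R) := vec (rho p.1 p.2 * cos (A p.1 p.2)) (rho p.1 p.2 * sin (A p.1 p.2)) (Y p.1 p.2).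
have Y1 s t : 0 <= s <= 1 -> circ t -> Y s t ^+ 2 < 1.
  move=> /andP[s0 s1] /sc[h1 h2]; have h := offpole_pz h1 h2; rewrite /Y exprMn.
  by apply: le_lt_trans h; rewrite ler_piMl ?sqr_ge0 // expr_le1.
have rho0 s t : 0 <= s <= 1 -> circ t -> 0 < rho s t.
  by move=> hs ht; rewrite sqrtr_gt0 subr_gt0 Y1.
have Csph s t : 0 <= s <= 1 -> circ t -> sphere 2 (C (s, t)).
  move=> hs ht; apply/sphereP; rewrite !coordE /= [(_ * cos _) ^+ 2]exprMn [(_ * sin _) ^+ 2]exprMn -mulrDr.
  rewrite cos2Dsin2 mulr1; have h : 0 <= 1 - Y s t ^+ 2 by rewrite subr_ge0 ltW // Y1.
  by rewrite (sqr_sqrtr h) subrK.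
have Coff s t : 0 <= s <= 1 -> circ t -> offpole (C (s, t)).
  move=> hs ht; rewrite /offpole !coordE /=.
  by case: (cossin_neq0 (A s t)) => h; [left|right]; rewrite mulf_neq0 // gt_eqF // rho0.
have c1 : cts cyl (fun p : R * R => p.1) by ctst.
have cC : cts cyl C.
  have cY : cts cyl (fun p : R * R => Y p.1 p.2).
    by rewrite /Y; ctst; exact: cts_cyl2.
  have cA : cts cyl (fun p : R * R => A p.1 p.2).
    by rewrite /A; ctst; exact: cts_cyl2.
  have cr : cts cyl (fun p : R * R => rho p.1 p.2) by rewrite /rho; ctst.
  by rewrite /C; ctst.
have cfC : cts cyl (fun p => f (C p)).
  by apply: (cts_comp cf) => // -[s t] /cylP[h1 /circP h2]; exact: Csph.
have E1 t : circ t -> C (1, t) = c t.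
  move=> ht; have [h1 h2] := sc _ ht; rewrite /C /= /Y /A mul1r subrr mul0r addr0 mul1r.
  have i1 : 0 <= (1 : R) <= 1 by rewrite lexx ler01.
  have [|e1 e2] := polar_norm (rho0 1 t i1 ht) _ (pa _ ht).
    rewrite sqr_sqrtr /Y mul1r; last by rewrite subr_ge0 ltW // offpole_pz.
    by move/sphereP: h1; lra.
  by rewrite -e1 -e2 vec_eta.
have E0 t : C (0, t) = equator (t * n%:~R).
  rewrite /C /= /rho /Y /A !mul0r add0r subr0 mul1r expr0n /= subr0 sqrtr1 !mul1r.
  by [].
have K : turn (fun t => f (C (1, t))) (n * m).
  apply: (turn_transport (C := fun p => f (C p))) => //.
  - by move=> s t hs ht; apply: fo; [exact: Csph|exact: Coff].
  - move=> s hs; suff -> : C (s, 2 * pi) = C (s, 0) by [].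
    rewrite /C /= /rho /Y ec; congr (vec (_ * _) (_ * _) _).
      have -> : A s (2 * pi) = A s 0 + 2 * pi * n%:~R by rewrite /A ea; ring.
      by rewrite cos_periodz.
    have -> : A s (2 * pi) = A s 0 + 2 * pi * n%:~R by rewrite /A ea; ring.
    by rewrite sin_periodz.
  apply: (@turn_ext (fun t => f (equator (t * n%:~R)))); first by move=> t _; rewrite E0.
  have ce : cts setT (fun t => f (equator t)).
    by apply: (cts_comp cf) => [|t _]; [rewrite /equator; ctst|exact: equatorP].
  apply: (wind_reparam (X := fun t => px (f (equator t))) (Y := fun t => py (f (equator t)))) => //.
  - exact: cts_px.
  - exact: cts_py.
  - move=> t; apply: fo; first exact: equatorP.
    by rewrite /offpole !coordE; exact: cossin_neq0.
  - by move=> t; rewrite equator_per.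
by apply: turn_ext K => t /E1 ->.
Qed.

End Degree.

(** * Fixed-point free maps exchanging the poles *)

Section FixedPointFree.
Context {R : realType}.
Local Notation V3 := ('rV[R]_3).

Definition circle_at (y t : R) : V3 :=
  vec (Num.sqrt (1 - y ^+ 2) * cos t) (Num.sqrt (1 - y ^+ 2) * sin t) y.

Lemma circle_at_sphere y t : y ^+ 2 <= 1 -> sphere 2 (circle_at y t).
Proof.
move=> h; apply/sphereP; rewrite !coordE !exprMn -mulrDr cos2Dsin2 mulr1.
by rewrite sqr_sqrtr ?subr_ge0 // subrK.
Qed.

Lemma circle_at_off y t : y ^+ 2 < 1 -> offpole (circle_at y t).
Proof.
move=> h; have h0 : 0 < Num.sqrt (1 - y ^+ 2) by rewrite sqrtr_gt0 subr_gt0.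
rewrite /offpole !coordE.
by case: (cossin_neq0 t) => ht; [left|right]; rewrite mulf_neq0 // gt_eqF.
Qed.

Lemma circle_at0 t : circle_at 0 t = equator t.
Proof. by rewrite /circle_at expr0n /= subr0 sqrtr1 !mul1r. Qed.

Lemma circle_at_per y : circle_at y (2 * pi) = circle_at y 0.
Proof. by rewrite /circle_at -[2 * pi]add0r cos_2pi sin_2pi. Qed.

Lemma sphere_pz1 (x : V3) : sphere 2 x -> pz x = 1 -> x = north.
Proof.
move=> /sphereP h e; move: h; rewrite e expr1n => h.
have hx := sqr_ge0 (px x); have hy := sqr_ge0 (py x).
have /eqP : px x ^+ 2 = 0 by lra.
have /eqP : py x ^+ 2 = 0 by lra.
rewrite !sqrf_eq0 => /eqP ey /eqP ex.
by apply: eq3; rewrite !coordE.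
Qed.

Lemma sphere_pz_le1 (x : V3) : sphere 2 x -> -1 <= pz x <= 1.
Proof.
move=> /sphereP sx; have := sqr_ge0 (px x); have := sqr_ge0 (py x).
by move=> h1 h2; rewrite -ler_norml -(@expr_le1 _ 2) // real_normK ?num_real //; lra.
Qed.

Lemma near_north (g : V3 -> R) : cts (sphere 2) g -> 0 < g north ->
  exists2 y : R, 0 < y < 1 & forall x, sphere 2 x -> y <= pz x -> 0 < g x.
Proof.
move=> cg g0.
have [|x sx|e e0 eP] := compact_pos_near (h := fun x => pz x - 1) (@compact_sphere R 2) cg.
- by ctst.
- by move/eqP; rewrite subr_eq0 => /eqP /(sphere_pz1 sx) ->.
exists (1 - Num.min e 1 / 2).
  have : 0 < Num.min e 1 by rewrite lt_min e0 ltr01.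
  have : Num.min e 1 <= 1 by rewrite ge_min lexx orbT.
  by lra.
move=> x sx hx; apply: eP => //.
have m1 : Num.min e 1 <= e by rewrite ge_min lexx.
have /andP[_ x1] := sphere_pz_le1 sx.
by rewrite ler0_norm ?subr_le0 //; lra.
Qed.

Lemma near_south (g : V3 -> R) : cts (sphere 2) g -> 0 < g (- north) ->
  exists2 y : R, 0 < y < 1 & forall x, sphere 2 x -> pz x <= - y -> 0 < g x.
Proof.
move=> cg g0; have [||y hy yP] := near_north (g := fun x => g (- x)) => //.
  by apply: (cts_comp cg) => [|x /sphereN //]; ctst.
exists y => // x sx hx; have := yP (- x) (sphereN sx); rewrite opprK; apply.
by rewrite !coordE; lra.
Qed.

(** In the stereographic coordinate z, the map f exchanges 0 and infinity and
   f(z)/z never takes the value 1, hence its winding number around 1 does not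
   depend on the circle |z| = r.  It vanishes for r large, where f(z)/z is
   close to 0, and equals the one around 0 for r small; hence f(z) winds around
   0 as z does.  The formulas below are 1 - f(z)/z, up to a positive factor. *)
Lemma wind_pole_swap (f : V3 -> V3) : smap f ->
  (forall x, sphere 2 x -> f x <> x) ->
  f north = - north -> f (- north) = north ->
  (forall x, sphere 2 x -> offpole x -> offpole (f x)) ->
  turn (fun t => f (equator t)) 1.
Proof.
move=> [cf sf] nofix fN fS foff.
(* up to positive factors, the product of the conjugate of z by f(z), and then
   1 - f(z)/z *)
pose wx (x : V3) := px x * px (f x) + py x * py (f x).
pose wy (x : V3) := px x * py (f x) - py x * px (f x).
pose n2 (x : V3) := px x ^+ 2 + py x ^+ 2.
pose Qx x := n2 x * (1 + pz (f x)) - (1 + pz x) * wx x.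
pose Qy x := - ((1 + pz x) * wy x).
have ww x : wx x ^+ 2 + wy x ^+ 2 = n2 x * n2 (f x) by rewrite /wx /wy /n2; ring.
have n2E x : sphere 2 x -> n2 x = (1 - pz x) * (1 + pz x).
  by move=> /sphereP h; rewrite /n2; lra.
have n20 x : offpole x -> 0 < n2 x.
  by case=> h; rewrite /n2; [rewrite ltr_pwDl|rewrite ltr_wpDl]; rewrite ?sqr_ge0 // exprn_even_gt0.
have n21 x : sphere 2 x -> n2 x <= 1.
  by move=> /sphereP h; have := sqr_ge0 (pz x); rewrite /n2; lra.
have wx1 x : sphere 2 x -> wx x ^+ 2 <= 1.
  move=> sx; have := sqr_ge0 (wy x); have := n21 _ sx; have := n21 _ (sf _ sx).
  have h0 (y : V3) : 0 <= n2 y by rewrite addr_ge0 ?sqr_ge0.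
  have := ww x; have := h0 x; have := h0 (f x); nra.
have wx1' x : sphere 2 x -> wx x <= 1.
  by move=> /wx1 h; have : `|wx x| <= 1; [rewrite -(@expr_le1 _ 2) // real_normK ?num_real|rewrite ler_norml => /andP[]].
have Qnz x : sphere 2 x -> offpole x -> Qx x != 0 \/ Qy x != 0.
  move=> sx ox; apply: or_neq0 => q1 q2; apply: (nofix _ sx).
  have of' := foff _ sx ox.
  have h1 := n2E _ sx; have h2 := n2E _ (sf _ sx).
  have p1 := n20 _ ox; have p2 := n20 _ of'.
  have /andP[b1 b2] := sphere_pz_le1 sx; have /andP[b3 b4] := sphere_pz_le1 (sf _ sx).
  have u0 : 0 < 1 + pz x by nra.
  have v0 : 0 < 1 + pz (f x) by nra.
  have n2nz : n2 x != 0 by rewrite gt_eqF.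
  have ex : px (f x) * (1 + pz x) = px x * (1 + pz (f x)).
    apply: (mulfI n2nz).
    have -> : n2 x * (px (f x) * (1 + pz x)) = (1 + pz x) * (px x * wx x - py x * wy x) by rewrite /n2 /wx /wy; ring.
    have -> : (1 + pz x) * (px x * wx x - py x * wy x) =
       px x * (n2 x * (1 + pz (f x)) - Qx x) + py x * Qy x by rewrite /Qx /Qy; ring.
    by rewrite q1 q2; ring.
  have ey : py (f x) * (1 + pz x) = py x * (1 + pz (f x)).
    apply: (mulfI n2nz).
    have -> : n2 x * (py (f x) * (1 + pz x)) = (1 + pz x) * (px x * wy x + py x * wx x) by rewrite /n2 /wx /wy; ring.
    have -> : (1 + pz x) * (px x * wy x + py x * wx x) =
       py x * (n2 x * (1 + pz (f x)) - Qx x) - px x * Qy x by rewrite /Qx /Qy; ring.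
    by rewrite q1 q2; ring.
  have e2 : n2 (f x) * (1 + pz x) ^+ 2 = n2 x * (1 + pz (f x)) ^+ 2.
    rewrite /n2 !mulrDl -!exprMn ex ey; ring.
  have ez : pz (f x) = pz x.
    have e3 : (1 + pz x) * (1 + pz (f x)) * ((1 - pz (f x)) * (1 + pz x)) =
       (1 + pz x) * (1 + pz (f x)) * ((1 - pz x) * (1 + pz (f x))).
      by move: e2; rewrite h1 h2 !expr2 => e2; lra.
    have := mulfI (lt0r_neq0 (mulr_gt0 u0 v0)) e3; lra.
  move: ex ey; rewrite ez => /(mulIf (lt0r_neq0 u0)) ex /(mulIf (lt0r_neq0 u0)) ey.
  exact: eq3.
have cpf : cts (sphere 2) (fun x => pz (f x)) by apply: cts_pz.
have [|y1 /andP[y10 y11] y1P] := near_north (g := fun x => - pz (f x)) (ctsN cpf).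
  by rewrite fN !coordE opprK ltr01.
have [|y0 /andP[y00 y01] y0P] := near_south cpf; first by rewrite fS !coordE ltr01.
have c1 : cts cyl (fun p : R * R => p.1) by ctst.
have c2 : cts cyl (fun p : R * R => p.2) by ctst.
have small y : - y0 <= y <= y1 -> y ^+ 2 < 1.
  move=> /andP[h1 h2]; have : `|y| < 1 by rewrite ltr_norml; lra.
  by rewrite -(real_normK (num_real y)) expr_lt1.
have mid s u v : 0 <= s <= 1 -> - y0 <= u -> u <= v -> v <= y1 ->
    - y0 <= u + s * (v - u) <= y1 by move=> /andP[? ?] ? ? ?; nra.
(* the circles between the heights u and v *)
pose C u v (p : R * R) := circle_at (u + p.1 * (v - u)) p.2.
have cC u v : cts cyl (C u v) by rewrite /C /circle_at; ctst.
have Csph u v p : - y0 <= u -> u <= v -> v <= y1 -> cyl p -> sphere 2 (C u v p) /\ offpole (C u v p).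
  move=> h1 h2 h3 /cylP[hs _]; have h := small _ (mid _ _ _ hs h1 h2 h3).
  by split; [apply: circle_at_sphere; exact: ltW|exact: circle_at_off].
have cfC u v : - y0 <= u -> u <= v -> v <= y1 -> cts cyl (fun p => f (C u v p)).
  by move=> h1 h2 h3; apply: (cts_comp cf (cC u v)) => p /(Csph u v p h1 h2 h3)[].
have Cper u v s : C u v (s, 2 * pi) = C u v (s, 0) by rewrite /C /= circle_at_per.
have C0 u v t : C u v (0, t) = circle_at u t by rewrite /C /= mul0r addr0.
have C1 u v t : C u v (1, t) = circle_at v t by rewrite /C /= mul1r addrC subrK.
have cylI (s t : R) : 0 <= s <= 1 -> circ t -> cyl (s, t) by move=> ? /circP ?; apply/cylP.
have i0 : 0 <= (0 : R) <= 1 by rewrite lexx ler01.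
have k1 : - y0 <= - y0 by []. 
have k2 : - y0 <= y1 by lra.
have k3 : y1 <= y1 by [].
pose D := C (- y0) y1.
have cQx : cts cyl (fun p => Qx (D p)).
  have cD := cC (- y0) y1; have cfD := cfC _ _ k1 k2 k3.
  by rewrite /Qx /n2 /wx; ctst.
have cQy : cts cyl (fun p => Qy (D p)).
  have cD := cC (- y0) y1; have cfD := cfC _ _ k1 k2 k3.
  by rewrite /Qy /wy; ctst.
have ccirc (g : R * R -> R) s : 0 <= s <= 1 -> cts cyl g -> cts circ (fun t => g (s, t)).
  move=> hs cg; apply: (cts_comp cg) => [|t ht]; last exact: cylI.
  by apply: cts_pair; [exact: cts_cst|exact: cts_id].
(* near the south pole f(z)/z is close to 0 *)
have W0 : wind (fun t => Qx (D (0, t))) (fun t => Qy (D (0, t))) 0.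
  apply: wind_right.
  - move=> t ht; have [sD oD] := Csph _ _ _ k1 k2 k3 (cylI _ _ i0 ht).
    rewrite -/D in sD oD.
    have hz : pz (D (0, t)) = - y0 by rewrite /D C0 /circle_at !coordE.
    have := y0P _ sD; rewrite hz lexx => /(_ isT) hf.
    rewrite /Qx n2E // hz; have hw := wx1' _ sD.
    have h1 : 0 < (1 + y0) * (1 + pz (f (D (0, t)))) - wx (D (0, t)) by nra.
    have : 0 < (1 - y0) * ((1 + y0) * (1 + pz (f (D (0, t)))) - wx (D (0, t))).
      by rewrite mulr_gt0 // subr_gt0.
    by lra.
  - exact: (ccirc (fun p => Qx (D p))).
  - exact: (ccirc (fun p => Qy (D p))).
  - by rewrite /D Cper.
  - by rewrite /D Cper.
have W1 : wind (fun t => Qx (D (1, t))) (fun t => Qy (D (1, t))) 0.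
  apply: (wind_transport (X := fun s t => Qx (D (s, t))) (Y := fun s t => Qy (D (s, t)))) W0.
  - by apply: cts_ext cQx => -[].
  - by apply: cts_ext cQy => -[].
  - by move=> s t hs ht; have [] := Csph _ _ _ k1 k2 k3 (cylI _ _ hs ht); exact: Qnz.
  - by move=> s _; rewrite /D Cper.
have i1 : 0 <= (1 : R) <= 1 by rewrite lexx ler01.
pose E t := circle_at y1 t.
have DE t : D (1, t) = E t by rewrite /D C1.
have sE t : circ t -> sphere 2 (E t) /\ offpole (E t).
  by move=> ht; rewrite -DE; exact: Csph _ _ _ k1 k2 k3 (cylI _ _ i1 ht).
have zE t : pz (E t) = y1 by rewrite /E /circle_at !coordE.
have fE t : circ t -> pz (f (E t)) < 0.
  by move=> ht; have [h _] := sE _ ht; have := y1P _ h; rewrite zE lexx => /(_ isT); lra.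
have cE : cts circ E by rewrite /E /circle_at; ctst.
have cfE : cts circ (fun t => f (E t)) by apply: (cts_comp cf cE) => t /sE[].
have perE : E (2 * pi) = E 0 by rewrite /E circle_at_per.
(* near the north pole the term 1 may be dropped *)
have W2 : wind (fun t => - ((1 + y1) * wx (E t))) (fun t => - ((1 + y1) * wy (E t))) 0.
  have W1' : wind (fun t => Qx (E t)) (fun t => Qy (E t)) 0.
    by apply: wind_ext W1 => t _; rewrite DE.
  apply: wind_segment W1'; rewrite ?perE //; try by [rewrite /Qx /n2 /wx; ctst|rewrite /Qy /wy; ctst].
  move=> s t /andP[s0 s1] ht; have [h1 h2] := sE _ ht.
  rewrite /Qx /Qy zE.
  set A := n2 _ * _; set X := wx _; set Y := wy _.
  have y1p : 1 + y1 != 0 by rewrite gt_eqF //; lra.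
  case: (eqVneq Y 0) => [Y0|nY]; last first.
    right; rewrite -mulrDl subrK mul1r oppr_eq0 mulf_neq0 //.
  left.
  have -> : (1 - s) * (A - (1 + y1) * X) + s * - ((1 + y1) * X) = (1 - s) * A - (1 + y1) * X by ring.
  apply/eqP => h.
  (* then (1 + y1) |w| <= n2 (1 + f3), whence (1 + y1)(1 - f3) <= 1 *)
  have XX : X ^+ 2 = n2 (E t) * n2 (f (E t)) by rewrite -ww -/X -/Y Y0 expr0n /= addr0.
  have a0 := n20 _ h2; have b0 := n20 _ (foff _ h1 h2).
  have f0 := fE _ ht.
  have aE := n2E _ h1; have bE := n2E _ (sf _ h1); rewrite zE in aE.
  have X1 := wx1' _ h1; rewrite -/X in X1.
  have /andP[g1 g2] := sphere_pz_le1 (sf _ h1).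
  have v0 : 0 < 1 + pz (f (E t)) by nra.
  have Xp : 0 <= X by rewrite /A in h; have : 0 <= (1 - s) * (n2 (E t) * (1 + pz (f (E t)))); [rewrite !mulr_ge0 ?subr_ge0 // ltW|nra].
  have X0 : 0 < X by rewrite lt_neqAle Xp andbT eq_sym -sqrf_eq0 XX mulf_neq0 // gt_eqF.
  have le1 : (1 + y1) * X <= n2 (E t) * (1 + pz (f (E t))).
    rewrite -/A; have : 0 <= A by rewrite mulr_ge0 // ltW.
    nra.
  have le2 : (1 + y1) * X * (1 - pz (f (E t))) <= X * X.
    have f1 : 0 <= 1 - pz (f (E t)) by lra.
    by have := ler_wpM2r f1 le1; rewrite -[X * X]expr2 XX bE; lra.
  have le3 : (1 + y1) * (1 - pz (f (E t))) <= X.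
    by rewrite -(ler_pM2l X0); lra.
  have : 0 < y1 * - pz (f (E t)) by rewrite mulr_gt0 // oppr_gt0.
  by clear -le3 X1 y10 f0; lra.
have W3 : wind (fun t => wx (E t)) (fun t => wy (E t)) 0.
  have m0 : -1 != 0 :> R \/ (0 : R) != 0 by left; rewrite oppr_eq0 oner_eq0.
  have := wind_mul (wind_cst m0) W2; rewrite addr0 => h.
  apply: (wind_cancel (c := fun=> 1 + y1)); first by move=> _ _; lra.
  by apply: wind_ext h => t _; split; ring.
have W4 : turn (fun t => f (E t)) 1.
  have r0 : 0 < Num.sqrt (1 - y1 ^+ 2) by rewrite sqrtr_gt0 subr_gt0 small // k2 k3.
  have h := wind_mul (wind_scale (c := fun=> Num.sqrt (1 - y1 ^+ 2)) (fun _ _ => r0) (wind_circle 1)) W3.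
  apply: (wind_cancel (c := fun t => n2 (E t))); first by move=> t /sE[_ /n20].
  rewrite addr0 in h; apply: wind_ext h => t _.
  have ex : px (E t) = Num.sqrt (1 - y1 ^+ 2) * cos t by rewrite /E /circle_at !coordE.
  have ey : py (E t) = Num.sqrt (1 - y1 ^+ 2) * sin t by rewrite /E /circle_at !coordE.
  by rewrite mulr1 -ex -ey /n2 /wx /wy; split; ring.
have k4 : - y0 <= 0 by lra.
have k5 : 0 <= y1 by lra.
have W5 : turn (fun t => f (C 0 y1 (1 - 1, t))) 1.
  have rev (s : R) : 0 <= s <= 1 -> 0 <= 1 - s <= 1 by lra.
  apply: (turn_transport (C := fun p => f (C 0 y1 (1 - p.1, p.2)))).
  - apply: (cts_comp (cfC 0 y1 k4 k5 k3)) => [|p /cylP[h1 h2]]; first by ctst.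
    by apply/cylP; split => //=; exact: rev.
  - move=> s t /rev hs ht; have [] := Csph _ _ _ k4 k5 k3 (cylI _ _ hs ht); exact: foff.
  - by move=> s _; rewrite /= Cper.
  - by apply: turn_ext W4 => t _; rewrite /= subr0 C1.
by apply: turn_ext W5 => t _; rewrite subrr C0 circle_at0.
Qed.

End FixedPointFree.

(** * Moving two points to the poles *)

Section AxisHomeo.
Context {R : realType}.
Local Notation V3 := ('rV[R]_3).

Definition homeo2 (h g : V3 -> V3) : Prop :=
  [/\ smap h, smap g, forall x, sphere 2 x -> g (h x) = x
    & forall x, sphere 2 x -> h (g x) = x].

Lemma dotC (x y : V3) : dot x y = dot y x.
Proof. by rewrite /dot; ring. Qed.
Lemma dotDl (x y z : V3) : dot (x + y) z = dot x z + dot y z.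
Proof. by rewrite /dot !coordE; ring. Qed.
Lemma dotZl c (x z : V3) : dot (c *: x) z = c * dot x z.
Proof. by rewrite /dot !coordE; ring. Qed.
Lemma dotNl (x z : V3) : dot (- x) z = - dot x z.
Proof. by rewrite /dot !coordE; ring. Qed.
Lemma dotBl (x y z : V3) : dot (x - y) z = dot x z - dot y z.
Proof. by rewrite dotDl dotNl. Qed.

Lemma sphere_dot (x : V3) : sphere 2 x <-> dot x x = 1.
Proof. by rewrite -normsq_dot. Qed.

Lemma dot_lt1 (p q : V3) : sphere 2 p -> sphere 2 q -> p <> q -> dot p q < 1.
Proof.
move=> /sphere_dot hp /sphere_dot hq pq.
have d0 : p - q != 0 by rewrite subr_eq0; apply/eqP.
by have := normsq_gt0 d0; rewrite normsq_dot; move: hp hq; rewrite /dot !coordE; lra.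
Qed.

(** The homeomorphism onto the unit sphere given by radial projection from an
   interior point a, followed by the homogeneous bijection S. *)
Section Projection.
Variables (a : V3) (S T : V3 -> V3).
Hypothesis a1 : dot a a < 1.
Hypothesis ST : forall x, S (T x) = x.
Hypothesis TS : forall x, T (S x) = x.
Hypothesis SZ : forall c x, S (c *: x) = c *: S x.
Hypothesis TZ : forall c x, T (c *: x) = c *: T x.
Hypothesis cS : cts setT S.
Hypothesis cT : cts setT T.

Let k x := unit_vec (S (x - a)).
Let root v := - dot a v + Num.sqrt (dot a v ^+ 2 + 1 - dot a a).
Let g y := a + root (unit_vec (T y)) *: unit_vec (T y).

Lemma proj_S0 x : x != 0 -> S x != 0.
Proof.
by apply: contra_neq => h; have := TZ 0 0; rewrite !scale0r -h TS.
Qed.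
Lemma proj_T0 x : x != 0 -> T x != 0.
Proof.
by apply: contra_neq => h; have := SZ 0 0; rewrite !scale0r -h ST.
Qed.

Lemma proj_sub0 x : sphere 2 x -> x - a != 0.
Proof.
move=> /sphere_dot sx; rewrite subr_eq0; apply/eqP => e.
by move: a1; rewrite -e sx ltxx.
Qed.

Lemma root_gt0 v : 0 < root v.
Proof.
rewrite /root addrC subr_gt0 (le_lt_trans (ler_norm _)) // -sqrtr_sqr ltr_sqrt.
  by rewrite -addrA ltrDl subr_gt0.
by rewrite -addrA ltr_wpDl ?sqr_ge0 ?subr_gt0.
Qed.

Lemma root_sphere v : sphere 2 v -> sphere 2 (a + root v *: v).
Proof.
move=> /sphere_dot sv; apply/sphere_dot.
have h : 0 <= dot a v ^+ 2 + 1 - dot a a.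
  by rewrite -addrA addr_ge0 ?sqr_ge0 // subr_ge0 ltW.
have := sqr_sqrtr h; rewrite /root; set s := Num.sqrt _ => sE.
rewrite dotDl !(dotC _ (_ + _)) !dotDl !dotZl !(dotC _ (_ *: _)) !dotZl sv.
by rewrite (dotC v a); lra.
Qed.

Lemma projection_homeo : homeo2 k g.
Proof.
have skE : forall x, sphere 2 x -> sphere 2 (k x).
  by move=> x /proj_sub0/proj_S0; exact: unit_sphere.
have T0 y : sphere 2 y -> sphere 2 (unit_vec (T y)).
  by move=> /sphere_neq0/proj_T0/unit_sphere.
split.
- split => //; apply: cts_unit; first by move=> x /proj_sub0/proj_S0.
  by apply: (cts_comp cS) => //; ctst.
- split; last by move=> y /T0; exact: root_sphere.
  have cu : cts (sphere 2) (fun y => unit_vec (T y)).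
    apply: cts_unit; first by move=> x /sphere_neq0/proj_T0.
    exact: cts_sub cT.
  suff cr (u : V3 -> V3) : cts (sphere 2) u -> cts (sphere 2) (fun y => a + root (u y) *: u y).
    exact: cr cu.
  by move=> ?; rewrite /root; ctst.
- move=> x sx; have n0 := proj_sub0 sx; have [c c0 cE] := unit_factor (proj_S0 n0).
  rewrite /g /k cE TZ TS unitZ // /unit_vec.
  have m0 := normsq_gt0 n0; set r := Num.sqrt (normsq (x - a)).
  have r0 : 0 < r by rewrite sqrtr_gt0.
  have rr : r ^+ 2 = normsq (x - a) by rewrite sqr_sqrtr // ltW.
  suff -> : root (r^-1 *: (x - a)) = r.
    by rewrite scalerA divff ?scale1r ?gt_eqF // addrC subrK.
  rewrite /root; set b := dot a _.
  have bE : r * b = dot a x - dot a a.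
    rewrite /b dotC dotZl mulrA divff ?gt_eqF // mul1r dotBl.
    by rewrite (dotC x).
  have eq : r * (r + 2 * b) = 1 - dot a a.
    have -> : r * (r + 2 * b) = r ^+ 2 + 2 * (r * b) by ring.
    rewrite rr bE normsq_dot; move/sphere_dot: sx; rewrite /dot !coordE; lra.
  have pos : 0 <= b + r.
    have : 0 < r + 2 * b by rewrite -(pmulr_rgt0 _ r0) eq subr_gt0.
    lra.
  have -> : b ^+ 2 + 1 - dot a a = (b + r) ^+ 2 by rewrite -addrA -eq; ring.
  by rewrite sqrtr_sqr ger0_norm // addrA addNr add0r.
- move=> y sy; have [c c0 cE] := unit_factor (proj_T0 (sphere_neq0 sy)).
  by rewrite /k /g addrC addKr SZ unitZ ?root_gt0 // cE SZ ST unitZ // unit_id.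
Qed.

End Projection.

Lemma north_offpole (x : V3) : sphere 2 x -> ~ offpole x -> x = north \/ x = - north.
Proof.
move=> /sphereP sx nx.
have ex : px x = 0 by case: (eqVneq (px x) 0) => // h; case: nx; left.
have ey : py x = 0 by case: (eqVneq (py x) 0) => // h; case: nx; right.
move: sx; rewrite ex ey expr0n /= !add0r => /eqP.
rewrite sqrf_eq1 => /orP[] /eqP ez; [left|right]; apply: eq3; rewrite !coordE //.
- by rewrite oppr0.
- by rewrite oppr0.
Qed.

(** Any two points can be moved to the poles, by projecting the sphere from
   the middle of the chord onto a unit sphere around it, and shearing the
   direction of the chord to the vertical.  The horizontal coordinates become
   linear forms f1 and f2 up to a positive factor, which controls the loops
   around p and around q; the two determinants are opposite because the chord
   points outwards at one end and inwards at the other.  The shear is isotopic to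
   the identity if it tilts the chord by at most a right angle. *)
Lemma axis_homeo (p q : V3) : sphere 2 p -> sphere 2 q -> p <> q ->
  exists (k g : V3 -> V3) (f1 f2 : V3),
  [/\ homeo2 k g, k p = north /\ k q = - north,
      forall x, sphere 2 x -> exists2 c, 0 < c &
        px (k x) = c * dot f1 (x - p) /\ py (k x) = c * dot f2 (x - p),
      det3 f1 f2 p != 0 /\ det3 f1 f2 q = - det3 f1 f2 p
    & dot f1 (p - q) = 0 /\ dot f2 (p - q) = 0 /\
      (0 <= pz (p - q) -> homotopic id k)].
Proof.
move=> sp sq pq.
have d0 : p - q != 0 by rewrite subr_eq0; apply/eqP.
(* the direction d of the chord is taken upwards, up to the sign e, so that the
   shear along l exists *)
pose e : R := if 0 <= pz (p - q) then 1 else -1.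
have ee : e * e = 1 by rewrite /e; case: ifP; rewrite ?mulrNN mulr1.
have [c c0 cE] := unit_factor d0.
have [d dE] : exists d, d = e *: unit_vec (p - q) by eexists.
have dd : dot d d = 1.
  by rewrite dE dotZl dotC dotZl mulrA ee mul1r; apply/sphere_dot; exact: unit_sphere.
have dz : 0 <= pz d.
  rewrite dE cE scalerA pzZ mulrAC; apply: mulr_ge0; last exact: ltW.
  by rewrite /e; case: ifP => h; [rewrite mul1r|rewrite mulN1r oppr_ge0 ltW // ltNge h].
have dz1 : 0 < 1 + pz d by lra.
(* z + (z.l) (north - d) maps d to the north pole, and fixes the plane orthogonal
   to l *)
have [l [dl lz]] : exists l, dot d l = 1 /\ pz l = 1.
  have dn : dot north d = pz d by rewrite /dot !coordE; ring.
  exists ((1 + pz d)^-1 *: (d + north)); split.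
    by rewrite dotC dotZl dotDl dd dn mulVf // gt_eqF.
  by rewrite pzZ pzD [pz north]pz_vec [_ + 1]addrC mulVf // gt_eqF.
pose a := 2^-1 *: (p + q).
have a1 : dot a a < 1.
  have := dot_lt1 sp sq pq; move/sphere_dot: sp; move/sphere_dot: sq.
  by rewrite /a /dot !coordE; lra.
have [w wE] : exists w, w = north - d by eexists.
have wl : dot w l = 0 by rewrite wE dotBl dl /dot !coordE lz; ring.
pose Sh (t : R) (z : V3) := z + (t * dot z l) *: w.
have ShK t z : Sh (- t) (Sh t z) = z.
  rewrite /Sh dotDl dotZl wl mulr0 addr0 mulNr scaleNr addrK //.
have ShZ t b z : Sh t (b *: z) = b *: Sh t z.
  by rewrite /Sh dotZl scalerDr scalerA mulrCA.
have cSh t : cts setT (Sh t) by rewrite /Sh; ctst.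
have ShN t z : Sh t (- z) = - Sh t z by rewrite -scaleN1r ShZ scaleN1r.
pose S z := Sh 1 (e *: z); pose T z := e *: Sh (-1) z.
have ST z : S (T z) = z.
  by rewrite /S /T scalerA ee scale1r -[X in Sh X]opprK; exact: ShK.
have TS z : T (S z) = z by rewrite /T /S ShK scalerA ee scale1r.
have SZ b z : S (b *: z) = b *: S z by rewrite /S scalerA mulrC -scalerA ShZ.
have TZ b z : T (b *: z) = b *: T z by rewrite /T ShZ scalerA mulrC -scalerA.
have cS : cts setT S.
  by apply: (cts_comp (cSh 1)) => //; apply: ctsZ; [exact: cts_cst|exact: cts_id].
have cT : cts setT T by apply: ctsZ; [exact: cts_cst|exact: cSh].
have hk := projection_homeo a1 ST TS SZ TZ cS cT.
set k := (fun x => unit_vec (S (x - a))) in hk.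
set g := (X in homeo2 k X) in hk.
have Sd : Sh 1 d = north by rewrite /Sh mul1r dl scale1r wE addrC subrK.
have pa : p - a = (2^-1 * c^-1 * e) *: d.
  rewrite dE scalerA -mulrA ee mulr1 cE scalerA -mulrA mulVf ?gt_eqF // mulr1.
  by apply: eq3; rewrite /a !coordE; lra.
have qa : q - a = - (p - a) by apply: eq3; rewrite /a !coordE; lra.
have Sp : S (p - a) = (2^-1 * c^-1) *: north.
  by rewrite /S pa scalerA mulrCA ee mulr1 ShZ Sd.
have h2 : 0 < 2^-1 * c^-1 :> R by rewrite mulr_gt0 // invr_gt0.
pose f1 := e *: (vec 1 0 0 - px d *: l); pose f2 := e *: (vec 0 1 0 - py d *: l).
have Sx z : px (S z) = dot f1 z /\ py (S z) = dot f2 z.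
  rewrite /S /Sh /f1 /f2 wE /dot !coordE; split; ring.
have f1d : dot f1 (p - a) = 0.
  by rewrite -(Sx _).1 Sp !coordE mulr0.
have f2d : dot f2 (p - a) = 0.
  by rewrite -(Sx _).2 Sp !coordE mulr0.
have detE x : det3 f1 f2 x = dot d x.
  have := dl; rewrite /f1 /f2 /det3 /dot !coordE lz => dl'.
  have -> : pz d = 1 - px d * px l - py d * py l by lra.
  have : e ^+ 2 = 1 by rewrite expr2.
  by move=> e2; ring: e2.
have dp : dot d p = e * c * (1 - dot p q).
  rewrite dE cE scalerA dotZl dotBl (dotC q); congr (_ * (_ - _)); exact/sphere_dot.
have dq : dot d q = - (e * c * (1 - dot p q)).
  rewrite dE cE scalerA dotZl dotBl -mulrN opprB; congr (_ * (_ - _)); exact/sphere_dot.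
exists k, g, f1, f2; split => //.
- split; first by rewrite /k Sp unit_pos //; exact: northP.
  rewrite /k qa -scaleN1r SZ Sp scaleN1r unitN unit_pos //; exact: northP.
- move=> x sx; have n0 : S (x - a) != 0.
    by apply: (proj_S0 TS TZ); exact: proj_sub0.
  have [b b0 bE] := unit_factor n0; exists b => //.
  have xE : x - a = (x - p) + (p - a) by rewrite addrA subrK.
  have shift f : dot f (p - a) = 0 -> dot f (x - a) = dot f (x - p).
    by move=> h; rewrite xE dotC dotDl !(dotC _ f) h addr0.
  by rewrite /k bE pxZ pyZ (Sx _).1 (Sx _).2 !shift.
- rewrite !detE dp dq; split => //; rewrite !mulf_neq0 //.
  + by rewrite -sqrf_eq0 expr2 ee oner_eq0.
  + by rewrite gt_eqF.
  + by rewrite gt_eqF // subr_gt0 dot_lt1.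
- have pqa : p - q = 2 *: (p - a) by apply: eq3; rewrite /a !coordE; lra.
  split; first by rewrite pqa dotC dotZl dotC f1d mulr0.
  split; first by rewrite pqa dotC dotZl dotC f2d mulr0.
  move=> hz; have e1 : e = 1 by rewrite /e hz.
  have := @hom_unit R (fun z => Sh z.1 (z.2 - z.1 *: a)).
  have H0 : forall z : R * V3, cyl2 z -> Sh z.1 (z.2 - z.1 *: a) != 0.
    move=> [t x] /cyl2P[/= /andP[t0 t1] sx].
    apply/eqP => h.
    have := ShK t (x - t *: a); rewrite h.
    have Sh0 : Sh (- t) 0 = 0 by have := ShZ (- t) 0 0; rewrite !scale0r.
    rewrite Sh0; move/esym/eqP; rewrite subr_eq0 => /eqP xE.
    move/sphere_dot: sx; rewrite xE dotZl dotC dotZl => h1.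
    have t2 : t * t <= 1 by nra.
    have : 0 <= dot a a by rewrite -normsq_dot normsq_ge0.
    by nra.
  have cH : cts cyl2 (fun z : R * V3 => Sh z.1 (z.2 - z.1 *: a)).
    by rewrite /Sh; ctst.
  move=> /(_ cH H0); apply: hom_ext => x sx /=.
    by rewrite /Sh mul0r !scale0r addr0 subr0 unit_id.
  by rewrite /k /S e1 !scale1r.
Qed.

End AxisHomeo.

(** * Homotopy classes of homeomorphisms of the sphere *)

Section HomeoDegree.
Context {R : realType}.
Local Notation V3 := ('rV[R]_3).

Lemma smap_comp (f g : V3 -> V3) : smap f -> smap g -> smap (fun x => f (g x)).
Proof.
move=> [cf sf] [cg sg]; split; first by apply: (cts_comp cf cg) => x /sg.
by move=> x /sg/sf.
Qed.

Lemma homeo2_comp (f f' g g' : V3 -> V3) : homeo2 f f' -> homeo2 g g' ->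
  homeo2 (fun x => f (g x)) (fun x => g' (f' x)).
Proof.
move=> [mf mf' ff' f'f] [mg mg' gg' g'g]; split; [exact: smap_comp|exact: smap_comp| |].
  by move=> x sx; rewrite ff' ?gg' //; exact: mg.2.
by move=> x sx; rewrite g'g ?f'f //; exact: mf'.2.
Qed.

Lemma homeo2_inj (f g : V3 -> V3) x y : homeo2 f g -> sphere 2 x -> sphere 2 y ->
  f x = f y -> x = y.
Proof. by move=> [_ _ fg _] sx sy e; rewrite -(fg _ sx) e fg. Qed.

Lemma homeo2_sym (f g : V3 -> V3) : homeo2 f g -> homeo2 g f.
Proof. by case. Qed.

Lemma southP : sphere 2 (- north : V3). Proof. exact: sphereN northP. Qed.

Lemma north_neq : (north : V3) <> - north.
Proof. by move/(congr1 pz); rewrite !coordE; lra. Qed.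

Lemma offpole_north (x : V3) : x = north \/ x = - north -> ~ offpole x.
Proof. by case=> ->; rewrite /offpole !coordE ?oppr0 eqxx => -[]. Qed.

Lemma not_offpole_coord (x : V3) : px x = 0 -> py x = 0 -> ~ offpole x.
Proof. by rewrite /offpole => -> ->; rewrite eqxx => -[]. Qed.

Lemma homeo2_offpole (f g : V3 -> V3) : homeo2 f g ->
  (f north = north /\ f (- north) = - north) \/ (f north = - north /\ f (- north) = north) ->
  forall x, sphere 2 x -> offpole x -> offpole (f x).
Proof.
move=> h fN x sx ox; case: (pselect (offpole (f x))) => // nf; exfalso.
have [mf _ _ _] := h.
have : x = north \/ x = - north; last by move/offpole_north.
have inj y : sphere 2 y -> f x = f y -> x = y by move=> sy; exact: homeo2_inj h sx sy.
have [e|e] := north_offpole (mf.2 _ sx) nf; case: fN => -[e1 e2].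
- by left; apply: inj; rewrite ?e1 //; exact: northP.
- by right; apply: inj; rewrite ?e2 //; exact: southP.
- by right; apply: inj; rewrite ?e2 //; exact: southP.
- by left; apply: inj; rewrite ?e1 //; exact: northP.
Qed.

Lemma sphere_param (x : V3) : sphere 2 x ->
  exists2 th, circ th & x = circle_at (pz x) th.
Proof.
move=> sx; case: (pselect (offpole x)) => [ox|no].
  have [th hth pth] := polar_exists_ge0 ox; exists th; first exact/circP.
  have z1 := offpole_pz sx ox.
  have [||e1 e2] := @polar_norm R _ _ _ (Num.sqrt (1 - pz x ^+ 2)) _ _ pth.
  - by rewrite sqrtr_gt0 subr_gt0.
  - rewrite sqr_sqrtr ?subr_ge0 ?ltW //; move/sphereP: sx; lra.
  by rewrite /circle_at -e1 -e2 vec_eta.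
exists 0; first exact: circ0.
by case: (north_offpole sx no) => ->; rewrite /circle_at; apply: eq3;
  rewrite !coordE ?sqrrN ?expr1n ?subrr ?sqrtr0 ?mul0r ?oppr0.
Qed.

(** Continuous families on the sphere may be given in cylindrical coordinates. *)
Lemma cylindrical (E : R -> R -> R -> V3) :
  cts ((`[0, 1]%classic : set R) `*` ((circ : set R) `*` (`[-1, 1]%classic : set R)))
    (fun q : R * (R * R) => E q.1 q.2.1 q.2.2) ->
  (forall t y, E t (2 * pi) y = E t 0 y) ->
  (forall t th th' y, y ^+ 2 = 1 -> E t th y = E t th' y) ->
  exists2 H : R * V3 -> V3, cts cyl2 H &
    forall t th y, circ th -> -1 <= y <= 1 -> H (t, circle_at y th) = E t th y.
Proof.
move=> cE per pole.
pose ang (x : V3) : R := get [set th | circ th /\ x = circle_at (pz x) th].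
pose H (p : R * V3) := E p.1 (ang p.2) (pz p.2).
have angP x : sphere 2 x -> circ (ang x) /\ x = circle_at (pz x) (ang x).
  by move=> /sphere_param[th h1 h2]; rewrite /ang; apply: (getI (P := [set th | circ th /\ x = circle_at (pz x) th]) (x := th)).
have HE t th y : circ th -> -1 <= y <= 1 -> H (t, circle_at y th) = E t th y.
  move=> hth hy; rewrite /H /=.
  have zE : pz (circle_at y th) = y by rewrite !coordE.
  have y2 : y ^+ 2 <= 1.
    by rewrite -(real_normK (num_real y)) expr_le1 // ler_norml.
  have [h1 h2] := angP _ (circle_at_sphere th y2); rewrite zE in h2 *.
  move: h1 h2; set th' := ang _ => h1 h2.
  case: (eqVneq (y ^+ 2) 1) => [|y1]; first exact: pole.
  have s0 : 0 < Num.sqrt (1 - y ^+ 2).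
    by rewrite sqrtr_gt0 subr_gt0 lt_neqAle y1.
  have p1 : polar (px (circle_at y th)) (py (circle_at y th)) th.
    by rewrite !coordE; exists (Num.sqrt (1 - y ^+ 2)).
  have p2 : polar (px (circle_at y th)) (py (circle_at y th)) th'.
    by rewrite h2 !coordE; exists (Num.sqrt (1 - y ^+ 2)).
  have [k kE] := polar_uniq p2 p1.
  move/circP: h1 => /andP[a1 a2]; move/circP: hth => /andP[b1 b2].
  have t0 := twopi_gt0 (R := R).
  have k1 : (k%:~R : R) <= 1.
    by rewrite -(ler_pM2l t0) mulr1; lra.
  have k2 : (-1 : R) <= k%:~R.
    by rewrite -(ler_pM2l t0) mulrN1; lra.
  have {k1} k1 : (k <= 1)%R by rewrite -(ler_int R).
  have {k2} k2 : (-1 <= k)%R by rewrite -(ler_int R) mulrNz.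
  have : k = 0 \/ k = 1 \/ k = -1 by lia.
  move=> [k0|[k0|k0]]; move: kE; rewrite k0.
  - by rewrite mulr0 addr0 => ->.
  - rewrite mulr1 => e; have -> : th' = 2 * pi by lra.
    by have -> : th = 0 by lra.
  - rewrite mulrNz mulrN mulr1 => e; have -> : th' = 0 by lra.
    by have -> : th = 2 * pi by lra.
exists H => //.
set K := _ `*` _ in cE.
have cK : compact K.
  apply: compact_setX; first exact: segment_compact.
  by apply: compact_setX; exact: segment_compact.
pose q (z : R * (R * R)) := (z.1, circle_at z.2.2 z.2.1).
have KP z : K z -> 0 <= z.1 <= 1 /\ circ z.2.1 /\ -1 <= z.2.2 <= 1.
  by case=> /itv01P h1 [h2]; rewrite /= in_itv.
have cq : cts K q by rewrite /q /circle_at; ctst.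
have qK : q @` K = cyl2.
  apply/seteqP; split => [_ [z /KP[h1 [h2 h3]] <-]|[t x] /cyl2P[/= h1 h2]].
    apply/cyl2P; split => //=; apply: circle_at_sphere.
    by rewrite -(real_normK (num_real _)) expr_le1 // ler_norml.
  have [th h3 h4] := sphere_param h2; exists (t, (th, pz x)); last by rewrite /q /= -h4.
  by split => /=; [rewrite in_itv|split => //=; rewrite in_itv /=; exact: sphere_pz_le1].
have hY : hausdorff_space (R * V3)%type by exact: norm_hausdorff.
rewrite -qK; apply: (cts_quotient hY cK cq).
by apply: cts_ext cE => z /KP[h1 [h2 h3]]; rewrite HE.
Qed.

Lemma homotopic_rotation : homotopic id (fun x : V3 => vec (- px x) (py x) (- pz x)).
Proof.
exists (fun p => vec (cos (pi * p.1) * px p.2 + sin (pi * p.1) * pz p.2) (py p.2)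
  (cos (pi * p.1) * pz p.2 - sin (pi * p.1) * px p.2)); split.
- by ctst.
- move=> t x _ /sphereP sx; apply/sphereP; rewrite !coordE /=.
  have := cos2Dsin2 (pi * t); set c := cos _; set s := sin _ => cs.
  have -> : (c * px x + s * pz x) ^+ 2 + py x ^+ 2 + (c * pz x - s * px x) ^+ 2 =
     (c ^+ 2 + s ^+ 2) * (px x ^+ 2 + pz x ^+ 2) + py x ^+ 2 by ring.
  by rewrite cs; lra.
- move=> x _ /=; rewrite mulr0 cos0 sin0 !mul0r !mul1r addr0 subr0; exact: vec_eta.
- by move=> x _ /=; rewrite mulr1 cospi sinpi !mul0r !mulN1r addr0 subr0.
Qed.

(** By multiplicativity, the winding numbers on the equator of f and of its
   inverse have product 1, hence are 1 or -1.  This number determines the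
   homotopy class: as the poles are fixed, the direction of the horizontal part
   of f is all that matters, and it can be taken from the equator. *)
Lemma homotopic_fix_poles (f g : V3 -> V3) : homeo2 f g ->
  f north = north -> f (- north) = - north ->
  homotopic f id \/ homotopic f (fun x => vec (px x) (- py x) (pz x)).
Proof.
move=> h fN fS; have [mf mg gf fg] := h; have [cf sf] := mf.
have foff := homeo2_offpole h (or_introl (conj fN fS)).
have gN : g north = north by rewrite -fN gf ?fN //; exact: northP.
have gS : g (- north) = - north by rewrite -fS gf ?fS //; exact: southP.
have goff := homeo2_offpole (homeo2_sym h) (or_introl (conj gN gS)).
have eoff (t : R) : offpole (equator t) by rewrite /offpole !coordE; exact: cossin_neq0.
have ce : cts circ (equator : R -> V3) by rewrite /equator; ctst.
have eper : equator (2 * pi) = equator 0 :> V3 by rewrite -[2 * pi]add0r equator_per.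
have wex (u : V3 -> V3) : smap u -> (forall x, sphere 2 x -> offpole x -> offpole (u x)) ->
    exists k, turn (fun t => u (equator t)) k.
  move=> [cu su] uoff.
  have cue : cts circ (fun t => u (equator t)).
    by apply: (cts_comp cu ce) => t _; exact: equatorP.
  apply: wind_exists; rewrite ?eper //; [exact: cts_px|exact: cts_py|].
  by move=> t _; apply: uoff; [exact: equatorP|exact: eoff].
have [n wn] := wex f mf foff; have [m wm] := wex g mg goff.
have nm : n * m = 1.
  have cfe : cts circ (fun t => f (equator t)).
    by apply: (cts_comp cf ce) => t _; exact: equatorP.
  have := wind_mult mg goff wm cfe _ _ wn.
  move=> /(_ ltac:(by move=> t _; split; [apply: sf|apply: foff]; rewrite ?equatorP //; exact: equatorP)).
  move=> /(_ ltac:(by rewrite eper)) w.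
  apply: wind_uniq w _; apply: wind_ext (wind_circle 1) => t _.
  by rewrite gf ?mulr1 ?coordE //; exact: equatorP.
have n1 : n = 1 \/ n = -1.
  have : (`|n| * `|m| = 1)%N by rewrite -abszM nm.
  by move/eqP; rewrite muln_eq1 => /andP[/eqP h1 _]; lia.
pose s : R := n%:~R.
have t1 (A : set (R * V3)) : cts A (fun p => p.1) by ctst.
have t2 (A : set (R * V3)) : cts A (fun p => p.2) by ctst.
have cf2 : cts cyl2 (fun p : R * V3 => f p.2).
  by apply: (cts_comp cf (t2 _)) => p /cyl2P[].
have vec0 (a b c : R) : vec a b c = 0 -> [/\ a = 0, b = 0 & c = 0].
  move=> e; have := (congr1 px e, congr1 py e, congr1 pz e).
  by rewrite !coordE => -[[-> ->] ->].
have z0P (x : V3) : sphere 2 x -> pz x = 0 -> offpole x.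
  move=> sx e; case: (pselect (offpole x)) => // /(north_offpole sx)[] h'; move: e;
    rewrite h' !coordE => /eqP; rewrite ?oppr_eq0 oner_eq0 //.
(* the height of f x is replaced by the height of x, and the horizontal part
   vanishes at the poles *)
pose F2 x := vec (px (f x) * (1 - pz x ^+ 2)) (py (f x) * (1 - pz x ^+ 2)) (pz x).
have h2 : homotopic f (fun x => unit_vec (F2 x)).
  have := @hom_unit R (fun p => vec (px (f p.2) * (1 - p.1 * pz p.2 ^+ 2))
    (py (f p.2) * (1 - p.1 * pz p.2 ^+ 2)) ((1 - p.1) * pz (f p.2) + p.1 * pz p.2)).
  move=> /(_ ltac:(ctst)) H.
  apply: hom_ext (H _) => /=.
  - by move=> x sx; rewrite !mul0r !subr0 !mulr1 mul1r addr0 vec_eta unit_id //; exact: sf.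
  - by move=> x sx; rewrite subrr mul0r add0r !mul1r.
  - move=> [t x] /cyl2P[/= /andP[t0 t1'] sx]; apply/eqP => /vec0[+ + e3].
    case: (pselect (offpole x)) => [ox|no].
      have q0 : 1 - t * pz x ^+ 2 != 0.
        by have := offpole_pz sx ox; have := sqr_ge0 (pz x) => *; rewrite gt_eqF //; nra.
      move=> /eqP + /eqP; rewrite !mulf_eq0 (negbTE q0) !orbF => /eqP e1 /eqP e2.
      exact: not_offpole_coord e1 e2 (foff _ sx ox).
    by move: e3; case: (north_offpole sx no) => ->; rewrite ?fN ?fS !coordE; lra.
set box := (`[0, 1]%classic : set R) `*` ((circ : set R) `*` (`[-1, 1]%classic : set R)).
have boxP z : box z -> 0 <= z.1 <= 1 /\ circ z.2.1 /\ -1 <= z.2.2 <= 1.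
  by case=> /itv01P b1 [b2]; rewrite /= in_itv.
have sq1 (y : R) : -1 <= y <= 1 -> y ^+ 2 <= 1.
  by move=> hy; rewrite -(real_normK (num_real y)) expr_le1 // ler_norml.
(* the horizontal part is taken on the equator instead of the parallel of x *)
pose E3 t th y := vec (px (f (circle_at ((1 - t) * y) th)) * (1 - y ^+ 2))
  (py (f (circle_at ((1 - t) * y) th)) * (1 - y ^+ 2)) y.
have sc (t y th : R) : 0 <= t <= 1 -> -1 <= y <= 1 -> sphere 2 (circle_at ((1 - t) * y) th).
  move=> /andP[a1 a2] hy; apply: circle_at_sphere; rewrite exprMn mulr_ile1 ?sqr_ge0 ?sq1 //.
  by lra.
have [||| H3 cH3 H3E] := @cylindrical E3.
- have cc : cts box (fun q : R * (R * R) => circle_at ((1 - q.1) * q.2.2) q.2.1).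
    by rewrite /circle_at; ctst.
  have cfc : cts box (fun q : R * (R * R) => f (circle_at ((1 - q.1) * q.2.2) q.2.1)).
    by apply: (cts_comp cf cc) => z /boxP[b1 [b2 b3]]; exact: sc.
  by rewrite /E3; ctst.
- by move=> t y; rewrite /E3 circle_at_per.
- by move=> t th th' y e; rewrite /E3 e subrr !mulr0.
pose F3 x := H3 (1, x).
have h3 : homotopic (fun x => unit_vec (F2 x)) (fun x => unit_vec (F3 x)).
  apply: hom_ext (hom_unit cH3 _) => //.
  - move=> x sx; have [th hth ->] := sphere_param sx.
    rewrite H3E ?sphere_pz_le1 // /E3 subr0 mul1r /F2; congr (unit_vec (vec (_ * (1 - _ ^+ 2)) (_ * (1 - _ ^+ 2)) _));
     by rewrite !coordE.
  - move=> [t x] /cyl2P[/= ht sx]; have [th hth ->] := sphere_param sx.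
    have hz := sphere_pz_le1 sx; rewrite H3E // /E3; apply/eqP => /vec0[/= + + e3].
    rewrite e3 expr0n /= mulr0 subr0 !mulr1 circle_at0 => e1 e2.
    by apply: (not_offpole_coord e1 e2); apply: foff => //; exact: equatorP.
(* the angle a is straightened to a multiple of the longitude *)
have [a [ca pa ea]] := wn.
pose r t := Num.sqrt (px (f (equator t)) ^+ 2 + py (f (equator t)) ^+ 2).
have r0 t : circ t -> 0 < r t by move=> /pa/polar_neq0; rewrite sqrtr_gt0.
pose A t th := (1 - t) * a th + t * (th * s).
pose E4 t th y := vec (((1 - t) * r th + t) * cos (A t th) * (1 - y ^+ 2))
  (((1 - t) * r th + t) * sin (A t th) * (1 - y ^+ 2)) y.
have [||| H4 cH4 H4E] := @cylindrical E4.
- have c21 : cts box (fun q : R * (R * R) => q.2.1) by ctst.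
  have cr : cts circ r.
    have cfe : cts circ (fun t => f (equator t)).
      by apply: (cts_comp cf ce) => t _; exact: equatorP.
    by rewrite /r; ctst.
  have cr2 : cts box (fun q : R * (R * R) => r q.2.1).
    by apply: (cts_comp cr c21) => z /boxP[_ []].
  have ca2 : cts box (fun q : R * (R * R) => a q.2.1).
    by apply: (cts_comp ca c21) => z /boxP[_ []].
  by rewrite /E4 /A; ctst.
- move=> t y; rewrite /E4.
  have -> : A t (2 * pi) = A t 0 + 2 * pi * n%:~R by rewrite /A ea; ring.
  by rewrite cos_periodz sin_periodz /r eper.
- by move=> t th th' y e; rewrite /E4 e subrr !mulr0.
pose F4 x := H4 (1, x).
have h4 : homotopic (fun x => unit_vec (F3 x)) (fun x => unit_vec (F4 x)).
  apply: hom_ext (hom_unit cH4 _) => //.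
  - move=> x sx; have [th hth ->] := sphere_param sx.
    have hz := sphere_pz_le1 sx.
    rewrite /F3 H3E // H4E // /E3 /E4 /A subrr !mul0r subr0 !mul1r !addr0 circle_at0.
    have [|e1 e2] := polar_norm (r0 _ hth) _ (pa _ hth); last by rewrite -e1 -e2.
    by rewrite /r sqr_sqrtr // addr_ge0 ?sqr_ge0.
  - move=> [t x] /cyl2P[/= /andP[ht0 ht1] sx]; have [th hth ->] := sphere_param sx.
    have hz := sphere_pz_le1 sx; rewrite H4E // /E4; apply/eqP => /vec0[/= + + e3].
    rewrite e3 expr0n /= subr0 !mulr1.
    have rp : 0 < (1 - t) * r th + t.
      rewrite -[X in _ + X]mulr1; apply: convex_gt0; rewrite ?ht0 ?ht1 ?ltr01 //.
      exact: r0.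
    move=> /eqP; rewrite mulf_eq0 gt_eqF //= => /eqP c0.
    move=> /eqP; rewrite mulf_eq0 gt_eqF //= => /eqP s0.
    by have [] := cossin_neq0 (A t th); rewrite ?c0 ?s0 eqxx.
have ss : s = 1 \/ s = -1.
  by rewrite /s; case: n1 => ->; [left|right]; rewrite ?mulrNz.
have s2 : s * s = 1 by case: ss => ->; rewrite ?mulrNN mulr1.
(* the radius 1 - y^2 is replaced by that of the parallel *)
have h5 : homotopic (fun x => unit_vec (F4 x)) (fun x => unit_vec (vec (px x) (s * py x) (pz x))).
  have := @hom_unit R (fun p => vec (((1 - p.1) * Num.sqrt (1 - pz p.2 ^+ 2) + p.1) * px p.2)
    (((1 - p.1) * Num.sqrt (1 - pz p.2 ^+ 2) + p.1) * (s * py p.2)) (pz p.2)).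
  move=> /(_ ltac:(ctst)) H.
  apply: hom_ext (H _) => /=.
  - move=> x sx; have [th hth ->] := sphere_param sx.
    have hz := sphere_pz_le1 sx.
    rewrite /F4 H4E // /E4 /A subrr !mul0r subr0 !mul1r !add0r !addr0 !mul1r.
    rewrite !coordE; set q := Num.sqrt _.
    have qq : 1 - pz x ^+ 2 = q * q.
      by rewrite -expr2 sqr_sqrtr // subr_ge0 sq1.
    rewrite qq; congr (unit_vec (vec _ _ _)).
      case: ss => ->; rewrite ?mulr1 ?mulrN1 ?cosN; ring.
    case: ss => ->; rewrite ?mulr1 ?mulrN1 ?sinN; ring.
  - by move=> x sx; rewrite subrr mul0r add0r !mul1r.
  - move=> [t x] /cyl2P[/= ht sx]; apply/eqP => /vec0[/= + + e3].
    rewrite e3 expr0n /= subr0 sqrtr1 mulr1 subrK !mul1r => e1 e2.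
    apply: (not_offpole_coord e1 _ (z0P _ sx e3)).
    by rewrite -[LHS]mul1r -s2 -mulrA e2 mulr0.
have hh := hom_trans h2 (hom_trans h3 (hom_trans h4 h5)).
case: ss => e; [left|right]; apply: hom_ext hh => // x sx.
  by rewrite e mul1r vec_eta unit_id.
rewrite e mulN1r unit_id //; move/sphereP: sx => sx; apply/sphereP.
by rewrite !coordE sqrrN.
Qed.

(** The images of the poles are moved back to the poles. *)
Lemma homotopic_up (f g : V3 -> V3) : homeo2 f g ->
  0 <= pz (f north - f (- north)) ->
  homotopic id f \/ homotopic id (fun x => - f x).
Proof.
move=> h hz; have [mf mg gf fg] := h.
have n1 : sphere 2 (f north) by apply: mf.2; exact: northP.
have n2 : sphere 2 (f (- north)) by apply: mf.2; exact: southP.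
have n3 : f north <> f (- north).
  by move/(homeo2_inj h northP southP); exact: north_neq.
have [k [k' [f1 [f2 [hk [kN kS] _ _ [_ [_ /(_ hz) kh]]]]]]] := axis_homeo n1 n2 n3.
have fk : homotopic f (fun x => k (f x)) by exact: hom_pre mf kh.
have [e|e] := homotopic_fix_poles (homeo2_comp hk h) kN kS.
  by left; apply: hom_sym; apply: hom_trans fk e.
right; apply: hom_trans homotopic_rotation _; apply: hom_sym.
apply: hom_ext (hom_opp (hom_trans fk e)) => // x _.
by apply: eq3; rewrite !coordE ?opprK.
Qed.

(** Both f and - f may be used, so that the image of the north pole can be assumed
   above that of the south pole. *)
Theorem homeo_homotopic (f g : V3 -> V3) : homeo2 f g ->
  homotopic id f \/ homotopic id (fun x => - f x).
Proof.
move=> h; case: (leP 0 (pz (f north - f (- north)))) => [|hz]; first exact: homotopic_up h.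
have hN : homeo2 (fun x : V3 => - x) (fun x => - x).
  by split; [exact: smapN|exact: smapN| |] => x _; rewrite opprK.
have [|e|e] := homotopic_up (homeo2_comp hN h).
- by rewrite -opprD pzN oppr_ge0 ltW.
- by right.
- by left; apply: hom_ext e => // x _; rewrite opprK.
Qed.

End HomeoDegree.

(** * Small loops around the centre of a chart *)

Section Charts.
Context {R : realType}.
Local Notation V3 := ('rV[R]_3).

Lemma det3E (u v w : V3) :
  \det (\matrix_(i < 3) nth 0 [:: u; v; w] i) = det3 u v w.
Proof.
rewrite (expand_det_row _ ord0) !big_ord_recl big_ord0 /cofactor.
rewrite !(expand_det_row _ ord0) !big_ord_recl !big_ord0 /cofactor !det_mx11.
rewrite !mxE /=.
rewrite /det3 /px /py /pz.
have E (x : V3) (j : 'I_1) (i : 'I_3) : x j i = [:: px x; py x; pz x]`_i.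
  by rewrite (ord1 j); case: i => -[|[|[|//]]] h /=; congr (fun_of_matrix _ _ _); exact: val_inj.
rewrite !E /= /bump /= /px /py /pz. ring.
Qed.

(** The angle from the half-plane through e to the half-plane through x around
   the chord p q, in a form that needs no frame orthogonal to the chord. *)
Definition axis1 (p q e x : V3) : R :=
  let a := 2^-1 *: (p + q) in
  dot (p - q) (p - q) * dot (x - a) (e - a) - dot (x - a) (p - q) * dot (e - a) (p - q).
Definition axis2 (p q e x : V3) : R :=
  let a := 2^-1 *: (p + q) in det3 (p - q) (e - a) (x - a).

Lemma axis1C p q e x : axis1 q p e x = axis1 p q e x.
Proof. by rewrite /axis1 (addrC q p) /dot !coordE; ring. Qed.

Lemma axis2C p q e x : axis2 q p e x = - axis2 p q e x.
Proof. by rewrite /axis2 (addrC q p) /det3 !coordE; ring. Qed.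

(** The hypothesis is the equality case of the Cauchy-Schwarz inequality: x lies
   on the line through p and q. *)
Lemma chord_meets (p q x : V3) : sphere 2 p -> sphere 2 q -> sphere 2 x -> p <> q ->
  let a := 2^-1 *: (p + q) in
  dot (p - q) (p - q) * dot (x - a) (x - a) = dot (x - a) (p - q) ^+ 2 ->
  x = p \/ x = q.
Proof.
move=> sp sq sx pq a; set d := p - q; set y := x - a => H.
have d0 : d != 0 by rewrite subr_eq0; apply/eqP.
have n0 : 0 < dot d d by rewrite -normsq_dot normsq_gt0.
pose s := dot y d / dot d d.
have yE : y = s *: d.
  apply/eqP; rewrite -subr_eq0; apply: contraT => /normsq_gt0.
  rewrite normsq_dot.
  have -> : dot (y - s *: d) (y - s *: d) = dot y y - 2 * s * dot y d + s ^+ 2 * dot d d.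
    by rewrite /dot !coordE; ring.
  have -> : dot y d = s * dot d d by rewrite /s divfK // gt_eqF.
  have -> : dot y y = s ^+ 2 * dot d d.
    apply: (mulfI (lt0r_neq0 n0)); rewrite H /s -[in LHS](divfK (lt0r_neq0 n0) (dot y d)).
    by rewrite exprMn !expr2; ring.
  by rewrite (_ : _ - _ + _ = 0) ?ltxx //; ring.
have xE : x = a + s *: d by rewrite -yE /y addrC subrK.
have ad : dot a d = 0.
  by move/sphere_dot: sp; move/sphere_dot: sq; rewrite /a /d /dot !coordE; lra.
have aa : dot a a = 1 - dot d d / 4.
  by move/sphere_dot: sp; move/sphere_dot: sq; rewrite /a /d /dot !coordE; lra.
have : dot x x = dot a a + s ^+ 2 * dot d d + 2 * s * dot a d.
  by rewrite xE /dot !coordE; ring.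
have -> : dot x x = 1 by exact/sphere_dot.
rewrite ad aa => h.
have s2 : (2 * s) ^+ 2 = 1.
  by apply: (mulIf (lt0r_neq0 n0)); rewrite exprMn; lra.
move: s2 => /eqP; rewrite sqrf_eq1 => /orP[] /eqP s2; [left|right]; rewrite xE.
  have -> : s = 2^-1 by lra.
  by apply: eq3; rewrite /a /d !coordE; lra.
have -> : s = - 2^-1 by lra.
by apply: eq3; rewrite /a /d !coordE; lra.
Qed.

Lemma axis_neq0 (p q e x : V3) : sphere 2 p -> sphere 2 q -> sphere 2 e -> sphere 2 x ->
  p <> q -> e <> p -> e <> q -> x <> p -> x <> q ->
  axis1 p q e x != 0 \/ axis2 p q e x != 0.
Proof.
move=> sp sq se sx pq ep eq' xp xq.
apply: or_neq0; rewrite /axis1 /axis2 /=.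
set d := p - q; set X := x - _; set E := e - _ => z1 z2.
have : (dot d d * dot X X - dot X d ^+ 2) * (dot d d * dot E E - dot E d ^+ 2) =
   (dot d d * dot X E - dot X d * dot E d) ^+ 2 + dot d d * det3 d E X ^+ 2.
  by rewrite /dot /det3; ring.
rewrite z1 z2 !expr0n /= mulr0 addr0 => /eqP; rewrite mulf_eq0 !subr_eq0.
by move=> /orP[] /eqP h; [case: (chord_meets sp sq sx pq h)|case: (chord_meets sp sq se pq h)].
Qed.

Lemma det3_cramer (u v w x : V3) :
  det3 u v w *: x = det3 x v w *: u + det3 u x w *: v + det3 u v x *: w.
Proof. by apply: eq3; rewrite !coordE /det3; ring. Qed.

Lemma det3_gram (f g h u v w : V3) : det3 f g h * det3 u v w =
  dot f u * (dot g v * dot h w - dot g w * dot h v)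
  - dot f v * (dot g u * dot h w - dot g w * dot h u)
  + dot f w * (dot g u * dot h v - dot g v * dot h u).
Proof. by rewrite /det3 /dot; ring. Qed.

Definition pt (r t : R) : R * R := (r * cos t, r * sin t).

Definition nsq (z : R * R) : R := z.1 ^+ 2 + z.2 ^+ 2.

Lemma disc_square (z : R * R) : nsq z <= 1 -> square z.
Proof.
rewrite /nsq => h; have := sqr_ge0 z.1; have := sqr_ge0 z.2 => h1 h2.
by split; rewrite -(@expr_le1 _ 2) // real_normK ?num_real //; lra.
Qed.

Lemma nsq_pt r t : nsq (pt r t) = r ^+ 2.
Proof. by rewrite /nsq /pt /= !exprMn -mulrDr cos2Dsin2 mulr1. Qed.

Lemma pt_square r t : 0 <= r <= 1 -> square (pt r t).
Proof.
by move=> /andP[h1 h2]; apply: disc_square; rewrite nsq_pt expr_le1.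
Qed.

Lemma pt_per r : pt r (2 * pi) = pt r 0.
Proof. by rewrite /pt -[2 * pi]add0r cos_2pi sin_2pi. Qed.

Lemma cts_pt (X : topologicalType) (A : set X) (r t : X -> R) :
  cts A r -> cts A t -> cts A (fun x => pt (r x) (t x)).
Proof. by move=> cr ct; rewrite /pt; ctst. Qed.

Lemma square_inj (chi : R * R -> V3) z z' : {in @square R &, injective chi} ->
  square z -> square z' -> chi z = chi z' -> z = z'.
Proof. by move=> inj sz sz'; apply: inj; rewrite inE. Qed.

Lemma nsq0 : nsq (0, 0) = 0.
Proof. by rewrite /nsq expr0n addr0. Qed.

Lemma square0 : square (0, 0 : R).
Proof. by apply: disc_square; rewrite nsq0 ler01. Qed.

Lemma compact_square : compact (@square R).
Proof.
have -> : @square R = (`[-1, 1]%classic : set R) `*` (`[-1, 1]%classic : set R).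
  by apply/seteqP; split => z; rewrite /square /= !in_itv /= !ler_norml.
by apply: compact_setX; exact: segment_compact.
Qed.

Lemma nsq_ge0 z : 0 <= nsq z. Proof. by rewrite addr_ge0 ?sqr_ge0. Qed.

Lemma nsq_eq0 z : nsq z = 0 -> z = (0, 0).
Proof.
case: z => x y /eqP; rewrite /nsq /= paddr_eq0 ?sqr_ge0 // !sqrf_eq0.
by move=> /andP[/eqP -> /eqP ->].
Qed.

Lemma polar_pt z : z <> (0, 0) -> exists2 r, 0 < r & exists2 t, circ t & z = pt r t /\ nsq z = r ^+ 2.
Proof.
move=> z0; have n0 : 0 < nsq z.
  by rewrite lt_neqAle nsq_ge0 andbT eq_sym; apply/eqP => /nsq_eq0.
have [a ha pa] : exists2 a, 0 <= a <= 2 * pi & polar z.1 z.2 a.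
  apply: polar_exists_ge0; apply: or_neq0 => e1 e2; case: z0.
  by move: e1 e2; case: (z) => ? ? /= -> ->.
exists (Num.sqrt (nsq z)); first by rewrite sqrtr_gt0.
exists a; first exact/circP.
have [||e1 e2] := @polar_norm R _ _ _ (Num.sqrt (nsq z)) _ _ pa.
- by rewrite sqrtr_gt0.
- by rewrite sqr_sqrtr // ltW.
split; last by rewrite sqr_sqrtr // ltW.
by rewrite /pt -e1 -e2; case: (z).
Qed.

Section OneChart.
Variables (chi : R * R -> V3) (w : V3).
Hypothesis cchi : cts (@square R) chi.
Hypothesis ichi : {in @square R &, injective chi}.
Hypothesis schi : forall z, square z -> sphere 2 (chi z).
Hypothesis chi0 : chi (0, 0) = w.
Variables (u v : V3).
Hypothesis Dpos : 0 < det3 u v w.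

(* the coordinates along u and v, up to the factor det3 u v w *)
Let X x := det3 x v w.
Let Y x := det3 u x w.

Lemma chart_center : sphere 2 w.
Proof.
by rewrite -chi0; apply: schi; exact: square0.
Qed.

Lemma frame_pole x : sphere 2 x -> X x = 0 -> Y x = 0 -> x = w \/ x = - w.
Proof.
move=> sx x0 y0; have := det3_cramer u v w x.
rewrite -/(X x) -/(Y x) x0 y0 !scale0r !add0r => h.
have xE : x = (det3 u v x / det3 u v w) *: w.
  by rewrite mulrC -scalerA -h scalerA mulVf ?scale1r // gt_eqF.
move: xE; set c := _ / _ => xE.
have : c ^+ 2 = 1.
  have := chart_center; move: sx; rewrite /sphere /= xE normsqZ => h1 h2.
  by rewrite -h1 h2 mulr1.
move=> /eqP; rewrite sqrf_eq1 => /orP[] /eqP c1; [left|right]; rewrite xE c1.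
  by rewrite scale1r.
by rewrite scaleN1r.
Qed.

Hypothesis wind1 : wind (fun t => X (chi (pt 1 t))) (fun t => Y (chi (pt 1 t))) 1.

Lemma cts_chi_circle r : 0 <= r <= 1 -> cts (circ : set R) (fun t => chi (pt r t)).
Proof.
move=> hr; apply: (cts_comp cchi) => [|t _]; last exact: pt_square.
by apply: cts_pt; [exact: cts_cst|exact: cts_id].
Qed.

Lemma i01 : 0 <= (1 : R) <= 1. Proof. by rewrite ler01 lexx. Qed.

Lemma cts_det3 (Z : topologicalType) (A : set Z) (a b c : Z -> V3) :
  cts A a -> cts A b -> cts A c -> cts A (fun z => det3 (a z) (b z) (c z)).
Proof. by move=> ca cb cc; rewrite /det3; ctst. Qed.

(** The disc bounded by the loop chi (cos t, sin t) does not contain the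
   antipode of its centre.  Otherwise the two points could be exchanged
   inside the disc, without meeting the loop; this reverses the axis joining
   them, hence the sign of the winding number around it. *)
Lemma antipode_outside z : nsq z <= 1 -> chi z <> - w.
Proof.
move=> hz ez; have sz := disc_square hz.
have sw := chart_center.
have w0 : w <> - w.
  by move=> e; have /eqP := sphere_neq0 sw; apply; apply: eq3; rewrite coordE;
    move: (congr1 px e) (congr1 py e) (congr1 pz e); rewrite !coordE; lra.
have z0 : z <> (0, 0) by move=> e; apply: w0; rewrite -{1}chi0 -e ez.
have hz1 : nsq z < 1.
  rewrite lt_neqAle hz andbT; apply/eqP => e1.
  have [r rp [t ht [zE nE]]] := polar_pt z0.
  have r1 : r = 1 by move: nE => /esym/eqP; rewrite e1 sqrp_eq1 ?(ltW rp) // => /eqP.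
  have := wind_neq0 wind1 ht; rewrite -r1 -zE ez /X /Y.
  have -> : det3 (- w) v w = 0 by rewrite /det3 !coordE; ring.
  have -> : det3 u (- w) w = 0 by rewrite /det3 !coordE; ring.
  by rewrite eqxx => -[].
(* the half-turn exchanging 0 and z *)
pose z1 (s : R) : R * R := (z.1 / 2 - (cos (pi * s) * z.1 - sin (pi * s) * z.2) / 2,
                            z.2 / 2 - (sin (pi * s) * z.1 + cos (pi * s) * z.2) / 2).
pose z2 (s : R) : R * R := (z.1 / 2 + (cos (pi * s) * z.1 - sin (pi * s) * z.2) / 2,
                            z.2 / 2 + (sin (pi * s) * z.1 + cos (pi * s) * z.2) / 2).
have cs s : cos (pi * s) ^+ 2 + sin (pi * s) ^+ 2 = 1 :> R by exact: cos2Dsin2.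
have cb' (s : R) : -1 <= cos (pi * s) <= 1 by rewrite cos_geN1 cos_le1.
have nz : 0 < nsq z.
  by rewrite lt_neqAle nsq_ge0 andbT eq_sym; apply/eqP => /nsq_eq0.
have d1 s : nsq (z1 s) < 1.
  have -> : nsq (z1 s) = nsq z * (1 - cos (pi * s)) / 2.
    rewrite /nsq /z1 /=; have := cs s; set c := cos _; set t := sin _ => e.
    have -> : (1 - c) = (1 + (c ^+ 2 + t ^+ 2)) / 2 - c by rewrite e; lra.
    by field.
  by move/andP: (cb' s) => [h1 h2]; nra.
have d2 s : nsq (z2 s) < 1.
  have -> : nsq (z2 s) = nsq z * (1 + cos (pi * s)) / 2.
    rewrite /nsq /z2 /=; have := cs s; set c := cos _; set t := sin _ => e.
    have -> : (1 + c) = (1 + (c ^+ 2 + t ^+ 2)) / 2 + c by rewrite e; lra.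
    by field.
  by move/andP: (cb' s) => [h1 h2]; nra.
have z12 s : z1 s <> z2 s.
  move=> e; have := cs s; move: (congr1 fst e) (congr1 snd e); rewrite /z1 /z2 /=.
  set c := cos _; set t := sin _ => e1 e2 e3.
  have f1 : c * z.1 - t * z.2 = 0 by lra.
  have f2 : t * z.1 + c * z.2 = 0 by lra.
  have : (c ^+ 2 + t ^+ 2) * nsq z = (c * z.1 - t * z.2) ^+ 2 + (t * z.1 + c * z.2) ^+ 2 by rewrite /nsq; ring.
  by rewrite f1 f2 e3 expr0n /= addr0 mul1r => h; rewrite h ltxx in nz.
have sq1 s : square (z1 s) by apply: disc_square; exact: ltW.
have sq2 s : square (z2 s) by apply: disc_square; exact: ltW.
have sqe : square (1, 1 : R) by split; rewrite /= normr1.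
have sqc t : square (pt 1 t) by apply: pt_square i01.
pose e := chi (1, 1).
have dist (a b : R * R) : square a -> square b -> nsq a != nsq b -> chi a <> chi b.
  by move=> sa sb /eqP n h; apply: n; rewrite (square_inj ichi sa sb h).
have c1 t : nsq (pt 1 t) = 1 by rewrite nsq_pt expr1n.
have Znz s t : axis1 (chi (z1 s)) (chi (z2 s)) e (chi (pt 1 t)) != 0 \/
               axis2 (chi (z1 s)) (chi (z2 s)) e (chi (pt 1 t)) != 0.
  apply: axis_neq0; try exact: schi.
  - by move/(square_inj ichi (sq1 s) (sq2 s)); exact: z12.
  - by apply: dist => //; rewrite gt_eqF //; apply: lt_trans (d1 s) _; rewrite /nsq /= expr1n; lra.
  - by apply: dist => //; rewrite gt_eqF //; apply: lt_trans (d2 s) _; rewrite /nsq /= expr1n; lra.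
  - by apply: dist => //; rewrite gt_eqF // c1.
  - by apply: dist => //; rewrite gt_eqF // c1.
have cp1 : cts cyl (fun p : R * R => p.1) by ctst.
have cp2 : cts cyl (fun p : R * R => p.2) by ctst.
have cz1 : cts cyl (fun p => chi (z1 p.1)).
  by apply: (cts_comp cchi) => [|p _]; last exact: sq1; rewrite /z1; ctst.
have cz2 : cts cyl (fun p => chi (z2 p.1)).
  by apply: (cts_comp cchi) => [|p _]; last exact: sq2; rewrite /z2; ctst.
have cpt : cts cyl (fun p => chi (pt 1 p.2)).
  by apply: (cts_comp cchi) => [|p _]; last exact: sqc; apply: cts_pt; ctst.
have [||||k kP] := @wind_homotopy R (fun s t => axis1 (chi (z1 s)) (chi (z2 s)) e (chi (pt 1 t)))
   (fun s t => axis2 (chi (z1 s)) (chi (z2 s)) e (chi (pt 1 t))).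
- by rewrite /axis1; ctst.
- by rewrite /axis2; apply: cts_det3; ctst.
- by move=> s t _ _; exact: Znz.
- by move=> s _; rewrite pt_per.
have e10 : z1 0 = (0, 0).
  by rewrite /z1 mulr0 cos0 sin0 !mul1r !mul0r subr0 add0r !subrr.
have e20 : z2 0 = z.
  by rewrite /z2 mulr0 cos0 sin0 !mul1r !mul0r subr0 add0r; case: (z) => ? ? /=; congr (_, _); lra.
have e11 : z1 1 = z.
  by rewrite /z1 mulr1 cospi sinpi !mulN1r !mul0r subr0 add0r; case: (z) => ? ? /=; congr (_, _); lra.
have e21 : z2 1 = (0, 0).
  by rewrite /z2 mulr1 cospi sinpi !mulN1r !mul0r subr0 add0r; case: (z) => ? ? /=; congr (_, _); lra.
have i0 : 0 <= (0 : R) <= 1 by rewrite lexx ler01.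
have W0 := kP 0 i0; have W1 := kP 1 i01.
rewrite e10 e20 chi0 ez in W0; rewrite e11 e21 chi0 ez in W1.
have kk : k = - k.
  apply: wind_uniq W1 _; apply: wind_ext (wind_conj W0) => t _.
  by split; [exact: axis1C|rewrite axis2C opprK].
have k0 : k = 0 by lia.
pose E := e - dot e w *: w.
have ww : dot w w = 1 by exact/sphere_dot.
have Ew : dot E w = 0 by rewrite /E dotBl dotZl ww mulr1 subrr.
have mid : 2^-1 *: (w + - w) = 0 :> V3 by rewrite subrr scaler0.
have dw : w - - w = 2 *: w by apply: eq3; rewrite !coordE; lra.
have a1E x : axis1 w (- w) e x = 4 * dot x E.
  rewrite /axis1 mid dw !subr0 /E.
  have -> : dot (2 *: w) (2 *: w) = 4 * dot w w by rewrite /dot !coordE; ring.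
  by rewrite ww /dot !coordE; ring.
have a2E x : axis2 w (- w) e x = 2 * det3 w E x.
  by rewrite /axis2 mid dw !subr0 /E /det3 !coordE; ring.
have EE : 0 < dot E E.
  rewrite -normsq_dot normsq_gt0 //; apply/eqP => E0.
  have hh : dot (w - - w) (w - - w) * dot (e - 0) (e - 0) = dot (e - 0) (w - - w) ^+ 2.
    have [k' eE] : exists k' : R, e = k' *: w.
      by exists (dot e w); apply/eqP; rewrite -subr_eq0; apply/eqP.
    by rewrite dw subr0 eE /dot !coordE; ring.
  have [h|h] : e = w \/ e = - w.
    by apply: (chord_meets sw (sphereN sw) (schi sqe) w0); rewrite mid.
  - move: h; rewrite -chi0; apply: dist; [exact: sqe|exact: square0|].
    by rewrite nsq0 /nsq /= expr1n gt_eqF //; lra.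
  - by move: h; rewrite -ez; apply: dist => //; rewrite gt_eqF //; apply: lt_trans hz1 _; rewrite /nsq /= expr1n; lra.
pose A := 4 * dot u E; pose B := 4 * dot v E.
pose C := 2 * det3 w E u; pose D := 2 * det3 w E v.
have detE : A * D - B * C = 8 * (det3 u v w * dot E E).
  have -> : A * D - B * C = 8 * (det3 u v w * dot E E - det3 u v E * dot E w).
    by rewrite /A /B /C /D /det3 /dot; ring.
  by rewrite Ew mulr0 subr0.
have det0 : 0 < A * D - B * C by rewrite detE !mulr_gt0.
have cX : cts circ (fun t => X (chi (pt 1 t))).
  by have cc := cts_chi_circle i01; apply: cts_det3; ctst.
have cY : cts circ (fun t => Y (chi (pt 1 t))).
  by have cc := cts_chi_circle i01; apply: cts_det3; ctst.
have := wind_linear (lt0r_neq0 det0) cX cY _ _ wind1.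
rewrite pt_per /sgn_wind det0 => /(_ erefl erefl) W.
have : wind (fun t => axis1 w (- w) e (chi (pt 1 t))) (fun t => axis2 w (- w) e (chi (pt 1 t))) 1.
  apply: (wind_cancel (c := fun=> det3 u v w)) => //.
  apply: wind_ext W => t _; rewrite a1E a2E; set x := chi _.
  split.
    rewrite mulrCA -dotZl det3_cramer !dotDl !dotZl (dotC w) Ew mulr0 addr0.
    by rewrite /A /B /X /Y; ring.
  rewrite mulrCA.
  have -> : det3 u v w * det3 w E x = det3 w E (det3 u v w *: x) by rewrite /det3 !coordE; ring.
  by rewrite det3_cramer /C /D /X /Y /det3 !coordE; ring.
by move/(wind_uniq W0); rewrite k0.
Qed.

(** The winding number around the axis through w and - w is defined for all the
   circles of the chart, because none of them meets this axis. *)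
Lemma small_frame_wind r : 0 < r <= 1 ->
  wind (fun t => X (chi (pt r t))) (fun t => Y (chi (pt r t))) 1.
Proof.
move=> /andP[r0 r1].
pose rs (s : R) := 1 - s * (1 - r).
have rsP s : 0 <= s <= 1 -> 0 < rs s <= 1 by move=> /andP[? ?]; rewrite /rs; nra.
have sq s t : 0 <= s <= 1 -> square (pt (rs s) t).
  by move=> /rsP/andP[h1 h2]; apply: pt_square; rewrite ltW.
have cc : cts cyl (fun p : R * R => chi (pt (rs p.1) p.2)).
  apply: (cts_comp cchi) => [|p /cylP[h _]]; last exact: sq.
  by apply: cts_pt; rewrite /rs; ctst.
have := @wind_transport R (fun s t => X (chi (pt (rs s) t))) (fun s t => Y (chi (pt (rs s) t))) 1.
have -> : rs 0 = 1 by rewrite /rs mul0r subr0.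
have -> : rs 1 = r by rewrite /rs mul1r opprB addrC subrK.
apply=> //.
- by apply: cts_det3; ctst.
- by apply: cts_det3; ctst.
- move=> s t hs ht; apply: or_neq0 => x0 y0; have /andP[h1 h2] := rsP _ hs.
  have [|] := frame_pole (schi (sq _ t hs)) x0 y0; last first.
    by apply: antipode_outside; rewrite nsq_pt expr_le1 // ltW.
  rewrite -chi0 => /(square_inj ichi (sq _ t hs)) e.
  have := nsq_pt (rs s) t; rewrite (e square0) nsq0 => /esym/eqP.
  by rewrite sqrf_eq0 gt_eqF.
- by move=> s _; rewrite pt_per.
Qed.

(** On small loops, chi - w is almost orthogonal to w, so that f1 and f2 may be
   replaced by their parts orthogonal to w; this gives a change of coordinates in
   the tangent plane, whose determinant has the sign of det3 f1 f2 w. *)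
Lemma chart_wind (f1 f2 : V3) : det3 f1 f2 w != 0 ->
  exists2 r0, 0 < r0 <= 1 & forall r, 0 < r <= r0 ->
    wind (fun t => dot f1 (chi (pt r t) - w)) (fun t => dot f2 (chi (pt r t) - w))
      (sgn_wind (det3 f1 f2 w) 1).
Proof.
move=> D0; set D := det3 f1 f2 w in D0 *; have sw := chart_center.
have ww : dot w w = 1 by exact/sphere_dot.
(* the cross product of f1 and f2 *)
pose n := vec (py f1 * pz f2 - pz f1 * py f2) (pz f1 * px f2 - px f1 * pz f2)
  (px f1 * py f2 - py f1 * px f2).
pose m z := dot (chi z - w) (chi z - w).
have D2 : 0 < D ^+ 2 by rewrite exprn_even_gt0.
have N0 : 0 <= dot n n by rewrite -normsq_dot normsq_ge0.
have [|||e e0 eP] := @compact_pos_near R _ (@square R)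
    (fun z => 4 * D ^+ 2 - m z * (D ^+ 2 + dot n n)) nsq compact_square.
- by rewrite /m; ctst.
- by rewrite /nsq; ctst.
- move=> z sz /nsq_eq0 ->.
  by rewrite /m chi0 subrr /dot !coordE !mul0r !addr0 mul0r subr0 mulr_gt0.
pose r0 := Num.min (e / 2) 1.
have r00 : 0 < r0 by rewrite lt_min divr_gt0 // ltr01.
have r01 : r0 <= 1 by rewrite ge_min lexx orbT.
have r0e : r0 < e by rewrite gt_min; apply/orP; left; lra.
exists r0; first by rewrite r00.
move=> r /andP[rp rr0].
have r1 : 0 < r <= 1 by rewrite rp (le_trans rr0).
have rc : 0 <= r <= 1 by case/andP: r1 => h1 h2; rewrite ltW.
have sq t : square (pt r t) by exact: pt_square.
have cc := cts_chi_circle rc.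
have mP t : m (pt r t) * (D ^+ 2 + dot n n) < 4 * D ^+ 2.
  rewrite -subr_gt0; apply: eP; rewrite // nsq_pt ger0_norm ?sqr_ge0 //.
  by rewrite expr2; case/andP: rc => *; nra.
have m0 t : 0 < m (pt r t).
  rewrite /m -normsq_dot normsq_gt0 // subr_eq0 -chi0; apply/eqP => h.
  have := nsq_pt r t; rewrite (square_inj ichi (sq t) square0 h) nsq0 => /esym/eqP.
  by rewrite sqrf_eq0 gt_eqF.
have wd t : dot w (chi (pt r t) - w) = - m (pt r t) / 2.
  have : dot (chi (pt r t)) (chi (pt r t)) = 1 by apply/sphere_dot; exact: schi.
  by move: ww; rewrite /m /dot !coordE; lra.
(* components along a frame of the plane orthogonal to w *)
pose al (f x : V3) := dot f x - dot w x * dot f w.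
have alE f t : al f u * X (chi (pt r t)) + al f v * Y (chi (pt r t)) =
    det3 u v w * (dot f (chi (pt r t) - w) - dot w (chi (pt r t) - w) * dot f w).
  set x := chi _; set d := x - w.
  have Xd : X x = X d by rewrite /X /d /det3 !coordE; ring.
  have Yd : Y x = Y d by rewrite /Y /d /det3 !coordE; ring.
  have c1 : det3 u v w * dot f d = X d * dot f u + Y d * dot f v + det3 u v d * dot f w.
    by rewrite (dotC f d) -dotZl det3_cramer !dotDl !dotZl !(dotC _ f).
  have c2 : det3 u v w * dot w d = X d * dot w u + Y d * dot w v + det3 u v d.
    by rewrite (dotC w d) -dotZl det3_cramer !dotDl !dotZl ww mulr1 !(dotC _ w).
  have -> : det3 u v w * (dot f d - dot w d * dot f w) =
     det3 u v w * dot f d - (det3 u v w * dot w d) * dot f w by ring.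
  by rewrite c1 c2 Xd Yd /al; ring.
have detE : al f1 u * al f2 v - al f1 v * al f2 u = D * det3 u v w.
  rewrite /D det3_gram ww /al !(dotC w); ring.
have det0 : al f1 u * al f2 v - al f1 v * al f2 u != 0.
  by rewrite detE mulf_neq0 // gt_eqF.
have cX : cts circ (fun t => X (chi (pt r t))) by apply: cts_det3; ctst.
have cY : cts circ (fun t => Y (chi (pt r t))) by apply: cts_det3; ctst.
have := wind_linear det0 cX cY _ _ (small_frame_wind r1).
rewrite pt_per detE => /(_ erefl erefl) W.
have -> : sgn_wind D 1 = sgn_wind (D * det3 u v w) 1 by rewrite /sgn_wind pmulr_lgt0.
apply: (wind_cancel (c := fun=> det3 u v w)) => //.
apply: wind_segment W; rewrite ?pt_per //; try by [ctst].
move=> s t /andP[s0 s1] ht; rewrite !alE.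
set d := chi (pt r t) - w.
pose eta := d - (1 - s) *: (dot w d *: w).
have hf f : (1 - s) * (det3 u v w * (dot f d - dot w d * dot f w)) + s * (det3 u v w * dot f d) =
    det3 u v w * dot f eta.
  by rewrite /eta /dot !coordE; ring.
rewrite !hf !mulf_eq0 !negb_or gt_eqF //=.
apply: or_neq0 => h1 h2.
have ed : dot eta eta = m (pt r t) - (1 - s ^+ 2) * dot w d ^+ 2.
  have -> : m (pt r t) = dot d d by [].
  have -> : dot eta eta = dot d d - 2 * (1 - s) * dot w d ^+ 2 + (1 - s) ^+ 2 * dot w d ^+ 2 * dot w w.
    by rewrite /eta /dot !coordE; ring.
  by rewrite ww; ring.
have ew : dot eta w = s * dot w d.
  have -> : dot eta w = dot w d - (1 - s) * dot w d * dot w w by rewrite /eta /dot !coordE; ring.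
  by rewrite ww; ring.
have en : D *: eta = dot eta w *: n.
  have -> : D *: eta = dot f1 eta *: vec (py f2 * pz w - pz f2 * py w) (pz f2 * px w - px f2 * pz w) (px f2 * py w - py f2 * px w)
    + dot f2 eta *: vec (py w * pz f1 - pz w * py f1) (pz w * px f1 - px w * pz f1) (px w * py f1 - py w * px f1)
    + dot eta w *: n.
    by apply: eq3; rewrite /D /n /det3 /dot !coordE; ring.
  by rewrite h1 h2 !scale0r !add0r.
have en2 : D ^+ 2 * dot eta eta = dot eta w ^+ 2 * dot n n.
  by rewrite -!normsq_dot -!normsqZ en.
move: en2; rewrite ed ew (wd t); have := mP t; have := m0 t.
set mm := m (pt r t) => p0 p1 en2.
have p2 : mm * (4 * D ^+ 2) = mm * (mm * ((1 - s ^+ 2) * D ^+ 2 + s ^+ 2 * dot n n)).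
  by move: en2; rewrite !exprMn; lra.
have p3 := mulfI (lt0r_neq0 p0) p2.
have ss : s ^+ 2 <= 1 by rewrite expr_le1.
have ss0 := sqr_ge0 s.
have p4 : (1 - s ^+ 2) * D ^+ 2 + s ^+ 2 * dot n n <= D ^+ 2 + dot n n.
  by apply: lerD; rewrite ler_piMl ?sqr_ge0 //; lra.
have p5 := ler_wpM2l (ltW p0) p4.
by move: p1; rewrite p3 ltNge p5.
Qed.

End OneChart.
End Charts.

(** * The symmetry exchanges the strands of a crossing *)

Section Swap.
Context {R : realType}.
Local Notation V3 := ('rV[R]_3).

(** An embedded square around w, positively oriented for an outside observer. *)
Definition oriented_chart (chi : R * R -> V3) (w : V3) : Prop :=
  [/\ cts (@square R) chi, {in @square R &, injective chi},
      forall z, square z -> sphere 2 (chi z), chi (0, 0) = w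
    & exists u v, 0 < det3 u v w /\
        wind (fun t => det3 (chi (pt 1 t)) v w) (fun t => det3 u (chi (pt 1 t)) w) 1].

Lemma oriented_chart_wind chi w (f1 f2 : V3) : oriented_chart chi w ->
  det3 f1 f2 w != 0 ->
  exists2 r0, 0 < r0 <= 1 & forall r, 0 < r <= r0 ->
    wind (fun t => dot f1 (chi (pt r t) - w)) (fun t => dot f2 (chi (pt r t) - w))
      (sgn_wind (det3 f1 f2 w) 1).
Proof.
by move=> [h1 h2 h3 h4 [u [v [h5 h6]]]]; apply: (@chart_wind R chi w _ _ _ _ u v).
Qed.

Definition seg (s : R) (z z' : R * R) : R * R :=
  ((1 - s) * z.1 + s * z'.1, (1 - s) * z.2 + s * z'.2).

Lemma seg0 z z' : seg 0 z z' = z.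
Proof. by rewrite /seg subr0 !mul1r !mul0r !addr0; case: z. Qed.
Lemma seg1 z z' : seg 1 z z' = z'.
Proof. by rewrite /seg subrr !mul1r !mul0r !add0r; case: z'. Qed.

Lemma seg_disc (r s : R) z z' : 0 <= s <= 1 -> nsq z <= r -> nsq z' <= r -> nsq (seg s z z') <= r.
Proof.
move=> /andP[s0 s1] hz hz'.
have -> : nsq (seg s z z') = (1 - s) * nsq z + s * nsq z' - s * (1 - s) * ((z.1 - z'.1) ^+ 2 + (z.2 - z'.2) ^+ 2).
  by rewrite /nsq /seg /=; ring.
have : 0 <= s * (1 - s) * ((z.1 - z'.1) ^+ 2 + (z.2 - z'.2) ^+ 2).
  by rewrite !mulr_ge0 ?subr_ge0 // addr_ge0 // sqr_ge0.
have := ler_wpM2l s0 hz'; have s1' : 0 <= 1 - s by rewrite subr_ge0.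
have := ler_wpM2l s1' hz; lra.
Qed.

(** By the intermediate value theorem along the segments of C. *)
Lemma convex_sign (f : R * R -> R) (B C : set (R * R)) : cts B f -> C `<=` B ->
  (forall s z z', 0 <= s <= 1 -> C z -> C z' -> C (seg s z z')) ->
  (forall z, C z -> f z != 0) -> forall z z', C z -> C z' -> 0 < f z * f z'.
Proof.
move=> cf CB conv f0 z z' Cz Cz'.
rewrite ltNge; apply/negP => h.
pose g s := f (seg s z z') * f z.
have cg : cts (`[0, 1]%classic : set R) g.
  apply: ctsM; last exact: cts_cst.
  apply: (cts_comp cf) => [|s /itv01P hs]; last exact/CB/conv.
  by rewrite /seg; have := @cts_id R (`[0, 1]%classic) => h0; ctst.
have g0 : 0 < g 0 by rewrite /g seg0 -expr2 exprn_even_gt0 // f0.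
have g1 : g 1 <= 0 by rewrite /g seg1 mulrC.
have [c /[!in_itv]/= hc gc] := @IVT R g 0 1 0 ler01 cg ltac:(by rewrite ge_min g1 orbT le_max ltW).
move/eqP: gc; rewrite mulf_eq0 => /orP[] /eqP e.
  by have := f0 _ (conv _ _ _ hc Cz Cz'); rewrite e eqxx.
by have := f0 _ Cz; rewrite e eqxx.
Qed.

Lemma mul_pos_trans (a b c : R) : 0 < a * b -> 0 < b * c -> 0 < a * c.
Proof.
move=> h1 h2; have b0 : b != 0 by case: eqP h1 => // ->; rewrite mulr0 ltxx.
have : 0 < (a * b) * (b * c) by rewrite mulr_gt0.
have -> : (a * b) * (b * c) = b ^+ 2 * (a * c) by ring.
by rewrite pmulr_rgt0 // exprn_even_gt0.
Qed.

Lemma sign_abs (x : R) : exists2 sg : R, sg = 1 \/ sg = -1 & sg * x = `|x|.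
Proof.
by case: (ger0P x) => _; [exists 1; rewrite ?mul1r|exists (-1); rewrite ?mulN1r]; auto.
Qed.

Section Exchange.
Variables (psi : V3 -> V3) (chi chi' : R * R -> V3) (w w' : V3).
Hypothesis psiI : homeo2 psi psi.
Hypothesis nofix : forall x, sphere 2 x -> psi x <> x.
Hypothesis chartw : oriented_chart chi w.
Hypothesis chartw' : oriented_chart chi' w'.
Hypothesis psiw : psi w = w'.
Hypothesis diag : forall z z', square z -> square z' -> psi (chi z) = chi' z' ->
  (`|z.1| = `|z.2| <-> `|z'.1| = `|z'.2|) /\ (`|z.1| < `|z.2| <-> `|z'.1| < `|z'.2|).

Lemma chart_sphere chi0 w0 : oriented_chart chi0 w0 -> sphere 2 w0.
Proof. by move=> [_ _ h <- _]; apply: h; exact: square0. Qed.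

(** Moving w and w' to the poles by K, the map psi preserves the winding number
   around the axis of the image of a small loop around w ([wind_pole_swap]).  But
   loops that are counterclockwise for an outside observer turn in opposite
   directions around this axis at w and at w'. *)
Lemma opposite_winds : exists (K K' : V3 -> V3) (e : int) (r0 : R),
  [/\ e = 1 \/ e = -1, 0 < r0 <= 1, homeo2 K K' /\ K w' = - north,
      forall r, 0 < r <= r0 -> turn (fun t => K (chi' (pt r t))) (- e)
    & forall r, 0 < r <= r0 -> turn (fun t => K (psi (chi (pt r t)))) e].
Proof.
have sw := chart_sphere chartw; have sw' := chart_sphere chartw'.
have [[cpsi spsi] _ psiK _] := psiI.
have ww' : w <> w' by rewrite -psiw => e; exact: (nofix sw (esym e)).
have psiw' : psi w' = w by rewrite -psiw psiK.
have [K [K' [f1 [f2 [hK [Kw Kw'] Kf [D0 D'] [fd1 [fd2 _]]]]]]] := axis_homeo sw sw' ww'.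
have [mK mK' K'K KK'] := hK.
have D0' : det3 f1 f2 w' != 0 by rewrite D' oppr_eq0.
have [ra /andP[ra0 ra1] raP] := oriented_chart_wind chartw D0.
have [rb /andP[rb0 rb1] rbP] := oriented_chart_wind chartw' D0'.
pose e := sgn_wind (det3 f1 f2 w) 1.
have e1 : e = 1 \/ e = -1 by rewrite /e /sgn_wind; case: ifP => _; [left|right].
have eN : sgn_wind (det3 f1 f2 w') 1 = - e.
  rewrite D' /e /sgn_wind oppr_gt0; case: (ltgtP 0 (det3 f1 f2 w)) => // h.
  by move: D0; rewrite -h eqxx.
have [cchi _ schi _ _] := chartw; have [cchi' _ schi' _ _] := chartw'.
pose r0 := Num.min ra rb.
have r00 : 0 < r0 by rewrite lt_min ra0.
have rra : r0 <= ra by rewrite ge_min lexx.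
have rrb : r0 <= rb by rewrite ge_min lexx orbT.
have inner r t : 0 < r <= r0 -> square (pt r t).
  by move=> /andP[h1 h2]; apply: pt_square; rewrite ltW //=; lra.
have KW (c : R -> V3) n : (forall t, circ t -> sphere 2 (c t)) ->
    wind (fun t => dot f1 (c t - w)) (fun t => dot f2 (c t - w)) n ->
    turn (fun t => K (c t)) n.
  move=> sc [a [ca pa ea]]; exists a; split => // t ht.
  have [b b0 [-> ->]] := Kf _ (sc _ ht); apply: polar_scale => //; exact: pa.
have wchi r : 0 < r <= r0 -> turn (fun t => K (chi (pt r t))) e.
  move=> hr; apply: KW; first by move=> t _; apply: schi; exact: inner hr.
  by apply: raP; move: hr => /andP[-> h] /=; lra.
exists K, K', e, r0; split => //; first by rewrite r00 /=; lra.
- move=> r hr; rewrite -eN; apply: KW; first by move=> t _; apply: schi'; exact: inner hr.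
  have hr' : 0 < r <= rb by move: hr => /andP[-> h] /=; lra.
  apply: wind_ext (rbP _ hr') => t _; set x := chi' _.
  have shift f : dot f (w - w') = 0 -> dot f (x - w') = dot f (x - w).
    move=> h; have -> : x - w' = (x - w) + (w - w') by rewrite addrA subrK.
    by rewrite dotC dotDl !(dotC _ f) h addr0.
  by rewrite !shift.
- move=> r hr.
  pose f x := K (psi (K' x)).
  have hf : homeo2 f (fun x => K (psi (K' x))).
    exact: homeo2_comp hK (homeo2_comp psiI (homeo2_sym hK)).
  have K'N : K' north = w by rewrite -Kw K'K.
  have K'S : K' (- north) = w' by rewrite -Kw' K'K.
  have fN : f north = - north by rewrite /f K'N psiw Kw'.
  have fS : f (- north) = north by rewrite /f K'S psiw' Kw.
  have foff := homeo2_offpole hf (or_intror (conj fN fS)).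
  have mf : smap f by case: hf.
  have fnofix x : sphere 2 x -> f x <> x.
    move=> sx e'; apply: (nofix (mK'.2 _ sx)).
    by rewrite -[LHS]K'K -/(f x) ?e' //; apply: spsi; exact: mK'.2.
  have wf := wind_pole_swap mf fnofix fN fS foff.
  have W := wchi r hr.
  have cc : cts (circ : set R) (fun t => K (chi (pt r t))).
    apply: (cts_comp mK.1) => [|t _]; last by apply: schi; exact: inner hr.
    apply: (cts_comp cchi) => [|t _]; last exact: inner hr.
    by apply: cts_pt; [exact: cts_cst|exact: cts_id].
  have := wind_mult mf foff wf cc _ _ W.
  rewrite mulr1 pt_per => h.
  have {h} := h _ erefl; rewrite /f => h.
  apply: (@turn_ext _ (fun t => K (psi (K' (K (chi (pt r t))))))).
    by move=> t _; rewrite K'K //; apply: schi; exact: inner hr.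
  apply: h => t ht; split; first by apply: mK.2; apply: schi; exact: inner hr.
  exact: wind_neq0 W ht.
Qed.

(** A chart covers a neighbourhood of its centre: a missed point would let the
   boundary loop be contracted in its complement. *)
Lemma chart_covers (K K' : V3 -> V3) (e : int) (r : R) :
  homeo2 K K' -> K w' = - north -> 0 < r <= 1 -> e != 0 ->
  turn (fun t => K (chi' (pt r t))) e ->
  (forall z, nsq z <= r ^+ 2 -> pz (K (chi' z)) < 0) ->
  exists2 d : R, 0 < d & forall x, sphere 2 x -> normsq (x - w') < d ->
    exists2 z, nsq z <= r ^+ 2 & chi' z = x.
Proof.
move=> hK Kw' /andP[r0 r1] e0 W neg.
have [cchi' ichi' schi' chi'0 _] := chartw'; have [mK _ _ _] := hK.
have rr : 0 <= r <= 1 by rewrite ltW.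
have r2 : r ^+ 2 <= 1 by rewrite expr_le1 // ltW.
have dsq z : nsq z <= r ^+ 2 -> square z by move=> h; apply: disc_square; exact: le_trans h r2.
have sw' : sphere 2 w' by rewrite -chi'0; apply: schi'; exact: square0.
have sK z : square z -> sphere 2 (K (chi' z)) by move=> sz; apply: mK.2; exact: schi'.
have cKc : cts (@square R) (fun z => K (chi' z)) by apply: (cts_comp mK.1 cchi').
pose loop t := K (chi' (pt r t)).
have cl : cts (circ : set R) loop.
  apply: (cts_comp cKc) => [|t _]; last exact: pt_square.
  by apply: cts_pt; [exact: cts_cst|exact: cts_id].
have lper : loop (2 * pi) = loop 0 by rewrite /loop pt_per.
pose n2 x : R := px x ^+ 2 + py x ^+ 2.
have l0 t : circ t -> 0 < n2 (loop t) by case: W => a [_ h _] /h/polar_neq0.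
have csph : compact (@sphere R 2) := @compact_sphere R 2.
have cx : cts (sphere 2 `*` (circ : set R)) (fun z : V3 * R => K z.1).
  by apply: (cts_comp mK.1) => [|z []//]; ctst.
have [||[x t] [/= sx ht] /normsq_sub_eq0 ->|da da0 daP] :=
   @compact_pos_near R _ (sphere 2 `*` (circ : set R))
   (fun z : V3 * R => n2 (loop z.2) - n2 (K z.1)) (fun z => normsq (z.1 - w'))
   (compact_setX csph (@compact_circ R)).
- have cl2 : cts (sphere 2 `*` (circ : set R)) (fun z : V3 * R => loop z.2).
    by apply: (cts_comp cl) => [|z []//]; ctst.
  by rewrite /n2; ctst.
- by ctst.
- by rewrite Kw' {2}/n2 !coordE !oppr0 expr0n /= addr0 subr0 l0.
have cKx : cts (sphere 2) (fun x => K x) := mK.1.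
have [||x sx /normsq_sub_eq0 ->|db db0 dbP] :=
   @compact_pos_near R _ (sphere 2) (fun x => - pz (K x)) (fun x => normsq (x - w')) csph.
- by ctst.
- by ctst.
- by rewrite Kw' !coordE opprK ltr01.
exists (Num.min da db); first by rewrite lt_min da0.
move=> x sx; rewrite lt_min => /andP[ha hb].
have nn : `|normsq (x - w')| = normsq (x - w') by rewrite ger0_norm ?normsq_ge0.
have small t : circ t -> n2 (K x) < n2 (loop t).
  by move=> ht; rewrite -subr_gt0; apply: (daP (x, t)); rewrite //= nn.
have Kx0 : pz (K x) < 0 by rewrite -oppr_gt0; apply: dbP; rewrite //= nn.
case: (pselect (exists2 z, nsq z <= r ^+ 2 & chi' z = x)) => // miss; exfalso.
pose a := px (K x); pose b := py (K x).
have avoid z : nsq z <= r ^+ 2 -> px (K (chi' z)) - a != 0 \/ py (K (chi' z)) - b != 0.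
  move=> hz; apply: or_neq0 => e1 e2; apply: miss; exists z => //.
  apply: (homeo2_inj hK (schi' _ (dsq _ hz)) sx); apply: eq3; try (by rewrite -/a; lra); first by rewrite -/b; lra.
  have := sK _ (dsq _ hz); have := mK.2 _ sx => /sphereP; rewrite -/a -/b => h1 /sphereP h2.
  have h3 : pz (K (chi' z)) ^+ 2 = pz (K x) ^+ 2.
    have e1' : px (K (chi' z)) = a by lra.
    have e2' : py (K (chi' z)) = b by lra.
    by move: h2; rewrite e1' e2'; lra.
  move/eqP: h3; rewrite eqf_sqr => /orP[/eqP //|/eqP h3].
  by have := neg _ hz; rewrite h3 oppr_lt0 => h4; have := lt_trans h4 Kx0; rewrite ltxx.
have W1 : wind (fun t => px (loop t) - a) (fun t => py (loop t) - b) e.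
  apply: wind_segment W; rewrite ?pt_per ?lper //.
  - exact: cts_px.
  - exact: cts_py.
  - by apply: ctsB; [exact: cts_px|exact: cts_cst].
  - by apply: ctsB; [exact: cts_py|exact: cts_cst].
  move=> s t /andP[s0 s1] ht; rewrite -/(loop t).
  have -> : (1 - s) * px (loop t) + s * (px (loop t) - a) = px (loop t) - s * a by ring.
  have -> : (1 - s) * py (loop t) + s * (py (loop t) - b) = py (loop t) - s * b by ring.
  apply: or_neq0 => e1 e2; have := small _ ht; rewrite /n2.
  have -> : px (loop t) = s * a by lra.
  have -> : py (loop t) = s * b by lra.
  rewrite -/a -/b !exprMn -mulrDr ltNge ler_piMl ?addr_ge0 ?sqr_ge0 //.
  by rewrite expr_le1.
have cs s t : 0 <= s <= 1 -> nsq (pt (s * r) t) <= r ^+ 2.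
  move=> /andP[s0 s1]; rewrite nsq_pt exprMn ler_piMl ?sqr_ge0 // expr_le1 //.
have cc : cts cyl (fun p : R * R => K (chi' (pt (p.1 * r) p.2))).
  apply: (cts_comp cKc) => [|p /cylP[h _]]; last by apply: dsq; exact: cs.
  by apply: cts_pt; ctst.
have W0 : wind (fun t => px (K (chi' (pt (1 * r) t))) - a) (fun t => py (K (chi' (pt (1 * r) t))) - b) 0.
  apply: (wind_transport (X := fun s t => px (K (chi' (pt (s * r) t))) - a)
    (Y := fun s t => py (K (chi' (pt (s * r) t))) - b)).
  - by ctst.
  - by ctst.
  - by move=> s t hs _; apply: avoid; exact: cs.
  - by move=> s _; rewrite pt_per.
  apply: (@wind_ext R (fun=> px (K (chi' (0, 0))) - a) (fun=> py (K (chi' (0, 0))) - b)).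
    by move=> t _; rewrite /pt !mul0r.
  by apply: wind_cst; apply: avoid; rewrite nsq0 sqr_ge0.
move/eqP: e0; apply; rewrite mul1r in W0; exact: wind_uniq W1 W0.
Qed.

(** The local homeomorphism tau = chi'^-1 psi chi preserves the pair of diagonals
   and the colours of the sectors, and reverses the orientation.  On each sector
   around a half-axis the coordinate of tau along this axis has a constant sign.
   If the signs were equal on opposite sectors, the segment from tau z to a fixed
   point of the axis would avoid 0, and tau would have winding number 0; if they
   were those of z, or those of - z, the segment from tau z to z, or to - z, would
   avoid 0, and tau would preserve the orientation.  Hence tau reverses exactly
   one of the two axes, and exchanges the diagonals. *)
Lemma strands_swapped : exists2 r : R, 0 < r & forall z z',
  square z -> square z' -> nsq z < r -> psi (chi z) = chi' z' ->
  (z.1 = z.2 -> z'.1 = - z'.2) /\ (z.1 = - z.2 -> z'.1 = z'.2).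
Proof.
have [K [K' [e [r0 [e1 /andP[r00 r01] [hK Kw'] W' W]]]]] := opposite_winds.
have [cchi ichi schi chi0 _] := chartw; have [cchi' ichi' schi' chi'0 _] := chartw'.
have sw := chart_sphere chartw; have sw' := chart_sphere chartw'.
have [[cpsi spsi] _ psiK _] := psiI; have [mK _ _ _] := hK.
have cKc : cts (@square R) (fun z => K (chi' z)) by apply: (cts_comp mK.1 cchi').
have cnsq : cts (@square R) nsq by rewrite /nsq; ctst.
have nsqn z : `|nsq z| = nsq z by rewrite ger0_norm ?nsq_ge0.
have [||z sz /nsq_eq0 ->|d1 d10 d1P] :=
   @compact_pos_near R _ (@square R) (fun z => - pz (K (chi' z))) nsq compact_square.
- by ctst.
- by [].
- by rewrite chi'0 Kw' !coordE opprK ltr01.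
(* the radius of a disc mapped by chi' below the equator *)
pose r3 := Num.min r0 (Num.min d1 1 / 2).
have m1 : 0 < Num.min d1 1 by rewrite lt_min d10 ltr01.
have m2 : Num.min d1 1 <= 1 by rewrite ge_min lexx orbT.
have m3 : Num.min d1 1 <= d1 by rewrite ge_min lexx.
have r30 : 0 < r3 by rewrite lt_min r00 /=; lra.
have r3r : r3 <= r0 by rewrite ge_min lexx.
have r3d : r3 <= Num.min d1 1 / 2 by rewrite ge_min lexx orbT.
have r31 : r3 <= 1 by lra.
have r3sq : r3 ^+ 2 < d1 by rewrite expr2; nra.
have r3sq1 : r3 ^+ 2 <= 1 by rewrite expr_le1 // ltW.
have dsq z : nsq z <= r3 ^+ 2 -> square z by move=> h; apply: disc_square; exact: le_trans h r3sq1.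
have neg z : nsq z <= r3 ^+ 2 -> pz (K (chi' z)) < 0.
  move=> hz; rewrite -oppr_gt0; apply: d1P; first exact: dsq.
  by rewrite nsqn (le_lt_trans hz).
have off z : z <> (0, 0) -> nsq z <= r3 ^+ 2 -> offpole (K (chi' z)).
  move=> /polar_pt[r rp [t ht [-> ->]]]; rewrite ler_pXn2r ?nnegrE ?(ltW rp) ?(ltW r30) // => hr.
  by apply: wind_neq0 (W' r _) ht; rewrite rp (le_trans hr).
have e0 : - e != 0 by case: e1 => ->.
have hr3 : 0 < r3 <= r0 by rewrite r30.
have [d d0 dP] := chart_covers hK Kw' (r := r3) ltac:(by rewrite r30) e0 (W' _ hr3) neg.
have cpc : cts (@square R) (fun z => psi (chi z)) by apply: (cts_comp cpsi cchi).
have [||z sz /nsq_eq0 ->|d2 d20 d2P] :=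
   @compact_pos_near R _ (@square R) (fun z => d - normsq (psi (chi z) - w')) nsq compact_square.
- by ctst.
- by [].
- by rewrite chi0 psiw subrr normsq0 subr0.
pose r4 := Num.min r3 (Num.min d2 1 / 2).
have n1 : 0 < Num.min d2 1 by rewrite lt_min d20 ltr01.
have n2 : Num.min d2 1 <= 1 by rewrite ge_min lexx orbT.
have n3 : Num.min d2 1 <= d2 by rewrite ge_min lexx.
have r40 : 0 < r4 by rewrite lt_min r30 /=; lra.
have r43 : r4 <= r3 by rewrite ge_min lexx.
have r4d : r4 <= Num.min d2 1 / 2 by rewrite ge_min lexx orbT.
have r4sq : r4 ^+ 2 < d2 by rewrite expr2; nra.
have r4sq3 : r4 ^+ 2 <= r3 ^+ 2 by rewrite ler_pXn2r ?nnegrE ?(ltW r40) ?(ltW r30).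
pose B : set (R * R) := [set z | nsq z <= r4 ^+ 2].
have Bsq z : B z -> square z by move=> h; apply: dsq; exact: le_trans h r4sq3.
(* tau = inv' o psi o chi is continuous, by compactness of the square *)
pose inv' x := get [set z | square z /\ chi' z = x].
have inv'P z : square z -> inv' (chi' z) = z.
  move=> sz; have [h1 h2] : square (inv' (chi' z)) /\ chi' (inv' (chi' z)) = chi' z.
    by apply: (getI (P := [set y | square y /\ chi' y = chi' z]) (x := z)).
  exact: square_inj ichi' h1 sz h2.
have hV : hausdorff_space V3 by exact: norm_hausdorff.
have cinv : cts (chi' @` @square R) inv' := cts_inverse hV compact_square cchi' inv'P.
pose tau z := inv' (psi (chi z)).
have tauP z : B z -> nsq (tau z) <= r3 ^+ 2 /\ chi' (tau z) = psi (chi z).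
  move=> Bz; have sz := Bsq _ Bz.
  have [|z' hz' ez'] := dP (psi (chi z)) (spsi _ (schi _ sz)).
    rewrite -subr_gt0; apply: d2P => //; rewrite nsqn.
    exact: le_lt_trans Bz r4sq.
  by rewrite /tau -ez' inv'P //; exact: dsq.
have ctau : cts B tau.
  apply: (cts_comp cinv) => [|z Bz]; first by apply: cts_sub cpc => z /Bsq.
  by have [h1 h2] := tauP _ Bz; exists (tau z) => //; exact: dsq.
have tau0 z : B z -> z <> (0, 0) -> tau z <> (0, 0).
  move=> Bz z0 tz; have [_ ht] := tauP _ Bz; move: ht; rewrite tz chi'0 -psiw => h.
  apply: z0; apply: (square_inj ichi (Bsq _ Bz) square0); rewrite chi0.
  by rewrite -(psiK _ (schi _ (Bsq _ Bz))) -h psiK.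
have tdiag z : B z -> (`|z.1| = `|z.2| <-> `|(tau z).1| = `|(tau z).2|) /\
   (`|z.1| < `|z.2| <-> `|(tau z).1| < `|(tau z).2|).
  move=> Bz; have [h1 h2] := tauP _ Bz; apply: diag; [exact: Bsq|exact: dsq|by []].
(* the coordinate along the horizontal axis if h holds, along the vertical axis
   otherwise *)
pose co (h : bool) (z : R * R) := if h then z.1 else z.2.
have coE h (z z' : R * R) : co h z = co h z' -> co (~~ h) z = co (~~ h) z' -> z = z'.
  by case: h z z' => -[? ?] [? ?] /= -> ->.
have tle h z : B z -> `|co (~~ h) z| <= `|co h z| -> `|co (~~ h) (tau z)| <= `|co h (tau z)|.
  move=> /tdiag[hd1 hd2]; case: h => /=; last first.
    by rewrite le_eqVlt => /orP[/eqP/hd1 ->|/hd2/ltW].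
  by rewrite !leNgt => /negP n; apply/negP => /hd2.
have tnz h z : B z -> z <> (0, 0) -> `|co (~~ h) z| <= `|co h z| -> co h (tau z) != 0.
  move=> Bz z0 /(tle _ _ Bz) l; apply/eqP => t0; apply: (tau0 _ Bz z0).
  by move: l; rewrite t0 normr0 normr_le0 => /eqP t0'; apply: (coE h); rewrite ?t0 ?t0'; case: (h).
have cco h : cts B (fun z => co h (tau z)) by case: h; rewrite /co; ctst.
have coseg h s z z' : co h (seg s z z') = (1 - s) * co h z + s * co h z' by case: h.
have Bconv s z z' : 0 <= s <= 1 -> B z -> B z' -> B (seg s z z') by exact: seg_disc.
(* the four closed sectors, around the half-axes *)
pose sector h (sg : R) : set (R * R) :=
  [set z | B z /\ (0 < sg * co h z /\ `|co (~~ h) z| <= sg * co h z)].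
pose unit (sg : R) := sg = 1 \/ sg = -1.
have sgabs (sg x : R) : unit sg -> 0 < sg * x -> sg * x = `|x|.
  by case=> ->; [rewrite mul1r => /gtr0_norm|rewrite mulN1r oppr_gt0 => /ltr0_norm].
have sector_sign h sg z z' : unit sg -> sector h sg z -> sector h sg z' ->
    0 < co h (tau z) * co h (tau z').
  move=> usg; apply: (convex_sign (cco h) (C := sector h sg)).
  - by move=> y [].
  - move=> s y y' /[dup] hs /andP[s0 s1] [By [y0 hy]] [By' [y'0 hy']].
    split; first exact: Bconv.
    have -> : sg * co h (seg s y y') = (1 - s) * (sg * co h y) + s * (sg * co h y').
      by rewrite coseg; ring.
    split; first exact: convex_gt0.
    rewrite coseg (le_trans (ler_normD _ _)) // !normrM (ger0_norm s0).
    rewrite (@ger0_norm _ (1 - s)) ?subr_ge0 //.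
    by apply: lerD; apply: ler_wpM2l; rewrite ?subr_ge0.
  - move=> y [By [y0 hy]]; apply: tnz => //; last by rewrite -(sgabs _ _ usg y0).
    by move=> ye; move: y0; rewrite ye; case: (h); rewrite /= mulr0 ltxx.
have sectors z : z <> (0, 0) -> B z -> exists h sg, unit sg /\ sector h sg z.
  move=> z0 Bz; have [h hle] : exists h, `|co (~~ h) z| <= `|co h z|.
    by case: (leP `|z.2| `|z.1|) => [?|/ltW ?]; [exists true|exists false].
  have n0 : co h z != 0.
    apply/eqP => c0; apply: z0; move: hle; rewrite c0 normr0 normr_le0 => /eqP c0'.
    by apply: (coE h); rewrite ?c0 ?c0'; case: (h).
  have [sg usg sE] := sign_abs (co h z).
  by exists h, sg; rewrite /sector /= sE normr_gt0.
pose ax (h : bool) q : R * R := if h then (q, 0) else (0, q).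
have axE h q : [/\ co h (ax h q) = q, co (~~ h) (ax h q) = 0 & nsq (ax h q) = q ^+ 2].
  by case: h; split => //; rewrite /nsq /= expr0n /= ?addr0 ?add0r.
have sector_ax h sg : unit sg -> sector h sg (ax h (sg * r4)).
  move=> usg; have [e2 e3 e4] := axE h (sg * r4); have sg2 : sg * sg = 1 by case: usg => ->; rewrite ?mulrNN mulr1.
  split; first by rewrite /B /= e4 exprMn expr2 sg2 mul1r.
  by rewrite e2 e3 normr0 mulrA sg2 mul1r r40 ltW.
have unit1 : unit 1 by left.
have unitN1 : unit (-1) by right.
pose d_ h sg := co h (tau (ax h (sg * r4))).
have d_0 h sg : unit sg -> d_ h sg != 0.
  move=> usg; have := sector_sign h sg _ _ usg (sector_ax h sg usg) (sector_ax h sg usg).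
  by rewrite -/(d_ h sg); case: eqP => // ->; rewrite mul0r ltxx.
have ptB t : B (pt r4 t) by rewrite /B /= nsq_pt.
have pt0 t : pt r4 t <> (0, 0).
  by move=> h; have := nsq_pt r4 t; rewrite h nsq0 => /esym/eqP; rewrite sqrf_eq0 gt_eqF.
(* comparing the loop tau (pt r4 t) with a loop in the punctured disc *)
have compare (l : R -> R * R) n : cts (circ : set R) l -> l (2 * pi) = l 0 ->
    (forall t, nsq (l t) <= r3 ^+ 2) ->
    (forall s z t, 0 <= s <= 1 -> z = pt r4 t -> seg s (tau z) (l t) <> (0, 0)) ->
    turn (fun t => K (chi' (l t))) n -> n = e.
  move=> cl lper ld ls Wl.
  have W0 : turn (fun t => K (chi' (tau (pt r4 t)))) e.
    apply: turn_ext (W r4 _) => [t _|]; last by rewrite r40 (le_trans r43).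
    by have [_ ->] := tauP _ (ptB t).
  have sd s t : 0 <= s <= 1 -> nsq (seg s (tau (pt r4 t)) (l t)) <= r3 ^+ 2.
    by move=> hs; apply: seg_disc => //; have [] := tauP _ (ptB t).
  have c1 : cts cyl (fun p : R * R => p.1) by ctst.
  have c2 : cts cyl (fun p : R * R => l p.2) by exact: cts_cyl2.
  have c3 : cts cyl (fun p : R * R => tau (pt r4 p.2)).
    by apply: (cts_comp ctau) => [|p _]; [apply: cts_pt; ctst|exact: ptB].
  have cc : cts cyl (fun p : R * R => K (chi' (seg p.1 (tau (pt r4 p.2)) (l p.2)))).
    apply: (cts_comp cKc) => [|p /cylP[hs _]]; last by apply: dsq; exact: sd.
    by rewrite /seg; ctst.
  apply: wind_uniq Wl _.
  apply: (@turn_ext _ (fun t => K (chi' (seg 1 (tau (pt r4 t)) (l t))))); first by move=> t _; rewrite seg1.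
  apply: (turn_transport cc).
  - by move=> s t hs ht; apply: off; [exact: ls|exact: sd].
  - by move=> s _; rewrite /= pt_per lper.
  - by apply: turn_ext W0 => t _; rewrite /= seg0.
have en0 : 0 <> e by case: e1 => ->.
have ene : - e <> e by case: e1 => ->.
have tn z : B z -> nsq (tau z) <= r3 ^+ 2 by move=> /tauP[].
have co_le h z : co h z ^+ 2 <= nsq z by case: h; rewrite /nsq ?lerDl ?lerDr sqr_ge0.
have opposite_arms h : d_ h 1 * d_ h (-1) < 0.
  rewrite ltNge; apply/negP => same_sign; apply: en0.
  have q0 := d_0 h 1 unit1; set q := d_ h 1 in q0 same_sign.
  have [q1 q2 q3] := axE h q.
  have qd : nsq (ax h q) <= r3 ^+ 2.
    rewrite q3; apply: le_trans (co_le h _) (tn _ _).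
    by have [] := sector_ax h 1 unit1.
  apply: (compare (fun=> ax h q)) => //.
  - exact: cts_cst.
  - move=> s z t hs ze; have z0 : z <> (0, 0) by rewrite ze; exact: pt0.
    have Bz : B z by rewrite ze; exact: ptB.
    move=> se; have := congr1 (co h) se; have := congr1 (co (~~ h)) se.
    have -> : co h (0, 0) = 0 by case: (h).
    have -> : co (~~ h) (0, 0) = 0 by case: (h).
    rewrite !coseg q1 q2 mulr0 addr0 => s1 s2.
    have key : 0 < co h (tau z) * q -> False.
      move=> kq; have : ((1 - s) * co h (tau z) + s * q) * q = 0 by rewrite s2 mul0r.
      rewrite mulrDl -!mulrA => c0'; have := convex_gt0 hs kq (y := q * q) ltac:(by rewrite -expr2 exprn_even_gt0).
      by rewrite c0' ltxx.
    have [h' [sg [usg hz]]] := sectors _ z0 Bz.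
    case: (eqVneq h' h) => [hh|nh].
      rewrite hh in hz; apply: key; have := sector_sign _ _ _ _ usg hz (sector_ax h sg usg).
      case: usg => -> //; rewrite -/(d_ h (-1)) => a1; apply: mul_pos_trans a1 _.
      by rewrite mulrC lt_neqAle same_sign andbT eq_sym mulf_neq0 // d_0.
    have {nh} hh : h' = ~~ h by case: (h) (h') nh => -[].
    rewrite hh in hz; have := sector_sign _ _ _ _ usg hz hz.
    move/eqP: s1; rewrite mulf_eq0 subr_eq0 => /orP[/eqP es|/eqP ->]; last by rewrite mul0r ltxx.
    by move: s2; rewrite -es subrr mul0r add0r mul1r => /eqP; rewrite (negbTE q0).
  - apply: wind_cst; apply: off => // qe; move: q0.
    by rewrite -q1 qe; case: (h); rewrite eqxx.
have sector_d h sg z : unit sg -> sector h sg z -> 0 < co h (tau z) * (d_ h 1 * sg).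
  move=> usg hz; have a1 := sector_sign _ _ _ _ usg hz (sector_ax h sg usg).
  case: usg a1 => ->; first by rewrite mulr1.
  rewrite -/(d_ h (-1)) => a1; apply: mul_pos_trans a1 _.
  by rewrite mulrN1 mulrN oppr_gt0 mulrC.
have NE : d_ true 1 * d_ false 1 < 0.
  rewrite ltNge; apply/negP => NE; apply: ene.
  have {}NE : 0 < d_ true 1 * d_ false 1 by rewrite lt_neqAle NE andbT eq_sym mulf_neq0 // d_0.
  have [sg usg sE] := sign_abs (d_ true 1).
  have sg2 : sg * sg = 1 by case: usg => ->; rewrite ?mulrNN mulr1.
  have sgE : 0 < d_ true 1 * sg.
    by rewrite mulrC sE normr_gt0 d_0.
  have sgh h : 0 < d_ h 1 * sg.
    by case: h => //; apply: mul_pos_trans sgE; rewrite mulrC.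
  pose l t : R * R := (sg * (pt r4 t).1, sg * (pt r4 t).2).
  have ln t : nsq (l t) = r4 ^+ 2.
    by rewrite -(nsq_pt r4 t) /nsq /l /= !exprMn [sg ^+ 2]expr2 sg2 !mul1r.
  apply: (compare l) => //.
  - by rewrite /l /pt; ctst.
  - by rewrite /l pt_per.
  - by move=> t; rewrite ln.
  - move=> s z t hs ze; have z0 : z <> (0, 0) by rewrite ze; exact: pt0.
    have Bz : B z by rewrite ze; exact: ptB.
    have [h [sg' [usg' hz]]] := sectors _ z0 Bz.
    move=> /(congr1 (co h)); rewrite coseg.
    have -> : co h (0, 0) = 0 by case: (h).
    have -> : co h (l t) = sg * co h z by rewrite ze; case: (h).
    move=> c0'; have := convex_gt0 hs (mul_pos_trans (sector_d _ _ _ usg' hz) _) hz.2.1.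
    move=> /(_ (sg * sg')) pos.
    have : 0 < d_ h 1 * sg' * (sg * sg').
      have -> : d_ h 1 * sg' * (sg * sg') = d_ h 1 * sg * (sg' * sg') by ring.
      by case: usg' => ->; rewrite ?mulrNN !mulr1.
    move/pos; have -> : (1 - s) * (co h (tau z) * (sg * sg')) + s * (sg' * co h z) =
       sg * sg' * ((1 - s) * co h (tau z) + s * (sg * co h z)) + (1 - sg * sg) * (s * sg' * co h z) by ring.
    by rewrite c0' sg2 subrr mulr0 mul0r addr0 ltxx.
  - have hr4 : 0 < r4 <= r0 by rewrite r40 (le_trans r43).
    have W4 := W' _ hr4.
    case: usg => sgE'.
      by apply: turn_ext W4 => t _; rewrite /l sgE' !mul1r; case: (pt r4 t).
    have lE t : l t = pt r4 (t + 1 * pi).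
      by rewrite /l sgE' mul1r /pt /= cosDpi sinDpi !mulN1r !mulrN.
    apply: (@turn_ext _ (fun t => K (chi' (pt r4 (t + 1 * pi))))); first by move=> t _; rewrite lE.
    apply: (turn_transport (C := fun p => K (chi' (pt r4 (p.2 + p.1 * pi))))).
    + apply: (cts_comp cKc) => [|p _]; last by apply: Bsq; exact: ptB.
      by apply: cts_pt; ctst.
    + by move=> s t _ _; apply: off; [exact: pt0|rewrite nsq_pt].
    + by move=> s _; rewrite /= add0r addrC /pt cos_2pi sin_2pi.
    + by apply: turn_ext W4 => t _; rewrite /= mul0r addr0.
exists (r4 ^+ 2); first by rewrite exprn_gt0.
move=> z z' sz sz' hz ez.
have Bz : B z by rewrite /B /=; exact: ltW.
have [_ e2] := tauP _ Bz.
have tz : tau z = z' by rewrite /tau ez inv'P.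
case: (pselect (z = (0, 0))) => [z0|z0].
  have -> : z' = (0, 0).
    by apply: (square_inj ichi' sz' square0); rewrite -ez z0 chi0 psiw.
  by rewrite /= oppr0.
have [hd _] := tdiag _ Bz; rewrite tz in hd.
have n0 : `|z.1| = `|z.2| -> z.2 != 0.
  move=> en; apply/eqP => z20; apply: z0; move/eqP: en; rewrite z20 normr0 normr_eq0 => /eqP z10.
  by move: z10 z20; case: (z) => ? ? /= -> ->.
have strand_sign (b : R) : unit b -> z.1 = b * z.2 -> 0 < z'.1 * (- b * z'.2) /\ `|z'.1| = `|- b * z'.2|.
  move=> ub e12; have b1 : `|b| = 1 by case: ub => ->; rewrite ?normrN normr1.
  have en : `|z.1| = `|z.2| by rewrite e12 normrM b1 mul1r.
  split; last by rewrite normrM normrN b1 mul1r; exact/hd.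
  have [sg usg sE] := sign_abs z.2.
  have bb : b * b = 1 by case: ub => ->; rewrite ?mulrNN mulr1.
  have ubsg : unit (b * sg) by case: ub usg => -> [] ->; rewrite ?mulrNN ?mulr1 ?mul1r; [left|right|right|left].
  have a1 := sector_d false sg z usg; have a2 := sector_d true (b * sg) z ubsg.
  have sE2 : b * sg * z.1 = `|z.2| by rewrite e12 -sE -[RHS]mul1r -bb; ring.
  rewrite /sector /= sE en normr_gt0 (n0 en) tz in a1.
  rewrite /sector /= sE2 normr_gt0 (n0 en) tz in a2.
  have {}a1 := a1 (conj Bz (conj isT (lexx _))); have {}a2 := a2 (conj Bz (conj isT (lexx _))).
  have : 0 < (z'.1 * (d_ true 1 * (b * sg))) * (z'.2 * (d_ false 1 * sg)) * - (d_ true 1 * d_ false 1).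
    by rewrite mulr_gt0 ?oppr_gt0 // mulr_gt0.
  have -> : (z'.1 * (d_ true 1 * (b * sg))) * (z'.2 * (d_ false 1 * sg)) * - (d_ true 1 * d_ false 1) =
    (sg * d_ true 1 * d_ false 1) ^+ 2 * (z'.1 * (- b * z'.2)) by ring.
  rewrite pmulr_rgt0 // lt_neqAle sqr_ge0 andbT eq_sym sqrf_eq0 !mulf_neq0 ?d_0 //.
  by case: usg => ->; rewrite ?oppr_eq0 oner_eq0.
have same (x y : R) : 0 < x * y /\ `|x| = `|y| -> x = y.
  move=> [h /eqP]; rewrite eqr_norm2 => /orP[/eqP //|/eqP e'].
  by move: h; rewrite e' mulNr oppr_gt0 ltNge -expr2 sqr_ge0.
split=> h.
  by rewrite -mulN1r; apply: same; apply: strand_sign; rewrite ?mul1r.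
rewrite -[z'.2]mul1r -[1]opprK; apply: same; apply: strand_sign => //.
by rewrite mulN1r.
Qed.


End Exchange.
End Swap.

(** * From the 2-sphere to the 3-sphere *)

Section Suspension.
Context {R : realType}.
Local Notation V3 := ('rV[R]_3).
Local Notation V4 := ('rV[R]_4).

(** S^3 is the suspension of S^2: the spheres around the origin of R^3 are the
   sections of S^3 at constant last coordinate. *)
Definition cone (u : V3) (y : R) : V4 :=
  row_mx (Num.sqrt (1 - y ^+ 2) *: u) (const_mx y : 'rV[R]_1).

Definition base (x : V4) : V3 := lsubmx (x : 'rV[R]_(3 + 1)).
Definition height (x : V4) : R := rsubmx (x : 'rV[R]_(3 + 1)) ord0 ord0.

Lemma base_cone u y : base (cone u y) = Num.sqrt (1 - y ^+ 2) *: u.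
Proof. exact: row_mxKl. Qed.

Lemma height_cone u y : height (cone u y) = y.
Proof. by rewrite /height /cone row_mxKr mxE. Qed.

Lemma cone_eta (x : V4) : x = row_mx (base x) (const_mx (height x) : 'rV[R]_1).
Proof.
have <- : rsubmx (x : 'rV[R]_(3 + 1)) = const_mx (height x).
  by apply/rowP => i; rewrite !ord1 [RHS]mxE.
by rewrite /base hsubmxK.
Qed.

Lemma normsq_row (a : V3) (b : 'rV[R]_1) : normsq (row_mx a b : V4) = normsq a + b ord0 ord0 ^+ 2.
Proof.
rewrite /normsq (@big_split_ord _ _ _ 3 1) /= big_ord1; congr (_ + _ ^+ 2).
  by apply: eq_bigr => i _; congr (_ ^+ 2); exact: row_mxEl.
exact: row_mxEr.
Qed.

Lemma sphere3P (x : V4) : sphere 3 x <-> normsq (base x) + height x ^+ 2 = 1.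
Proof. by rewrite /sphere /= {1}[x]cone_eta normsq_row mxE. Qed.

Lemma itv11_sq (y : R) : -1 <= y <= 1 -> y ^+ 2 <= 1.
Proof. by move=> hy; rewrite -(real_normK (num_real y)) expr_le1 // ler_norml. Qed.

Lemma cone_sphere u y : sphere 2 u -> -1 <= y <= 1 -> sphere 3 (cone u y).
Proof.
move=> su /itv11_sq hy; apply/sphere3P; rewrite base_cone height_cone normsqZ.
by rewrite sqr_sqrtr ?subr_ge0 // su mulr1 subrK.
Qed.

Lemma cone_pole u u' y : y ^+ 2 = 1 -> cone u y = cone u' y.
Proof. by move=> h; rewrite /cone h subrr sqrtr0 !scale0r. Qed.

Lemma eq_row (a a' : V3) (b b' : 'rV[R]_1) : a = a' -> b = b' ->
  row_mx a b = row_mx a' b' :> V4.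
Proof. by move=> -> ->. Qed.

Lemma cone_surj (x : V4) : sphere 3 x ->
  exists u y, [/\ sphere 2 u, -1 <= y <= 1 & x = cone u y].
Proof.
move=> /sphere3P h; have hn := normsq_ge0 (base x).
have hy : -1 <= height x <= 1.
  by rewrite -ler_norml -(@expr_le1 _ 2) // real_normK ?num_real //; lra.
case: (eqVneq (base x) 0) => [b0|b0].
  exists north, (height x); split => //; first exact: northP.
  rewrite {1}[x]cone_eta b0 /cone; apply: eq_row => //.
  have : normsq (0 : V3) = 0 by rewrite normsqE !coordE expr0n /= !addr0.
  rewrite -b0 => e; have -> : 1 - height x ^+ 2 = 0 by lra.
  by rewrite sqrtr0 scale0r b0.
exists (unit_vec (base x)), (height x); split => //; first exact: unit_sphere.
rewrite {1}[x]cone_eta /cone /unit_vec; apply: eq_row => //.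
have -> : 1 - height x ^+ 2 = normsq (base x) by lra.
by rewrite scalerA divff ?scale1r // gt_eqF // sqrtr_gt0 normsq_gt0.
Qed.

Lemma cone_l u y (i : 'I_3) j : cone u y j (lshift 1 i : 'I_(3 + 1)) = Num.sqrt (1 - y ^+ 2) * u ord0 i.
Proof. by rewrite (ord1 j); apply: (etrans (@row_mxEl _ 1 3 1 _ _ _ _)); rewrite mxE. Qed.

Lemma cone_r u y (i : 'I_1) j : cone u y j (rshift 3 i : 'I_(3 + 1)) = y.
Proof. by apply: (etrans (@row_mxEr _ 1 3 1 _ _ _ _)); rewrite mxE. Qed.

Lemma ord4P (P : 'I_4 -> Prop) : (forall i : 'I_3, P (lshift 1 i)) ->
  (forall i : 'I_1, P (rshift 3 i)) -> forall j, P j.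
Proof.
move=> hl hr j; have [k jk|k jk] := @splitP 3 1 j.
  by have -> : j = lshift 1 k by apply: val_inj.
by have -> : j = rshift 3 k by apply: val_inj.
Qed.

(** The antipodal map reverses heights, besides acting antipodally on the
   directions. *)
Lemma cone_opp u y : - cone u y = cone (- u) (- y).
Proof.
apply/rowP; apply: ord4P => i; rewrite [LHS]mxE ?cone_l ?cone_r //.
by rewrite sqrrN [in RHS]mxE mulrN.
Qed.

Lemma cts_cone (X : topologicalType) (A : set X) (u : X -> V3) (y : X -> R) :
  cts A u -> cts A y -> cts A (fun x => cone (u x) (y x)).
Proof.
move=> cu cy; apply: cts_mx => i; apply: ord4P => k.
  apply: (@cts_ext _ _ _ (fun x => Num.sqrt (1 - y x ^+ 2) * u x ord0 k)).
    by move=> x _; rewrite cone_l.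
  have cuk : cts A (fun x => u x ord0 k) by exact: cts_coord.
  by ctst.
by apply: (cts_ext _ cy) => x _; rewrite cone_r.
Qed.

Lemma stereo_cone (rho : R) u : sphere 2 u -> 0 < rho ->
  inv_stereo (rho *: u) = cone u ((rho ^+ 2 - 1) / (rho ^+ 2 + 1)).
Proof.
move=> su r0; rewrite /inv_stereo normsqZ su mulr1 /cone.
have p0 : 0 < rho ^+ 2 + 1 by rewrite ltr_wpDl ?sqr_ge0.
apply: eq_row => //; rewrite scalerA; congr (_ *: _).
have -> : 1 - ((rho ^+ 2 - 1) / (rho ^+ 2 + 1)) ^+ 2 = (2 / (rho ^+ 2 + 1) * rho) ^+ 2.
  by field; rewrite gt_eqF.
by rewrite sqrtr_sqr ger0_norm // mulr_ge0 ?divr_ge0 // ltW.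
Qed.

Lemma hausdorff4 : hausdorff_space V4. Proof. exact: norm_hausdorff. Qed.

Definition itv11 : set R := `[-1, 1].
Lemma itv11P y : itv11 y <-> -1 <= y <= 1.
Proof. by rewrite /itv11 /= in_itv. Qed.
Definition solid : set (V3 * R) := sphere 2 `*` itv11.

Lemma compact_solid : compact solid.
Proof. by apply: compact_setX; [exact: compact_sphere|exact: segment_compact]. Qed.

(** A continuous family of homeomorphisms of [-1, 1] fixing both ends. *)
Record height_map (T T' : V3 -> R -> R) : Prop := HeightMap {
  hm_cts : cts solid (fun z => T z.1 z.2);
  hm_cts' : cts solid (fun z => T' z.1 z.2);
  hm_end : forall u, T u 1 = 1 /\ T u (-1) = -1;
  hm_end' : forall u, T' u 1 = 1 /\ T' u (-1) = -1;
  hm_itv : forall u y, -1 <= y <= 1 -> -1 <= T u y <= 1;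
  hm_itv' : forall u y, -1 <= y <= 1 -> -1 <= T' u y <= 1;
  hmK : forall u y, -1 <= y <= 1 -> T' u (T u y) = y;
  hmK' : forall u y, -1 <= y <= 1 -> T u (T' u y) = y }.

Lemma sq1_cases (y : R) : y ^+ 2 = 1 -> y = 1 \/ y = -1.
Proof. by move=> /eqP; rewrite sqrf_eq1 => /orP[] /eqP; [left|right]. Qed.

Definition susp (f : V3 -> V3) (T : V3 -> R -> R) (x : V4) : V4 :=
  cone (f (unit_vec (base x))) (T (unit_vec (base x)) (height x)).

Lemma susp_cone f T u y : (forall u, T u 1 = 1 /\ T u (-1) = -1) ->
  sphere 2 u -> -1 <= y <= 1 -> susp f T (cone u y) = cone (f u) (T u y).
Proof.
move=> Te su hy; rewrite /susp base_cone height_cone.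
case: (eqVneq (y ^+ 2) 1) => [y1|y1].
  have TE v : T v y = y by have [h1 h2] := Te v; case: (sq1_cases y1) => ->.
  by rewrite !TE; exact: cone_pole.
rewrite unit_pos //; rewrite sqrtr_gt0 subr_gt0 lt_neqAle y1; exact: itv11_sq.
Qed.

Lemma cts_susp f (T : V3 -> R -> R) : smap f -> cts solid (fun z => T z.1 z.2) ->
  (forall u, T u 1 = 1 /\ T u (-1) = -1) -> cts (sphere 3) (susp f T).
Proof.
move=> [cf sf] cT Te.
have c1 : cts solid (fun z : V3 * R => z.1) by ctst.
have c2 : cts solid (fun z : V3 * R => z.2) by ctst.
have -> : @sphere R 3 = (fun z : V3 * R => cone z.1 z.2) @` solid.
  apply/seteqP; split => [x /cone_surj[u [y [su hy ->]]]|_ [[u y] [/= su /itv11P hy] <-]].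
    by exists (u, y) => //; split => //; exact/itv11P.
  exact: cone_sphere.
apply: cts_quotient; [exact: hausdorff4|exact: compact_solid|exact: cts_cone|].
apply: (@cts_ext _ _ _ (fun z : V3 * R => cone (f z.1) (T z.1 z.2))).
  by move=> [u y] [/= su /itv11P hy]; rewrite susp_cone.
by apply: cts_cone => //; apply: (cts_comp cf) => // z [].
Qed.

Lemma smap_susp f (T : V3 -> R -> R) : smap f -> (forall u y, -1 <= y <= 1 -> -1 <= T u y <= 1) ->
  (forall u, T u 1 = 1 /\ T u (-1) = -1) -> {homo susp f T : x / sphere 3 x}.
Proof.
move=> [cf sf] Ti Te x /cone_surj[u [y [su hy ->]]]; rewrite susp_cone //.
by apply: cone_sphere; [exact: sf|exact: Ti].
Qed.

Lemma susp_homeo f g (T T' : V3 -> R -> R) : homeo2 f g -> height_map T T' ->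
  sphere_homeo (n := 3) (susp f T).
Proof.
move=> [mf mg gf fg] hT; exists (susp g (fun v => T' (g v))).
have e2 : forall u, T' (g u) 1 = 1 /\ T' (g u) (-1) = -1 by move=> u; exact: (hm_end' hT).
have i2 : forall u y, -1 <= y <= 1 -> -1 <= T' (g u) y <= 1 by move=> u; exact: (hm_itv' hT).
split.
- by split; apply: smap_susp => //; [exact: (hm_itv hT)|exact: (hm_end hT)].
- by apply: cts_susp => //; [exact: (hm_cts hT)|exact: (hm_end hT)].
- apply: cts_susp => //.
  have cg1 : cts solid (fun z : V3 * R => g z.1) by apply: (cts_comp mg.1) => [|z []//]; ctst.
  apply: (cts_comp (f := fun z : V3 * R => (g z.1, z.2)) (hm_cts' hT)); first by ctst.
  by move=> [u y] [/= su hy]; split => //=; exact: mg.2.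
- move=> x; rewrite inE => /cone_surj[u [y [su hy ->]]].
  rewrite susp_cone //; last exact: (hm_end hT).
  rewrite susp_cone ?gf ?(hmK hT) //; [exact: mf.2|exact: (hm_itv hT)].
- move=> x; rewrite inE => /cone_surj[u [y [su hy ->]]].
  rewrite susp_cone // susp_cone ?fg ?(hmK' hT) //; last 2 first.
  + exact: mg.2.
  + exact: (hm_itv' hT).
  exact: (hm_end hT).
Qed.

(** The heights are deformed to the identity by convexity. *)
Lemma susp_orientation f (T T' : V3 -> R -> R) : smap f -> homotopic id f -> height_map T T' ->
  orientation_preserving (n := 3) (susp f T).
Proof.
move=> mf [H [cH sH H0 H1]] hT.
pose TT (t : R) u y := (1 - t) * y + t * T u y.
pose F (p : R * V4) := cone (H (p.1, unit_vec (base p.2)))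
  (TT p.1 (unit_vec (base p.2)) (height p.2)).
have FE t u y : sphere 2 u -> -1 <= y <= 1 -> F (t, cone u y) = cone (H (t, u)) (TT t u y).
  move=> su hy; rewrite /F /= base_cone height_cone.
  case: (eqVneq (y ^+ 2) 1) => [y1|y1].
    have TE v : TT t v y = y.
      have [h1 h2] := hm_end hT v; rewrite /TT.
      by case: (sq1_cases y1) => ->; rewrite ?h1 ?h2 -mulrDl subrK mul1r.
    by rewrite !TE; exact: cone_pole.
  rewrite unit_pos //; rewrite sqrtr_gt0 subr_gt0 lt_neqAle y1; exact: itv11_sq.
have TTi t u y : 0 <= t <= 1 -> -1 <= y <= 1 -> -1 <= TT t u y <= 1.
  by move=> /andP[t0 t1] /[dup] /(hm_itv hT u) /andP[h1 h2] /andP[h3 h4]; rewrite /TT; nra.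
exists F; split.
- pose K : set (R * (V3 * R)) := (`[0, 1]%classic : set R) `*` solid.
  have cK : compact K by apply: compact_setX; [exact: segment_compact|exact: compact_solid].
  pose q (z : R * (V3 * R)) := (z.1, cone z.2.1 z.2.2).
  have c1 : cts K (fun z : R * (V3 * R) => z.1) by ctst.
  have c2 : cts K (fun z : R * (V3 * R) => z.2) by ctst.
  have c3 : cts K (fun z : R * (V3 * R) => z.2.1) by ctst.
  have c4 : cts K (fun z : R * (V3 * R) => z.2.2) by ctst.
  have cq : cts K q by apply: cts_pair => //; exact: cts_cone.
  have hY : hausdorff_space (R * V4)%type by exact: norm_hausdorff.
  have -> : (`[0, 1]%classic : set R) `*` sphere 3 = q @` K.
    apply/seteqP; split => [[t x] [/= ht /cone_surj[u [y [su hy ->]]]]|_ [[t [u y]] [/= ht [/= su /itv11P hy]] <-]].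
      by exists (t, (u, y)) => //; split => //; split => //; exact/itv11P.
    by split => //=; exact: cone_sphere.
  apply: (cts_quotient hY cK cq).
  apply: (@cts_ext _ _ _ (fun z : R * (V3 * R) => cone (H (z.1, z.2.1)) (TT z.1 z.2.1 z.2.2))).
    by move=> [t [u y]] [/= ht [/= su /itv11P hy]]; rewrite /q /= FE.
  apply: cts_cone.
    apply: (cts_comp (f := fun z : R * (V3 * R) => (z.1, z.2.1)) cH); first by ctst.
    by move=> [t [u y]] [/= ht [/= su hy]].
  have cT : cts K (fun z : R * (V3 * R) => T z.2.1 z.2.2).
    by apply: (cts_comp (hm_cts hT) c2) => z [].
  by rewrite /TT; ctst.
- move=> t x ht /cone_surj[u [y [su hy ->]]]; rewrite FE //.
  by apply: cone_sphere; [exact: sH|exact: TTi].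
- by move=> x /cone_surj[u [y [su hy ->]]]; rewrite FE // /TT H0 // subr0 mul1r mul0r addr0.
- move=> x /cone_surj[u [y [su hy ->]]].
  rewrite FE // susp_cone //; last exact: (hm_end hT).
  by rewrite /TT H1 // subrr mul0r add0r mul1r.
Qed.

(** Two families of homeomorphisms of [-1, 1]. In the coordinate
   ln ((1 + y) / (1 - y)) of ]-1, 1[, which is twice the logarithm of the
   distance to the origin of R^3, slide k is the translation by ln k.  The
   second one is odd, and moves the heights away from 0 or towards it. *)
Definition slide (k y : R) : R :=
  (k * (1 + y) - (1 - y)) / (k * (1 + y) + (1 - y)).
Definition stretch (c y : R) : R := c * y / (1 + (c - 1) * `|y|).

Lemma slide_den (k y : R) : 0 < k -> -1 <= y <= 1 -> 0 < k * (1 + y) + (1 - y).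
Proof.
move=> k0 /andP[h1 h2]; case: (eqVneq y 1) => [->|y1].
  by rewrite subrr addr0 mulr_gt0 //; lra.
have : y < 1 by rewrite lt_neqAle y1.
by move=> h; rewrite ltr_wpDl ?subr_gt0 // mulr_ge0 ?(ltW k0) //; lra.
Qed.

Lemma stretch_den (c y : R) : 0 < c -> -1 <= y <= 1 -> 0 < 1 + (c - 1) * `|y|.
Proof.
move=> c0; rewrite -ler_norml => h; have := normr_ge0 y => h0.
have -> : 1 + (c - 1) * `|y| = (1 - `|y|) * 1 + `|y| * c by ring.
by apply: convex_gt0; rewrite ?h0.
Qed.

Lemma slide_itv (k y : R) : 0 < k -> -1 <= y <= 1 -> -1 <= slide k y <= 1.
Proof.
move=> k0 hy; have d := slide_den k0 hy; case/andP: hy => h1 h2.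
have h3 : 0 <= k * (1 + y) by rewrite mulr_ge0 ?(ltW k0) //; lra.
by rewrite /slide ler_pdivlMr // ler_pdivrMr //; lra.
Qed.

Lemma stretch_itv (c y : R) : 0 < c -> -1 <= y <= 1 -> -1 <= stretch c y <= 1.
Proof.
move=> c0 hy; have d := stretch_den c0 hy; move: hy; rewrite -!ler_norml => hy.
rewrite /stretch normrM normrM normfV (gtr0_norm d) (gtr0_norm c0) ler_pdivrMr // mul1r.
by lra.
Qed.


Lemma slideK (k y : R) : 0 < k -> -1 <= y <= 1 -> slide k^-1 (slide k y) = y.
Proof.
move=> k0 hy; have d := slide_den k0 hy; rewrite /slide.
set p := 1 + y; set q := 1 - y; set D := k * p + q in d *.
have pq : p + q = 2 by rewrite /p /q; lra.
have -> : 1 + (k * p - q) / D = 2 * k * p / D by rewrite /D; field; rewrite gt_eqF.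
have -> : 1 - (k * p - q) / D = 2 * q / D by rewrite /D; field; rewrite gt_eqF.
have -> : k^-1 * (2 * k * p / D) = 2 * p / D by field; rewrite !gt_eqF.
rewrite -mulrBl -mulrDl -mulrBr -mulrDr pq.
have -> : p - q = 2 * y by rewrite /p /q; ring.
by field; rewrite gt_eqF.
Qed.

Lemma stretchK (c y : R) : 0 < c -> -1 <= y <= 1 -> stretch c^-1 (stretch c y) = y.
Proof.
move=> c0 hy; have d := stretch_den c0 hy; rewrite /stretch normrM normrM normfV.
rewrite (gtr0_norm d) (gtr0_norm c0); set D := 1 + _ in d *.
have E : 1 + (c^-1 - 1) * (c * `|y| / D) = D^-1.
  have -> : 1 + (c^-1 - 1) * (c * `|y| / D) = (D + (1 - c) * `|y|) / D by field; rewrite !gt_eqF.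
  by rewrite (_ : D + _ = 1) ?mul1r // /D; ring.
by rewrite E invrK; field; rewrite !gt_eqF.
Qed.

Lemma slide1 (k : R) : 0 < k -> slide k 1 = 1.
Proof. by move=> k0; rewrite /slide subrr subr0 addr0 divff // mulf_neq0 ?gt_eqF. Qed.
Lemma slideN1 k : slide k (-1) = -1.
Proof.
have e : (1 - -1 : R) = 2 by lra.
by rewrite /slide subrr mulr0 e sub0r add0r mulNr divff.
Qed.
Lemma stretch1 (c : R) : 0 < c -> stretch c 1 = 1.
Proof. by move=> c0; rewrite /stretch normr1 !mulr1 addrC subrK divff ?gt_eqF. Qed.
Lemma stretchN1 (c : R) : 0 < c -> stretch c (-1) = -1.
Proof.
by move=> c0; rewrite /stretch normrN normr1 !mulr1 addrC subrK mulrN1 mulNr divff ?gt_eqF.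
Qed.

Lemma slide_map (k : V3 -> R) : (forall u, 0 < k u) -> cts (sphere 2) k ->
  height_map (fun u => slide (k u)) (fun u => slide (k u)^-1).
Proof.
move=> k0 ck.
have c1 : cts solid (fun z : V3 * R => k z.1) by apply: (cts_comp ck) => [|z []//]; ctst.
have ki u : 0 < (k u)^-1 by rewrite invr_gt0.
have c1i : cts solid (fun z : V3 * R => (k z.1)^-1) by apply: ctsV => // z _; rewrite gt_eqF.
have c2 : cts solid (fun z : V3 * R => z.2) by ctst.
have cd (j : V3 -> R) : (forall u, 0 < j u) -> cts solid (fun z : V3 * R => j z.1) ->
    cts solid (fun z : V3 * R => slide (j z.1) z.2).
  move=> j0 cj; rewrite /slide; apply: ctsM; first by ctst.
  apply: ctsV; last by ctst.
  by move=> z [_ /itv11P h]; rewrite gt_eqF // slide_den.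
split.
- exact: cd.
- exact: (cd (fun u => (k u)^-1)).
- by move=> u; rewrite slide1 ?slideN1.
- by move=> u; rewrite slide1 ?slideN1.
- by move=> u y; exact: slide_itv.
- by move=> u y; exact: slide_itv.
- by move=> u y; exact: slideK.
- by move=> u y hy; have := slideK (ki u) hy; rewrite invrK.
Qed.

Lemma stretch_map (c : V3 -> R) : (forall u, 0 < c u) -> cts (sphere 2) c ->
  height_map (fun u => stretch (c u)) (fun u => stretch (c u)^-1).
Proof.
move=> c0 cc.
have c1 : cts solid (fun z : V3 * R => c z.1) by apply: (cts_comp cc) => [|z []//]; ctst.
have ci u : 0 < (c u)^-1 by rewrite invr_gt0.
have c1i : cts solid (fun z : V3 * R => (c z.1)^-1) by apply: ctsV => // z _; rewrite gt_eqF.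
have c2 : cts solid (fun z : V3 * R => z.2) by ctst.
have cn : cts solid (fun z : V3 * R => `|z.2|) by exact: cts_norm.
have cd (j : V3 -> R) : (forall u, 0 < j u) -> cts solid (fun z : V3 * R => j z.1) ->
    cts solid (fun z : V3 * R => stretch (j z.1) z.2).
  move=> j0 cj; rewrite /stretch; apply: ctsM; first by ctst.
  apply: ctsV; last by ctst.
  by move=> z [_ /itv11P h]; rewrite gt_eqF // stretch_den.
split.
- exact: cd.
- exact: (cd (fun u => (c u)^-1)).
- by move=> u; rewrite stretch1 ?stretchN1.
- by move=> u; rewrite stretch1 ?stretchN1.
- by move=> u y; exact: stretch_itv.
- by move=> u y; exact: stretch_itv.
- by move=> u y; exact: stretchK.
- by move=> u y hy; have := stretchK (ci u) hy; rewrite invrK.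
Qed.

Lemma height_map_comp (S S' T T' : V3 -> R -> R) : height_map S S' -> height_map T T' ->
  height_map (fun u y => S u (T u y)) (fun u y => T' u (S' u y)).
Proof.
move=> hS hT.
have c1 : cts solid (fun z : V3 * R => z.1) by ctst.
split.
- apply: (cts_comp (f := fun z : V3 * R => (z.1, T z.1 z.2)) (hm_cts hS)).
    by apply: cts_pair => //; exact: hm_cts hT.
  by move=> z [h1 /itv11P h2]; split => //; apply/itv11P; exact: hm_itv hT _ _ h2.
- apply: (cts_comp (f := fun z : V3 * R => (z.1, S' z.1 z.2)) (hm_cts' hT)).
    by apply: cts_pair => //; exact: hm_cts' hS.
  by move=> z [h1 /itv11P h2]; split => //; apply/itv11P; exact: hm_itv' hS _ _ h2.
- by move=> u; have [-> ->] := hm_end hT u; exact: hm_end hS u.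
- by move=> u; have [-> ->] := hm_end' hS u; exact: hm_end' hT u.
- by move=> u y hy; apply: (hm_itv hS); exact: hm_itv hT _ _ hy.
- by move=> u y hy; apply: (hm_itv' hT); exact: hm_itv' hS _ _ hy.
- by move=> u y hy; rewrite (hmK hS) ?(hmK hT) //; exact: hm_itv hT _ _ hy.
- by move=> u y hy; rewrite (hmK' hT) ?(hmK' hS) //; exact: hm_itv' hS _ _ hy.
Qed.

End Suspension.

(** * Faces, crossings and extension of functions *)

Section FiniteFamilies.
Context {R : realType}.

Lemma finite_lower_bound (I : finType) (P : I -> R -> Prop) :
  (forall i e e', 0 < e' -> e' <= e -> P i e -> P i e') ->
  (forall i, exists2 e, 0 < e & P i e) ->
  exists2 e, 0 < e & forall i, P i e.
Proof.
move=> Pdown ex.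
have {ex} [f fP] := choice (fun i => (let: ex_intro2 e e0 Pe := ex i in ex_intro (fun e => 0 < e /\ P i e) e (conj e0 Pe))).
exists (\big[Num.min/1]_(i : I) f i).
  by apply: lt_bigmin => // i _; case: (fP i).
move=> i; apply: (Pdown i (f i)); last by case: (fP i).
  by apply: lt_bigmin => // j _; case: (fP j).
exact: bigmin_le_cond.
Qed.

Lemma compact_finite_union (X : topologicalType) (I : finType) (F : I -> set X) :
  (forall i, compact (F i)) -> compact (\bigcup_(i in [set: I]) F i).
Proof.
move=> cF; have -> : [set: I] = [set` enum I].
  by apply/seteqP; split => i //= _; rewrite mem_enum.
by rewrite bigcup_seq; exact: bigsetU_compact.
Qed.

End FiniteFamilies.

Section Components.
Context {R : realType}.
Local Notation V3 := ('rV[R]_3).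

Lemma homeo_component (h k : V3 -> V3) (A B : set V3) x : homeo2 h k ->
  A `<=` sphere 2 -> B `<=` sphere 2 -> (forall y, A y -> B (h y)) ->
  (forall y, B y -> A (k y)) -> A x ->
  h @` connected_component A x = connected_component B (h x).
Proof.
move=> [mh mk kh hk] sA sB AB BA Ax.
have inA y : connected_component A x y -> A y by exact: connected_component_sub.
have inB y : connected_component B (h x) y -> B y by exact: connected_component_sub.
apply/seteqP; split => [|y Cy].
  apply: connected_component_max.
  - by exists x => //; exact: connected_component_refl.
  - by move=> _ [y /inA /AB ? <-].
  - apply: connected_continuous_connected; first exact: component_connected.
    by apply: cts_sub mh.1 => y /inA /sA.
exists (k y); last by rewrite hk //; exact/sB/inB.
have : (k @` connected_component B (h x)) `<=` connected_component A x.
  apply: connected_component_max.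
  - exists (h x); last by rewrite kh //; exact: sA.
    by apply: connected_component_refl; exact: AB.
  - by move=> _ [z /inB /BA ? <-].
  - apply: connected_continuous_connected; first exact: component_connected.
    by apply: cts_sub mk.1 => z /inB /sB.
by apply; exists y.
Qed.

(** The determinants with two vectors of the basis are the coordinates in this
   basis, up to a positive factor. *)
Lemma crossing_oriented (G M : drawing R) (w : vertex M) (chi : R * R -> V3) :
  crossing_chart G w chi -> oriented_chart chi (vpos w).
Proof.
move=> [[c i s] [c0 [u [v [r [a [b [det ca ea P]]]]]]] _ _].
rewrite det3E in det.
split => //; first by move=> z sz; apply: s; exists z.
exists u, v; split => //; exists a; split => //.
- move=> th /circP /P [r0 E]; rewrite /pt !mul1r E.
  exists (r th * det3 u v (vpos w)); first exact: mulr_gt0.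
  by rewrite /det3 !coordE; split; ring.
- by rewrite ea mulr1.
Qed.

Lemma near_sphere_map (f : V3 -> V3) u0 d : cts (sphere 2) f -> sphere 2 u0 -> 0 < d ->
  exists2 e : R, 0 < e & forall u, sphere 2 u -> normsq (u - u0) < e -> normsq (f u - f u0) < d.
Proof.
move=> cf su0 d0; have cfu := cf.
have [||u su /normsq_sub_eq0 ->|e e0 eP] := @compact_pos_near R _ (sphere 2)
  (fun u => d - normsq (f u - f u0)) (fun u => normsq (u - u0)) (@compact_sphere R 2).
- by ctst.
- by ctst.
- by rewrite subrr normsq0 subr0.
exists e => // u su h; rewrite -subr_gt0; apply: eP => //.
by rewrite ger0_norm ?normsq_ge0.
Qed.

Lemma cts_metric (A : set V3) (f : V3 -> R) :
  (forall u0 e, A u0 -> 0 < e -> exists2 d, 0 < d &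
     forall u, A u -> normsq (u - u0) < d -> `|f u - f u0| < e) -> cts A f.
Proof.
move=> H; apply: at_cts => u0 Au0; apply/cvgrPdist_lt => e e0.
have [d d0 dP] := H _ _ Au0 e0.
have c : cts setT (fun u : V3 => normsq (u - u0)) by ctst.
have /= := cts_at c (x := u0) I; rewrite withinET.
move/cvgrPdist_lt => /(_ d d0) hn.
rewrite !near_withinE; near=> u => Au.
rewrite distrC; apply: dP => //.
have : `|normsq (u0 - u0) - normsq (u - u0)| < d by near: u.
by rewrite subrr normsq0 sub0r normrN ger0_norm ?normsq_ge0.
Unshelve. all: by end_near.
Qed.

Lemma closed_interval_limit (X : topologicalType) (F : R -> X) (C : set X) :
  cts (`[0, 1]%classic : set R) F -> closed C -> (forall t, 0 < t < 1 -> C (F t)) ->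
  forall t, 0 <= t <= 1 -> C (F t).
Proof.
move=> cF cC inner t /[dup] ht /andP[t0 t1].
apply: contrapT => nC.
have oC : nbhs (F t) (~` C) by apply: open_nbhs_nbhs; split => //; exact: closed_openC.
have It : (`[0, 1]%classic : set R) t by apply/itv01P.
have := (cts_at cF It) (~` C) oC.
rewrite /nbhs /= /within /= => /nbhs_ballP [e /= e0 eP].
pose e1 := Num.min e 1 / 2.
have m0 : 0 < Num.min e 1 by rewrite lt_min e0 ltr01.
have m1 : Num.min e 1 <= 1 by rewrite ge_min lexx orbT.
have m2 : Num.min e 1 <= e by rewrite ge_min lexx.
pose s := (1 - e1) * t + e1 * 2^-1.
have hs : 0 < s < 1 by rewrite /s /e1; apply/andP; split; nra.
apply: (eP s); [|by apply/itv01P; lra|exact: inner].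
rewrite /ball /= /s; have -> : t - ((1 - e1) * t + e1 / 2) = e1 * (t - 2^-1) by ring.
rewrite normrM gtr0_norm; last by rewrite /e1; lra.
have : `|t - 2^-1| <= 1 by rewrite ler_norml; lra.
by have := normr_ge0 (t - 2^-1); rewrite /e1; nra.
Qed.

(** Lagrange interpolation by polynomials in the coordinates. *)
Lemma interpolation (I : finType) (pos : I -> V3) (b : I -> R) : injective pos ->
  exists2 f : V3 -> R, cts setT f & forall i, f (pos i) = b i.
Proof.
move=> inj.
pose pi_ (i : I) (u : V3) := \prod_(j | j != i) (normsq (u - pos j) / normsq (pos i - pos j)).
have nz i j : j != i -> normsq (pos i - pos j) != 0.
  by move=> ij; rewrite gt_eqF // normsq_gt0 // subr_eq0 (inj_eq inj) eq_sym.
exists (fun u => \sum_(i : I) b i * pi_ i u).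
  apply: cts_sum => i; apply: ctsM; first exact: cts_cst.
  apply: cts_prod => j; apply: ctsM; last exact: cts_cst.
  by ctst.
move=> i; rewrite (bigD1 i) //= big1 ?addr0.
  by rewrite /pi_ big1 ?mulr1 // => j ji; rewrite divff // nz.
move=> j ji; rewrite /pi_ (bigD1 i) 1?eq_sym //= subrr.
by rewrite normsq0 !mul0r mulr0.
Qed.

(** The image of A is bounded, as the extension theorem requires. *)
Lemma tietze (A : set V3) (f : V3 -> R) : compact A -> cts A f ->
  exists2 g : V3 -> R, cts setT g & forall u, A u -> g u = f u.
Proof.
move=> cA cf.
have clA : closed A by apply: compact_closed => //; exact: norm_hausdorff.
have cfA : compact (f @` A) by exact: continuous_compact.
have [b [_ bP]] := compact_bounded cfA.
have bb : 0 < `|b| + 1 by rewrite ltr_wpDl.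
have fb u : A u -> `|f u| <= `|b| + 1.
  move=> Au; apply: bP; last by exists u.
  by rewrite (le_lt_trans (ler_norm b)) // ltrDl.
have nV : normal_space V3 by exact: pseudometric_normal.
have [g [fg cg _]] := continuous_bounded_extension nV clA bb cf fb.
exists g; first exact: cts_T.
by move=> u Au; rewrite fg ?inE.
Qed.

End Components.

(** * Making the heights symmetric *)

Section Symmetrize.
Context {R : realType}.
Local Notation V3 := ('rV[R]_3).
Variables (M : drawing R) (psi : V3 -> V3).
Hypothesis mapM : is_map M.
Hypothesis psiI : homeo2 psi psi.
Hypothesis nofix : forall x, sphere 2 x -> psi x <> x.
Hypothesis psiV : forall v : vertex M, exists v' : vertex M, psi (vpos v) = vpos v'.
Hypothesis psiS : forall x, skeleton M x -> skeleton M (psi x).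
(* S is the height of the strands, in a coordinate where heights can be
   translated; it is A or - A at the crossings. *)
Variables (S : edge M -> R -> R) (A : R) (over : edge M -> bool -> bool).
Hypothesis cS : forall m, cts (`[0, 1]%classic : set R) (S m).
Hypothesis Send : forall m s, S m (end_param R s) = if over m s then A else - A.
Variable chi : vertex M -> R * R -> V3.
Hypothesis chiP : forall v, oriented_chart (chi v) (vpos v).
Hypothesis strands : forall (m : edge M) s, exists2 d : R, 0 < d &
  forall t, 0 < t < 1 -> `|t - end_param R s| < d -> exists x y,
    [/\ square (x, y), earc m t = chi (endpt m s) (x, y) & x = if over m s then y else - y].
Hypothesis diags : forall v v' z z', psi (vpos v) = vpos v' ->
  square z -> square z' -> psi (chi v z) = chi v' z' ->
  (`|z.1| = `|z.2| <-> `|z'.1| = `|z'.2|) /\ (`|z.1| < `|z.2| <-> `|z'.1| < `|z'.2|).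

Lemma arc_skeleton (m : edge M) t : 0 <= t <= 1 -> skeleton M (earc m t).
Proof. by move=> ht; right; exists m => //; exists t => //; exact/itv01P. Qed.

Lemma skeleton_sphere x : skeleton M x -> sphere 2 x.
Proof. by move=> h; apply: (map_sphere mapM). Qed.

Lemma skeletonP u : skeleton M u -> (exists v : vertex M, u = vpos v) \/
  exists (m : edge M) t, 0 < t < 1 /\ u = earc m t.
Proof.
case=> [[v _ <-]|[m _ [t /itv01P /andP[t0 t1] <-]]]; first by left; exists v.
case: (ltgtP 0 t) t0 => // [t0 _|<- _]; last first.
  by left; exists (endpt m false); exact: (map_ends mapM m false).
case: (ltgtP t 1) t1 => // [t1 _|-> _]; last first.
  by left; exists (endpt m true); exact: (map_ends mapM m true).
by right; exists m, t; rewrite t0.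
Qed.

Lemma interior_not_vertex (m : edge M) t (v : vertex M) :
  0 < t < 1 -> earc m t = vpos v -> False.
Proof. by move=> ht; apply: (map_interior mapM). Qed.

Lemma psi_interior (m : edge M) t : 0 < t < 1 ->
  exists (m' : edge M) t', 0 < t' < 1 /\ psi (earc m t) = earc m' t'.
Proof.
move=> /[dup] ht /andP[t0 t1]; have sk := arc_skeleton m (t := t) ltac:(by rewrite !ltW).
have [[v e]|//] := skeletonP (psiS sk).
have [_ _ psiK _] := psiI; have [v' e'] := psiV v.
exfalso; apply: (interior_not_vertex (m := m) (v := v') ht).
by rewrite -e' -e psiK //; exact: skeleton_sphere.
Qed.

Lemma normsq_abs (x : V3) : `|normsq x| = normsq x.
Proof. by rewrite ger0_norm ?normsq_ge0. Qed.

Lemma cts_arc (m : edge M) : cts (`[0, 1]%classic : set R) (earc m).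
Proof. exact: (map_arc mapM). Qed.

(** As the interiors of the edges are embedded, there is only one such height. *)
Definition strand (u : V3) : R :=
  get [set s | exists (m : edge M) t, [/\ 0 < t < 1, earc m t = u & s = S m t]].

Lemma strandE (m : edge M) t : 0 < t < 1 -> strand (earc m t) = S m t.
Proof.
move=> ht.
have [m' [t' [ht' e ->]]] : [set s | exists (m' : edge M) t', [/\ 0 < t' < 1, earc m' t' = earc m t & s = S m' t']]
    (strand (earc m t)).
  apply: (getI (P := [set s | exists (m' : edge M) t', [/\ 0 < t' < 1, earc m' t' = earc m t & s = S m' t']]) (x := S m t)).
  by exists m, t.
by have [-> ->] := map_embedded mapM ht' ht e.
Qed.

Lemma strand_continuous (m0 : edge M) t0 e : 0 < t0 < 1 -> 0 < e ->
  exists2 d : R, 0 < d & forall (m : edge M) t, 0 < t < 1 ->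
    normsq (earc m t - earc m0 t0) < d -> `|strand (earc m t) - strand (earc m0 t0)| < e.
Proof.
move=> ht0 e0; rewrite strandE //.
have [||d d0 dP] := @finite_lower_bound R (edge M) (fun m d => forall t, 0 < t < 1 ->
   normsq (earc m t - earc m0 t0) < d -> `|strand (earc m t) - S m0 t0| < e); last by exists d.
  by move=> m d d' _ h P t ht hd; apply: P => //; exact: lt_le_trans hd h.
move=> m; have ca := @cts_arc m; have cSm := @cS m.
have cn : cts (`[0, 1]%classic : set R) (fun t => `|S m t - S m0 t0|).
  by apply: cts_norm; ctst.
have [||t /itv01P ht /normsq_sub_eq0 h|d d0 dP] := @compact_pos_near R _ (`[0, 1]%classic : set R)
   (fun t => e - `|S m t - S m0 t0|) (fun t => normsq (earc m t - earc m0 t0)) (@segment_compact R 0 1).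
- by ctst.
- by ctst.
- case: (eqVneq t 0) => [t00|t00].
    by exfalso; apply: (interior_not_vertex (m := m0) ht0 (v := endpt m false)); rewrite -h t00 -(map_ends mapM m false).
  case: (eqVneq t 1) => [t1|t1].
    by exfalso; apply: (interior_not_vertex (m := m0) ht0 (v := endpt m true)); rewrite -h t1 -(map_ends mapM m true).
  have ht' : 0 < t < 1 by case/andP: ht => a b; rewrite lt_neqAle eq_sym t00 a lt_neqAle t1.
  by have [-> ->] := map_embedded mapM ht' ht0 h; rewrite subrr normr0 subr0.
exists d => // t ht h; rewrite strandE // -subr_gt0; apply: dP.
  by apply/itv01P; case/andP: ht => *; rewrite !ltW.
by rewrite normsq_abs.
Qed.

Lemma half_param (t : R) : 0 < t < 1 -> exists s : bool,
  (if s then `[1/2, 1]%classic else `[0, 1/2]%classic : set R) t.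
Proof.
move=> /andP[t0 t1]; case: (leP t (1/2)) => h; [exists false|exists true];
  by rewrite /= in_itv /=; lra.
Qed.

(** Near a vertex, the skeleton consists of small pieces of the strands through
   the crossing, on the diagonals of the chart, at heights close to A or -A. *)
Lemma near_vertex (v0 : vertex M) (e r : R) : 0 < e -> 0 < r ->
  exists2 d : R, 0 < d & forall (m : edge M) t, 0 < t < 1 -> normsq (earc m t - vpos v0) < d ->
    exists b x y, [/\ `|strand (earc m t) - (if b then A else - A)| < e,
      square (x, y), nsq (x, y) < r, earc m t = chi v0 (x, y) & x = if b then y else - y].
Proof.
move=> e0 r0.
have [dlt dltP] := choice (fun ms : edge M * bool => (let: ex_intro2 d d0 P := strands ms.1 ms.2 in
  ex_intro (fun d => 0 < d /\ forall t, 0 < t < 1 -> `|t - end_param R ms.2| < d -> exists x y,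
    [/\ square (x, y), earc ms.1 t = chi (endpt ms.1 ms.2) (x, y) & x = if over ms.1 ms.2 then y else - y]) d (conj d0 P))).
pose half (s : bool) : set R := if s then `[1/2, 1]%classic else `[0, 1/2]%classic.
have halfc s : compact (half s) by case: s; exact: segment_compact.
have half01 s : half s `<=` (`[0, 1]%classic : set R).
  by case: s => t; rewrite /half /= !in_itv /=; lra.
have halfend s t : half s t -> (t = 0 \/ t = 1) -> t = end_param R s.
  by rewrite /end_param; case: s; rewrite /half /= in_itv /= => h [] e1; lra.
have [cchi ichi schi chi0 _] := chiP v0.
have [||z sz /normsq_sub_eq0 h|dr dr0 drP] := @compact_pos_near R _ (@square R)
   (fun z => r - nsq z) (fun z => normsq (chi v0 z - vpos v0)) compact_square.
- by rewrite /nsq; ctst.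
- by ctst.
- have -> : z = (0, 0) by apply: (square_inj ichi sz square0); rewrite chi0.
  by rewrite /nsq /= expr0n /= addr0 subr0.
have [||d d0 dP] := @finite_lower_bound R (edge M * bool)%type (fun ms d => forall t, half ms.2 t -> 0 < t < 1 ->
   normsq (earc ms.1 t - vpos v0) < d -> [/\ endpt ms.1 ms.2 = v0, `|t - end_param R ms.2| < dlt ms
     & `|S ms.1 t - S ms.1 (end_param R ms.2)| < e]).
- by move=> ms d d' _ h P t h1 h2 hd; apply: P => //; exact: lt_le_trans hd h.
- move=> [m s]; rewrite /=.
  have ca : cts (half s) (earc m) by apply: cts_sub (@cts_arc m); exact: half01.
  have cSm : cts (half s) (S m) by apply: cts_sub (@cS m); exact: half01.
  have ch : cts (half s) (fun t => normsq (earc m t - vpos v0)) by ctst.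
  have only t : half s t -> normsq (earc m t - vpos v0) = 0 ->
      t = end_param R s /\ endpt m s = v0.
    move=> ht /normsq_sub_eq0 h; have /itv01P /andP[t0 t1] := half01 _ _ ht.
    have te : t = 0 \/ t = 1.
      case: (eqVneq t 0) => [|n0]; first by left.
      case: (eqVneq t 1) => [|n1]; first by right.
      by exfalso; apply: (interior_not_vertex _ h); rewrite lt_neqAle eq_sym n0 t0 lt_neqAle n1.
    have tE := halfend _ _ ht te; split => //; apply: (map_vpos mapM).
    by rewrite -(map_ends mapM) -tE.
  case: (eqVneq (endpt m s) v0) => [ev|nv]; last first.
    have [|t ht h|d d0 dP] := @compact_pos_near R _ (half s) (fun=> -1)
       (fun t => normsq (earc m t - vpos v0)) (halfc s) _ ch.
    + exact: cts_cst.
    + by have [_ h'] := only _ ht h; rewrite h' eqxx in nv.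
    exists d => // t ht _ hd; have := dP t ht; rewrite normsq_abs => /(_ hd).
    by rewrite oppr_gt0 ltNge ler01.
  have c1 : cts (half s) (fun t => dlt (m, s) - `|t - end_param R s|).
    by apply: ctsB; [exact: cts_cst|apply: cts_norm; ctst].
  have c2 : cts (half s) (fun t => e - `|S m t - S m (end_param R s)|).
    by apply: ctsB; [exact: cts_cst|apply: cts_norm; ctst].
  have [t ht h|d1 d10 d1P] := compact_pos_near (halfc s) c1 ch.
    by have [-> _] := only _ ht h; rewrite subrr normr0 subr0; case: (dltP (m, s)).
  have [t ht h|d2 d20 d2P] := compact_pos_near (halfc s) c2 ch.
    by have [-> _] := only _ ht h; rewrite subrr normr0 subr0.
  exists (Num.min d1 d2); first by rewrite lt_min d10.
  move=> t ht _; rewrite lt_min => /andP[h1 h2]; split => //.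
    by rewrite -subr_gt0; apply: d1P => //; rewrite normsq_abs.
  by rewrite -subr_gt0; apply: d2P => //; rewrite normsq_abs.
exists (Num.min d dr); first by rewrite lt_min d0.
move=> m t ht; rewrite lt_min => /andP[h1 h2].
have [s hs] := half_param ht.
have [ev hd hS] := dP (m, s) t hs ht h1.
have [_ /(_ t ht hd) [x [y [/= sq E xy]]]] := dltP (m, s).
rewrite ev in E; exists (over m s), x, y; split => //.
  by rewrite strandE // -Send.
rewrite -subr_gt0; apply: drP => //; rewrite normsq_abs -E //.
Qed.

(** Translating by the correction makes the heights at u and at psi u opposite.
   At a vertex the two strands must be made opposite to each other, and they
   already are. *)
Definition correction (u : V3) : R :=
  if pselect (exists v : vertex M, u = vpos v) then 0
  else - (strand u + strand (psi u)) / 2.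

Lemma correction_vertex (v : vertex M) : correction (vpos v) = 0.
Proof. by rewrite /correction; case: pselect => // -[]; exists v. Qed.

Lemma correction_arc (m : edge M) t : 0 < t < 1 ->
  correction (earc m t) = - (strand (earc m t) + strand (psi (earc m t))) / 2.
Proof.
move=> ht; rewrite /correction; case: pselect => // -[v e].
by case: (interior_not_vertex ht e).
Qed.

(** At a crossing the heights at u and psi u tend to opposite limits, because psi
   maps the upper strand to the lower strand of the image: this is where the
   signs of the crossings matter. *)
Lemma cts_correction : cts (skeleton M) correction.
Proof.
have [[cpsi spsi] _ psiK _] := psiI.
apply: cts_metric => u0 e sk0 e0.
have su0 := skeleton_sphere sk0.
have e2 : 0 < e / 2 by rewrite divr_gt0.
have [[v0 E0]|[m0 [t0 [ht0 E0]]]] := skeletonP sk0.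
- have [v0' E0'] := psiV v0; rewrite {}E0 in su0 *.
  have [_ ichi _ chi0 _] := chiP v0.
  have [_ ichi' _ chi0' _] := chiP v0'.
  have [r r0 rP] := strands_swapped psiI nofix (chiP v0) (chiP v0') E0' (fun z z' => diags E0').
  have [d1 d10 d1P] := near_vertex v0 e2 r0.
  have [d2 d20 d2P] := near_vertex v0' e2 r0.
  have [d3 d30 d3P] := near_sphere_map cpsi su0 d20.
  exists (Num.min d1 d3); first by rewrite lt_min d10.
  move=> u sku; rewrite lt_min correction_vertex subr0 => /andP[h1 h3].
  have [[v ->]|[m [t [ht E]]]] := skeletonP sku; first by rewrite correction_vertex normr0.
  have hpsi := d3P _ (skeleton_sphere sku) h3.
  rewrite {u}E in sku h1 h3 hpsi *.
  have [m' [t' [ht' E']]] := psi_interior m ht.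
  rewrite correction_arc // E'; rewrite E' E0' in hpsi.
  have [b [x [y [hb sq hr Ec xy]]]] := d1P _ _ ht h1.
  have [b' [x' [y' [hb' sq' _ Ec' xy']]]] := d2P _ _ ht' hpsi.
  have ez : psi (chi v0 (x, y)) = chi v0' (x', y') by rewrite -Ec E' Ec'.
  have [/= sw1 sw2] := rP (x, y) (x', y') sq sq' hr ez.
  have n0 : x' <> 0 \/ y' <> 0.
    case: (eqVneq x' 0) => [x0|/eqP]; last by left.
    case: (eqVneq y' 0) => [y0|/eqP]; last by right.
    by exfalso; apply: (interior_not_vertex (m := m') (v := v0') ht'); rewrite Ec' x0 y0 chi0'.
  have bb : b' = ~~ b.
    case: b hb xy sw1 sw2 => _ xy sw1 sw2; case: b' hb' xy' => // _ xy'; exfalso.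
      by have := sw1 xy; case: n0; lra.
    by have := sw2 xy; case: n0; lra.
  have hsum : `|strand (earc m t) + strand (earc m' t')| < e.
    have -> : strand (earc m t) + strand (earc m' t') =
      (strand (earc m t) - (if b then A else - A)) + (strand (earc m' t') - (if b' then A else - A)).
      by rewrite bb; case: (b) => /=; ring.
    by rewrite (le_lt_trans (ler_normD _ _)) //; lra.
  rewrite mulNr normrN normrM normfV (ger0_norm (_ : 0 <= 2)) //.
  by have := normr_ge0 (strand (earc m t) + strand (earc m' t')); lra.
have [m0' [t0' [ht0' E0']]] := psi_interior m0 ht0.
rewrite {}E0 in su0 sk0 *.
have [d1 d10 d1P] := strand_continuous m0 ht0 e2.
have [d2 d20 d2P] := strand_continuous m0' ht0' e2.
have [d3 d30 d3P] := near_sphere_map cpsi su0 d20.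
have [||d4 d40 d4P] := @finite_lower_bound R (vertex M) (fun v d => d <= normsq (vpos v - earc m0 t0)).
- by move=> v d d' _ h1 h2; exact: le_trans h1 h2.
- move=> v; exists (normsq (vpos v - earc m0 t0)) => //.
  rewrite normsq_gt0 // subr_eq0; apply/eqP => h.
  exact: (interior_not_vertex ht0 (esym h)).
exists (Num.min d1 (Num.min d3 d4)); first by rewrite !lt_min d10 d30.
move=> u sku; rewrite !lt_min => /and3P[h1 h3 h4].
have [[v E]|[m [t [ht E]]]] := skeletonP sku.
  by have := d4P v; rewrite -E leNgt h4.
have hpsi := d3P _ (skeleton_sphere sku) h3.
rewrite {u}E in sku h1 h3 h4 hpsi *.
have [m' [t' [ht' E']]] := psi_interior m ht.
rewrite !correction_arc // E' E0'; rewrite E' E0' in hpsi.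
have a1 := d1P _ _ ht h1; have a2 := d2P _ _ ht' hpsi.
set x1 := strand (earc m t) in a1 *; set x2 := strand (earc m0 t0) in a1 *.
set y1 := strand _ in a2 *; set y2 := strand _ in a2 *.
have -> : - (x1 + y1) / 2 - - (x2 + y2) / 2 = - ((x1 - x2) + (y1 - y2)) / 2 by field.
rewrite mulNr normrN normrM normfV (ger0_norm (_ : 0 <= 2)) //.
have := ler_normD (x1 - x2) (y1 - y2); lra.
Qed.

Lemma compact_skeleton : compact (skeleton M).
Proof.
rewrite /skeleton; apply: compactU.
  have -> : vertices M = \bigcup_(v in [set: vertex M]) [set vpos v].
    by apply/seteqP; split => [_ [v _ <-]|_ [v _ ->]]; exists v.
  by apply: compact_finite_union => v; exact: compact_set1.
apply: compact_finite_union => m; apply: continuous_compact; first exact: cts_arc.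
exact: segment_compact.
Qed.

(** Only an extension of the correction to the sphere can be used to move the
   heights by a homeomorphism of S^3. *)
Lemma symmetric_heights : exists2 B : V3 -> R, cts setT B &
  forall (m : edge M) t (m' : edge M) t', 0 < t < 1 -> 0 < t' < 1 -> psi (earc m t) = earc m' t' ->
    B (earc m' t') + S m' t' = - (B (earc m t) + S m t).
Proof.
have [B cB BE] := tietze compact_skeleton cts_correction.
have [_ _ psiK _] := psiI.
exists B => // m t m' t' ht ht' E.
have sk : skeleton M (earc m t) by apply: arc_skeleton; case/andP: ht => *; rewrite !ltW.
have sk' : skeleton M (earc m' t') by apply: arc_skeleton; case/andP: ht' => *; rewrite !ltW.
have E' : psi (earc m' t') = earc m t by rewrite -E psiK //; exact: skeleton_sphere.
by rewrite !BE // !correction_arc // E E' !strandE //; lra.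
Qed.

End Symmetrize.

(** * Normalizing the heights at the crossings *)

Section Levels.
Context {R : realType}.
Local Notation V3 := ('rV[R]_3).

(** The homeomorphism of ]-1, 1[ onto the line which turns slides into
   translations. *)
Definition log_height (y : R) : R := ln ((1 + y) / (1 - y)).

Lemma log_height_arg (y : R) : -1 < y < 1 -> 0 < (1 + y) / (1 - y).
Proof. by move=> /andP[h1 h2]; rewrite divr_gt0 //; lra. Qed.

Lemma log_heightN (y : R) : -1 < y < 1 -> log_height (- y) = - log_height y.
Proof.
move=> hy; rewrite /log_height -lnV; last by rewrite posrE log_height_arg.
by rewrite invf_div opprK.
Qed.

Lemma log_height_inj (y z : R) : -1 < y < 1 -> -1 < z < 1 ->
  log_height y = log_height z -> y = z.
Proof.
move=> hy hz e.
have : (1 + y) / (1 - y) = (1 + z) / (1 - z).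
  by apply: (@ln_inj R) => //; rewrite posrE log_height_arg.
move: hy hz => /andP[h1 h2] /andP[h3 h4] /eqP.
by rewrite eqr_div; [move/eqP; lra|rewrite gt_eqF //; lra|rewrite gt_eqF //; lra].
Qed.

Lemma slide_strict (k y : R) : 0 < k -> -1 < y < 1 -> -1 < slide k y < 1.
Proof.
move=> k0 /andP[h1 h2]; have d : 0 < k * (1 + y) + (1 - y).
  by apply: slide_den => //; rewrite !ltW.
have p : 0 < k * (1 + y) by rewrite mulr_gt0 //; lra.
by rewrite /slide ltr_pdivlMr // ltr_pdivrMr //; lra.
Qed.

Lemma log_height_slide (k y : R) : 0 < k -> -1 < y < 1 ->
  log_height (slide k y) = ln k + log_height y.
Proof.
move=> k0 /[dup] hy /andP[h1 h2]; rewrite /log_height -lnM ?posrE ?log_height_arg //.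
have d : 0 < k * (1 + y) + (1 - y) by apply: slide_den => //; rewrite !ltW.
have d1 : 0 < 1 - y by lra.
congr ln; rewrite /slide; set D := k * (1 + y) + (1 - y) in d *.
have -> : 1 + (k * (1 + y) - (1 - y)) / D = 2 * k * (1 + y) / D.
  by rewrite /D; field; rewrite gt_eqF.
have -> : 1 - (k * (1 + y) - (1 - y)) / D = 2 * (1 - y) / D.
  by rewrite /D; field; rewrite gt_eqF.
by field; rewrite !gt_eqF.
Qed.

Lemma height_map_strict (T T' : V3 -> R -> R) u y : height_map T T' ->
  -1 < y < 1 -> -1 < T u y < 1.
Proof.
move=> hT /andP[h1 h2]; have hy : -1 <= y <= 1 by rewrite !ltW.
have /andP[g1 g2] := hm_itv hT u hy; have K := hmK hT u hy.
have [e1 e2] := hm_end' hT u.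
rewrite !lt_neqAle g1 g2 !andbT; apply/andP; split; apply/eqP => e.
  by move: K; rewrite -e e2 => e'; rewrite e' ltxx in h1.
by move: K; rewrite e e1 => e'; rewrite e' ltxx in h2.
Qed.

(** The height in S^3 of a point at distance rho from the origin of R^3. *)
Definition stereo_height (rho : R) : R := (rho ^+ 2 - 1) / (rho ^+ 2 + 1).

Lemma stereo_height_strict (rho : R) : 0 < rho -> -1 < stereo_height rho < 1.
Proof.
move=> r0; have s0 : 0 < rho ^+ 2 by rewrite exprn_gt0.
have d : 0 < rho ^+ 2 + 1 by lra.
by rewrite /stereo_height ltr_pdivlMr // ltr_pdivrMr //; lra.
Qed.

Lemma cts_stereo_height (X : topologicalType) (A : set X) (rho : X -> R) :
  cts A rho -> cts A (fun x => stereo_height (rho x)).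
Proof.
move=> c; rewrite /stereo_height; apply: ctsM; first by ctst.
apply: ctsV; last by ctst.
by move=> x _; rewrite gt_eqF // ltr_wpDl ?sqr_ge0.
Qed.

Lemma positive_interpolation (I : finType) (pos : I -> V3) (b : I -> R) : injective pos ->
  (forall i, 0 < b i) ->
  exists f : V3 -> R, [/\ cts setT f, forall u, 0 < f u & forall i, f (pos i) = b i].
Proof.
move=> inj b0; have [f cf fE] := interpolation (fun i => ln (b i)) inj.
exists (fun u => expR (f u)); split.
- exact: cts_expR.
- by move=> u; exact: expR_gt0.
- by move=> i; rewrite fE lnK // posrE.
Qed.

(** A slide puts the two strands of each crossing at opposite heights, and then a
   stretching at the heights 1/2 and -1/2. *)
Lemma level_crossings (I : finType) (pos : I -> V3) (lo hi : I -> R) : injective pos ->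
  (forall i, 0 < lo i) -> (forall i, lo i < hi i) ->
  exists T T' : V3 -> R -> R, height_map T T' /\
    forall i, T (pos i) (stereo_height (hi i)) = 2^-1 /\
              T (pos i) (stereo_height (lo i)) = - 2^-1.
Proof.
move=> inj l0 lh; have h0 i : 0 < hi i by exact: lt_trans (l0 i) (lh i).
have d0 i : 0 < hi i - lo i by rewrite subr_gt0.
have s0 i : 0 < hi i + lo i by rewrite addr_gt0.
have [k [ck k0 kE]] := @positive_interpolation I pos (fun i => (lo i * hi i)^-1) inj
  ltac:(by move=> i; rewrite invr_gt0 mulr_gt0).
have [c [cc c0 cE]] := @positive_interpolation I pos (fun i => 2 * lo i / (hi i - lo i)) inj
  ltac:(by move=> i; rewrite divr_gt0 ?mulr_gt0).
have cks : cts (sphere 2) k by exact: cts_sub ck.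
have ccs : cts (sphere 2) c by exact: cts_sub cc.
have hT := height_map_comp (stretch_map c0 ccs) (slide_map k0 cks).
do 2 eexists; split; first exact: hT.
move=> i; rewrite /= kE cE /stereo_height; move: (l0 i) (h0 i) (d0 i) (s0 i).
move: (lo i) (hi i) => l h hl hh hd hs.
(* k = 1 / (l h) slides the heights of the two strands to z and - z *)
pose z := (h - l) / (h + l).
have sh2 : 2 * h + 2 * l != 0 by rewrite gt_eqF //; lra.
have z0 : 0 < z by rewrite divr_gt0.
have q1 : h ^+ 2 + 1 != 0 by rewrite gt_eqF // ltr_wpDl ?sqr_ge0.
have q2 : l ^+ 2 + 1 != 0 by rewrite gt_eqF // ltr_wpDl ?sqr_ge0.
have -> : slide (l * h)^-1 ((h ^+ 2 - 1) / (h ^+ 2 + 1)) = z.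
  rewrite /slide.
  have -> : 1 + (h ^+ 2 - 1) / (h ^+ 2 + 1) = 2 * h ^+ 2 / (h ^+ 2 + 1) by field.
  have -> : 1 - (h ^+ 2 - 1) / (h ^+ 2 + 1) = 2 / (h ^+ 2 + 1) by field.
  by rewrite /z; field; rewrite q1 sh2 !gt_eqF.
have -> : slide (l * h)^-1 ((l ^+ 2 - 1) / (l ^+ 2 + 1)) = - z.
  rewrite /slide.
  have -> : 1 + (l ^+ 2 - 1) / (l ^+ 2 + 1) = 2 * l ^+ 2 / (l ^+ 2 + 1) by field.
  have -> : 1 - (l ^+ 2 - 1) / (l ^+ 2 + 1) = 2 / (l ^+ 2 + 1) by field.
  by rewrite /z; field; rewrite q2 (addrC (2 * l)) sh2 !gt_eqF.
rewrite /stretch normrN (gtr0_norm z0).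
have -> : 1 + (2 * l / (h - l) - 1) * z = 4 * l / (h + l).
  by rewrite /z; field; rewrite !gt_eqF.
by rewrite /z; split; field; rewrite !gt_eqF.
Qed.

End Levels.

Section Invariance.
Context {R : realType}.
Local Notation V3 := ('rV[R]_3).
Variables (M : drawing R) (psi f : V3 -> V3) (Y : edge M -> R -> R).
Hypothesis mapM : is_map M.
Hypothesis fpsi : forall u, sphere 2 u -> f (psi u) = - f u.
Hypothesis psi_interior : forall (m : edge M) t, 0 < t < 1 ->
  exists (m' : edge M) t', 0 < t' < 1 /\ psi (earc m t) = earc m' t'.
Hypothesis cf : cts (sphere 2) f.
Hypothesis cY : forall m, cts (`[0, 1]%classic : set R) (Y m).
Hypothesis Yopp : forall (m : edge M) t (m' : edge M) t', 0 < t < 1 -> 0 < t' < 1 ->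
  psi (earc m t) = earc m' t' -> Y m' t' = - Y m t.

(** The crossings are reached by continuity: the union of the strands is closed. *)
Lemma strands_antipodal :
  let L := \bigcup_(m in [set: edge M]) ((fun t => cone (f (earc m t)) (Y m t)) @` `[0, 1]%classic) in
  antipode (n := 3) @` L = L.
Proof.
move=> L.
have ca (m : edge M) : cts (`[0, 1]%classic : set R) (fun t => cone (f (earc m t)) (Y m t)).
  apply: cts_cone; last exact: cY.
  have ce : cts (`[0, 1]%classic : set R) (earc m) by exact: (map_arc mapM).
  apply: (cts_comp cf ce) => t /itv01P ht.
  by apply: (map_sphere mapM); exact: arc_skeleton.
have clL : closed L.
  apply: compact_closed; first exact: hausdorff4.
  apply: compact_finite_union => m; apply: continuous_compact; first exact: ca.
  exact: segment_compact.
have NL x : L x -> L (- x).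
  move=> [m _ [t /itv01P ht <-]].
  have cN : cts (`[0, 1]%classic : set R) (fun t => - cone (f (earc m t)) (Y m t)).
    by apply: ctsN; exact: ca.
  apply: (closed_interval_limit cN clL) ht => {}t /[dup] ht /andP[t0 t1].
  have [m' [t' [ht' E]]] := psi_interior m ht.
  exists m' => //; exists t'; first by apply/itv01P; case/andP: ht' => *; rewrite !ltW.
  rewrite cone_opp -fpsi; last first.
    by apply: (map_sphere mapM); apply: arc_skeleton; rewrite !ltW.
  by rewrite E (Yopp ht ht' E).
apply/seteqP; split => [_ [x /NL Lx <-] //|x /NL Lx].
by exists (- x) => //; rewrite /antipode opprK.
Qed.

End Invariance.

(** * Symmetry of the link *)

Section Conjugate.
Context {R : realType}.
Local Notation V3 := ('rV[R]_3).
Variables (G M : drawing R) (phi g : V3 -> V3).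
Hypothesis mapG : is_map G.
Hypothesis mapM : is_map M.
Hypothesis phiI : homeo2 phi g.

(** The antipodal symmetry of the redrawn shadow, carried back to the shadow over
   which the link lies. *)
Definition antipodal_conjugate (x : V3) : V3 := g (- phi x).
Local Notation psi := antipodal_conjugate.

Lemma phi_conjugate x : sphere 2 x -> phi (psi x) = - phi x.
Proof. by case: phiI => [[_ sp] _ _ gK] sx; rewrite gK //; apply: sphereN; exact: sp. Qed.

Lemma homeo2_conjugate : homeo2 psi psi.
Proof.
have [mp mg pK gK] := phiI.
have mpsi : smap psi := smap_comp mg (smap_comp smapN mp).
have psiK x : sphere 2 x -> psi (psi x) = x.
  by move=> sx; rewrite {1}/antipodal_conjugate phi_conjugate // opprK pK.
by split.
Qed.

Lemma conjugate_nofix x : sphere 2 x -> psi x <> x.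
Proof.
move=> sx h; have := phi_conjugate sx; rewrite h => e.
have [mp _ _ _] := phiI; have := sphere_neq0 (mp.2 _ sx).
move/eqP; apply; apply/rowP => i; have /rowP/(_ i) := e; rewrite !mxE; lra.
Qed.

Lemma skeleton_redraw : skeleton (redraw phi M) = phi @` skeleton M.
Proof.
apply/seteqP; split => [x|_ [x [[v _ <-]|[m _ [t ht <-]]] <-]].
- case=> [[v _ <-]|[m _ [t ht <-]]]; first by exists (@vpos R M v) => //; left; exists v.
  by exists (@earc R M m t) => //; right; exists m => //; exists t.
- by left; exists v.
- by right; exists m => //; exists t.
Qed.

Hypothesis sym : antipode_invariant (redraw phi M).

Lemma conjugate_vertex (v : vertex M) : exists v' : vertex M, psi (vpos v) = vpos v'.
Proof.
have [mp mg pK gK] := phiI.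
have sv (w : vertex M) : sphere 2 (vpos w) by apply: (map_sphere mapM); left; exists w.
have : vertices (redraw phi M) (- phi (vpos v)).
  by rewrite -sym.1; exists (phi (vpos v)) => //; exists v.
by move=> [v' _ /= e]; exists v'; rewrite /antipodal_conjugate -e pK.
Qed.

Lemma conjugate_skeleton x : skeleton M x -> skeleton M (psi x).
Proof.
move=> sk; have [mp mg pK gK] := phiI.
have : skeleton (redraw phi M) (- phi x).
  by rewrite -sym.2; exists (phi x) => //; rewrite skeleton_redraw; exists x.
rewrite skeleton_redraw => -[y sy e].
by rewrite /antipodal_conjugate -e pK //; exact: (map_sphere mapM).
Qed.

Lemma conjugate_skeletonP x : sphere 2 x -> skeleton M x <-> skeleton M (psi x).
Proof.
move=> sx; split; first exact: conjugate_skeleton.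
by move/conjugate_skeleton; have [_ _ psiK _] := homeo2_conjugate; rewrite psiK.
Qed.

Hypothesis col : color_preserving (redraw phi G) (redraw phi M).

(** Homeomorphisms map faces to faces, so that the colours may be compared after
   redrawing. *)
Lemma conjugate_black x : sphere 2 x -> ~ skeleton M x ->
  black G (face_at M x) <-> black G (face_at M (psi x)).
Proof.
move=> sx nx; have [mp mg pK gK] := phiI.
have [mpsi _ psiK _] := homeo2_conjugate.
have faceS y z : face_at M y z -> sphere 2 z.
  by move=> h; have [] : (sphere 2 `\` skeleton M) z by exact: connected_component_sub h.
have sG (v : vertex G) : sphere 2 (vpos v) by apply: (map_sphere mapG); left; exists v.
have faceE y : sphere 2 y -> ~ skeleton M y ->
    face_at (redraw phi M) (phi y) = phi @` face_at M y.
  move=> sy ny; apply/esym/(homeo_component phiI); try by move=> z [].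
  - move=> z [sz nz]; split; first exact: mp.2.
    rewrite skeleton_redraw => -[w sw e]; apply: nz.
    by rewrite -(pK z) // -e pK //; exact: (map_sphere mapM).
  - move=> z [sz nz]; split; first exact: mg.2.
    by move=> sk; apply: nz; rewrite skeleton_redraw; exists (g z) => //; exact: gK.
  - by [].
have psiE : psi @` face_at M x = face_at M (psi x).
  apply: (homeo_component homeo2_conjugate); try by move=> z [].
  - by move=> z [sz nz]; split; [exact: mpsi.2|move/(conjugate_skeletonP sz)].
  - by move=> z [sz nz]; split; [exact: mpsi.2|move/(conjugate_skeletonP sz)].
  - by [].
have blackE y : black (redraw phi G) (phi @` face_at M y) <-> black G (face_at M y).
  split=> -[v]; last by move=> h; exists v; exists (vpos v).
  by move=> /= [z fz e]; exists v; rewrite -(pK (@vpos R G v)) // -e pK //; exact: faceS fz.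
have psx : sphere 2 (psi x) by exact: mpsi.2.
have npx : ~ skeleton M (psi x) by move/(conjugate_skeletonP sx).
have face : is_face (redraw phi M) (phi @` face_at M x).
  exists (phi x); last by rewrite faceE.
  split; first exact: mp.2.
  rewrite skeleton_redraw => -[w sw e]; apply: nx.
  by rewrite -(pK x) // -e pK //; exact: (map_sphere mapM).
have oppE : antipode (n := 2) @` (phi @` face_at M x) = phi @` face_at M (psi x).
  rewrite -psiE; apply/seteqP; split => [_ [_ [y fy <-] <-]|_ [_ [y fy <-] <-]].
    by exists (psi y); [exists y|rewrite phi_conjugate //; exact: faceS fy].
  by exists (phi y); [exists y|rewrite phi_conjugate //; exact: faceS fy].
by rewrite -blackE (col face) oppE blackE.
Qed.

Lemma conjugate_chart (v v' : vertex M) chi chi' z z' :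
  crossing_chart G v chi -> crossing_chart G v' chi' ->
  square z -> square z' -> psi (chi z) = chi' z' ->
  (`|z.1| = `|z.2| <-> `|z'.1| = `|z'.2|) /\ (`|z.1| < `|z.2| <-> `|z'.1| < `|z'.2|).
Proof.
case: z => x y; case: z' => x' y' [[_ _ s1] _ sk1 bl1] [_ _ sk2 bl2] sq sq' E.
have su : sphere 2 (chi (x, y)) by apply: s1; exists (x, y).
have skE : `|x| = `|y| <-> `|x'| = `|y'| by rewrite -sk1 // -sk2 // -E conjugate_skeletonP.
split => //=; case: (pselect (`|x| = `|y|)) => [e|ne].
  by rewrite e (skE.1 e) !ltxx.
have ne' : `|x'| <> `|y'| by move=> /skE.
by rewrite -bl1 // -bl2 // -E conjugate_black // sk1.
Qed.

End Conjugate.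

Theorem corollary8 (R : realType) (G M : drawing R) (p : edge G -> vertex M)
    (L : set 'rV[R]_4) (phi : 'rV[R]_3 -> 'rV[R]_3)
    (mapG : is_map G)
    (medM : is_medial p)
    (LG : link_of_map (fun _ : edge G => true) p L)
    (homeo_phi : sphere_homeo (n := 2) phi)
    (sym_phi : antipode_invariant (redraw phi M))
    (col_phi : color_preserving (redraw phi G) (redraw phi M)) :
  antipodally_symmetric3 L.
Proof.
have [_ [[mapM _ [q _ pq]] _ _ _]] := medM.
have [over [L0 [diag [rho [lo [hi [crho rho0 lohi rhoE L0E]]]] LE]]] := LG.
have [g [[sphi sg] cphi cg phiK gK]] := homeo_phi.
have phiI : homeo2 phi g.
  split; [by split|by split|by move=> x sx; apply: phiK; rewrite inE|].
  by move=> x sx; apply: gK; rewrite inE.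
pose psi := antipodal_conjugate phi g.
have psiI : homeo2 psi psi := homeo2_conjugate phiI.
have nofix := @conjugate_nofix _ _ _ phiI.
have psiV := conjugate_vertex mapM phiI sym_phi.
have psiS := conjugate_skeleton mapM phiI sym_phi.
have chartw w : exists chi : R * R -> 'rV[R]_3, crossing_chart G w chi /\
    forall (m : edge M) (s : bool), endpt m s = w ->
    exists2 d : R, 0 < d & forall t : R, 0 < t < 1 -> `|t - end_param R s| < d ->
      exists x y, [/\ square (x, y), earc m t = chi (x, y) & x = if over m s then y else - y].
  have [chi h1 h2] := diag (q w); rewrite pq in h1 h2.
  exists chi; split => // m s /h2[d d0 dP]; exists d => // t ht hd.
  have [x [y [h3 h4 h5]]] := dP t ht hd; exists x, y; split => //.
  by rewrite h5; case: (over m s).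
have [chi chiP] := choice chartw.
have oriented v := crossing_oriented (chiP v).1.
have strands (m : edge M) s := (chiP (endpt m s)).2 m s erefl.
have diags v v' z z' (_ : psi (vpos v) = vpos v') :=
  @conjugate_chart _ _ _ _ _ mapG mapM phiI sym_phi col_phi v v' (chi v) (chi v') z z' (chiP v).1 (chiP v').1.
(* The values of lo and hi attained by the strands are positive, but the others,
   if any, are arbitrary. *)
pose hi' v : R := if 0 < hi v then hi v else 1.
pose lo' v : R := if 0 < lo v then lo v else hi' v / 2.
have lo0 v : 0 < lo' v.
  rewrite /lo' /hi'; case: ifP => // _; case: ifP => h; lra.
have lohi' v : lo' v < hi' v.
  rewrite /lo' /hi'; have := lohi v; case: (ltP 0 (lo v)) => h1 h.
    by rewrite (lt_trans h1 h).
  by case: ifP => h2; lra.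
have rhoE' m s : rho m (end_param R s) = if over m s then hi' (endpt m s) else lo' (endpt m s).
  have e1 : 0 <= end_param R s <= 1 by case: s; rewrite /end_param /= ?lexx ?ler01.
  have := rho0 m _ e1; rewrite rhoE /hi' /lo'; case: (over m s) => h; by rewrite h.
(* The heights become 1/2 and -1/2 at the crossings. *)
have [T0 [T0' [hT0 T0E]]] := level_crossings (map_vpos mapM) lo0 lohi'.
pose y1 m t := T0 (earc m t) (stereo_height (rho m t)).
have y1_strict m t : 0 <= t <= 1 -> -1 < y1 m t < 1.
  by move=> ht; apply: (height_map_strict _ hT0); apply: stereo_height_strict; exact: rho0.
have y1E m s : y1 m (end_param R s) = if over m s then 2^-1 else - 2^-1.
  rewrite /y1 rhoE' (map_ends mapM); have [h1 h2] := T0E (endpt m s).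
  by case: (over m s).
pose S m t := log_height (y1 m t).
have ce (m : edge M) : cts (`[0, 1]%classic : set R) (earc m) := @map_arc _ _ mapM m.
have se (m : edge M) t : 0 <= t <= 1 -> sphere 2 (earc m t).
  by move=> ht; apply: (map_sphere mapM); exact: arc_skeleton.
have cy1 m : cts (`[0, 1]%classic : set R) (y1 m).
  have cr : cts (`[0, 1]%classic : set R) (rho m) := crho m.
  apply: (cts_comp (f := fun t => (earc m t, stereo_height (rho m t))) (hm_cts hT0)).
    by apply: cts_pair; [exact: ce|exact: cts_stereo_height].
  move=> t /itv01P ht; split; first exact: se.
  by apply/itv11P; have /andP[h1 h2] := stereo_height_strict (rho0 m t ht); rewrite !ltW.
have cS m : cts (`[0, 1]%classic : set R) (S m).
  apply: cts_ln => [t /itv01P ht|]; first by apply: log_height_arg; exact: y1_strict.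
  have cy := cy1 m; apply: ctsM; first by ctst.
  apply: ctsV; last by ctst.
  by move=> t /itv01P /(y1_strict m) /andP[_ h]; rewrite gt_eqF // subr_gt0.
have SE m s : S m (end_param R s) = if over m s then log_height 2^-1 else - log_height 2^-1.
  rewrite /S y1E; case: (over m s) => //; apply: log_heightN; lra.
(* They become opposite at u and psi u, after sliding by exp (B u). *)
have [B cB BE] := symmetric_heights mapM psiI nofix psiV psiS cS SE oriented strands diags.
pose k u := expR (B u).
have k0 u : 0 < k u := expR_gt0 _.
have ck : cts (sphere 2) k by apply: cts_expR; exact: cts_sub cB.
have hT := height_map_comp (slide_map k0 ck) hT0.
set T := fun u y => _ in hT; set T' := fun u y => _ in hT.
pose Y m t := slide (k (earc m t)) (y1 m t).
have Y_strict m t : 0 <= t <= 1 -> -1 < Y m t < 1.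
  by move=> ht; apply: slide_strict => //; exact: y1_strict.
have cY m : cts (`[0, 1]%classic : set R) (Y m).
  apply: (cts_comp (f := fun t => (earc m t, y1 m t)) (hm_cts (slide_map k0 ck))).
    by apply: cts_pair.
  move=> t /itv01P ht; split; first exact: se.
  by apply/itv11P; have /andP[h1 h2] := y1_strict m t ht; rewrite !ltW.
have Yopp (m : edge M) t (m' : edge M) t' : 0 < t < 1 -> 0 < t' < 1 ->
    psi (earc m t) = earc m' t' -> Y m' t' = - Y m t.
  move=> ht ht' E; have := BE m t m' t' ht ht' E.
  have i : 0 <= t <= 1 by case/andP: ht => *; rewrite !ltW.
  have i' : 0 <= t' <= 1 by case/andP: ht' => *; rewrite !ltW.
  move=> e; apply: log_height_inj; first exact: Y_strict.
    by have := Y_strict m t i; lra.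
  rewrite log_heightN ?Y_strict // !log_height_slide ?y1_strict // /k !expRK.
  exact: e.
(* Either phi or - phi is homotopic to the identity, and both turn psi into the
   antipodal map. *)
have [f [f' [fI idf fpsi]]] : exists f f', [/\ homeo2 f f', homotopic id f &
    forall u, sphere 2 u -> f (psi u) = - f u].
  have [h|h] := homeo_homotopic phiI.
    by exists phi, g; split => // u su; exact: phi_conjugate.
  exists (fun x => - phi x), (fun x => g (- x)); split => //.
    apply: homeo2_comp phiI => //; split; try exact: smapN; by move=> x _; rewrite opprK.
  by move=> u su; rewrite (phi_conjugate phiI).
have [mf _ _ _] := fI.
pose L' := \bigcup_(m in [set: edge M]) ((fun t => cone (f (earc m t)) (Y m t)) @` `[0, 1]%classic).
have L'E : susp f T @` L = L'.
  have im m t : 0 <= t <= 1 ->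
      susp f T (inv_stereo (rho m t *: earc m t)) = cone (f (earc m t)) (Y m t).
    move=> ht; rewrite stereo_cone ?rho0 //; last exact: se.
    rewrite susp_cone //; [exact: hm_end hT|exact: se|].
    by have /andP[h1 h2] := stereo_height_strict (rho0 m t ht); rewrite !ltW.
  rewrite LE L0E; apply/seteqP; split.
    move=> _ [_ [_ [m _ [t /itv01P ht <-]] <-] <-]; exists m => //.
    by exists t; [exact/itv01P|rewrite im].
  move=> _ [m _ [t /itv01P ht <-]]; rewrite -im //.
  do 2 (eexists; last reflexivity).
  by exists m => //; exists t => //; exact/itv01P.
exists L'; split.
- move=> _ [m _ [t /itv01P ht <-]]; apply: cone_sphere; first by apply: mf.2; exact: se.
  by have /andP[h1 h2] := Y_strict m t ht; rewrite !ltW.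
- exists (susp f T); split => //; first exact: susp_homeo fI hT.
  exact: susp_orientation mf idf hT.
- apply: (strands_antipodal mapM fpsi _ mf.1 cY Yopp) => m t ht.
  exact: (psi_interior mapM psiI psiV psiS).
Qed.
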